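(* Let $B$ be a body and let $P$ be the $G_{2B}$-structure on $B$, for $\alpha=0$, given by two one-dimensional distributions $L_1,L_2$ with $L_1\cap L_2=0$ at every point, a nowhere vanishing one-form $\omega$ such that $L_1\oplus L_2=\{\omega=0\}$, and a volume form $\Omega$. Then $P$ is integrable if and only if all of the following hold: the two-dimensional distribution $L_1\oplus L_2$ is involutive; $\tau(Y_1,Y_2,Y_3)=0$ for an arbitrary local frame $Y_1,Y_2,Y_3$ with $Y_1\in L_1$, $Y_2\in L_2$ and $\Omega(Y_1,Y_2,Y_3)=1$; and $d\omega=0$. Here $$\tau(Y_1,Y_2,Y_3)=Y_1(p)+Y_2(h)+p\,h-p\,q,$$ where the local functions $p,q,h$ are defined by $[Y_1,Y_2]=pY_1+qY_2$ and $\mathcal{L}_{Y_1}\Omega=h\,\Omega$.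
   Context: A body is a $3$-dimensional smooth manifold which can be covered with one chart. In this case $G_{2B}\subset GL(3,\mathbb{R})$ is the isotropy group of the subspaces $\langle e_2\rangle$, $\langle e_3\rangle$, the covector $e^1$ and the tensor $e^1\wedge e^2\wedge e^3$, where $(e_i)$ is the canonical basis of $\mathbb{R}^3$ and $(e^i)$ its dual basis. The corresponding $G_{2B}$-structure $P$ is the set of linear frames $(v_1,v_2,v_3)$ at points $x\in B$ such that $v_3$ spans $(L_1)_x$, $v_2$ spans $(L_2)_x$, $\omega(v_1)=1$ and $\Omega(v_1,v_2,v_3)=1$. A $G$-structure $P$ is integrable if around each point there are local coordinates whose coordinate frame is a section of $P$. $\mathcal{L}$ denotes the Lie derivative. *)

(* Defs.v *)
From HB Require Import structures.
From mathcomp Require Import all_boot all_order all_algebra.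
From mathcomp Require Import all_classical all_reals all_analysis.
Import numFieldNormedType.Exports.

Set Implicit Arguments.
Unset Strict Implicit.
Unset Printing Implicit Defensive.
Import Order.TTheory GRing.Theory Num.Theory.
Local Open Scope classical_set_scope.
Local Open Scope ring_scope.

(* f is of class C^n on D, meant for D open: f is C^(n+1) when it is
   differentiable with all directional derivatives of class C^n. *)
Fixpoint class_C (R : realType) (V W : normedModType R) (n : nat)
    (D : set V) (f : V -> W) : Prop :=
  if n is m.+1 then
    (forall x, D x -> differentiable f x) /\
    (forall v, class_C m D (fun x => 'd f x v))
  else forall x, D x -> {for x, continuous f}.

Definition smooth_on (R : realType) (V W : normedModType R)
    (D : set V) (f : V -> W) : Prop := forall n, class_C n D f.

(* A 3-manifold with a global chart, onto an open subset of R^3. The topology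
   and the smooth structure are those for which [chart] is a diffeomorphism
   onto its image. [param] is the inverse of [chart]; its values off the image
   are irrelevant. *)
Record body (R : realType) := Body {
  carrier :> Type;
  chart : carrier -> 'rV[R]_3;
  param : 'rV[R]_3 -> carrier;
  chartK : cancel chart param;
  open_range_chart : open (range chart) }.
Arguments chart {R b} _.
Arguments param {R b} _.

Section Body.
Context {R : realType} {B : body R}.

(* Every tangent space of B is identified with R^3 through the frame of the
   global chart, so that a vector field is a map X : B -> E. *)
Let E := 'rV[R]_3.

Definition body_open (U : set B) : Prop := open (chart @` U).

Definition body_smooth (W : normedModType R) (U : set B) (f : B -> W) : Prop :=
  smooth_on (chart @` U) (f \o param).

Definition body_diff (W : normedModType R) (f : B -> W) (x : B) (v : E) : W :=
  'd (f \o param) (chart x) v.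

Definition lie_bracket (X Y : B -> E) (x : B) : E :=
  body_diff Y x (X x) - body_diff X x (Y x).

Definition line_distribution (L : B -> {vspace E}) : Prop :=
  forall x, exists U : set B, exists Y : B -> E,
    [/\ body_open U, U x, body_smooth U Y
      & forall y, U y -> Y y != 0 /\ L y = <[Y y]>%VS].

Definition involutive_distribution (D : B -> {vspace E}) : Prop :=
  forall (U : set B) (X Y : B -> E),
    body_open U -> body_smooth U X -> body_smooth U Y ->
    (forall x, U x -> X x \in D x /\ Y x \in D x) ->
    forall x, U x -> lie_bracket X Y x \in D x.

Definition one_form (w : B -> E -> R) : Prop :=
  (forall x, scalar (w x)) /\
  (forall v, body_smooth setT (fun x => w x v)).

(* dw(X,Y) = X(w(Y)) - Y(w(X)) - w([X,Y]), evaluated on the constant extensions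
   of v1 and v2 in the global chart, which commute. *)
Definition ext_deriv (w : B -> E -> R) (x : B) (v1 v2 : E) : R :=
  body_diff (fun y => w y v2) x v1 - body_diff (fun y => w y v1) x v2.

Definition three_form (Om : B -> E -> E -> E -> R) : Prop :=
  [/\ forall x v2 v3, scalar (fun v1 => Om x v1 v2 v3),
      forall x v1 v3, scalar (fun v2 => Om x v1 v2 v3),
      forall x v1 v2, scalar (fun v3 => Om x v1 v2 v3),
      forall x u v, [/\ Om x u u v = 0, Om x u v u = 0 & Om x v u u = 0]
    & forall v1 v2 v3, body_smooth setT (fun x => Om x v1 v2 v3)].

Definition volume_form (Om : B -> E -> E -> E -> R) : Prop :=
  three_form Om /\ forall x, exists v1 v2 v3, Om x v1 v2 v3 <> 0.

(* (L_Y Om)(X1,X2,X3) = Y(Om(X1,X2,X3)) - Om([Y,X1],X2,X3) - Om(X1,[Y,X2],X3)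
   - Om(X1,X2,[Y,X3]), evaluated on the constant extensions of v1, v2, v3 in
   the global chart. *)
Definition lie_derivative (Y : B -> E) (Om : B -> E -> E -> E -> R)
    (x : B) (v1 v2 v3 : E) : R :=
  body_diff (fun y => Om y v1 v2 v3) x (Y x)
  - Om x (lie_bracket Y (cst v1) x) v2 v3
  - Om x v1 (lie_bracket Y (cst v2) x) v3
  - Om x v1 v2 (lie_bracket Y (cst v3) x).

(* [coord] is a diffeomorphism from the open set U onto an open subset of R^3,
   with inverse [coord_inv]; the values of both maps elsewhere are irrelevant. *)
Definition local_coordinates (U : set B) (coord : B -> E) (coord_inv : E -> B) :
    Prop :=
  [/\ body_open U, open (coord @` U),
      forall x, U x -> coord_inv (coord x) = x,
      body_smooth U coord
    & smooth_on (coord @` U) (chart \o coord_inv)].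

Definition coordinate_vector (coord : B -> E) (coord_inv : E -> B)
    (i : 'I_3) (x : B) : E :=
  'd (chart \o coord_inv : E -> E) (coord x) (delta_mx 0 i).

(* [P x] is a set of linear frames at x. *)
Definition integrable_structure (P : B -> set (E * E * E)) : Prop :=
  forall x, exists U : set B, exists coord : B -> E, exists coord_inv : E -> B,
    [/\ local_coordinates U coord coord_inv, U x
      & let e := coordinate_vector coord coord_inv in
        forall y, U y -> P y (e 0 y, e 1 y, e 2 y)].

Definition G2B_structure (L1 L2 : B -> {vspace E}) (w : B -> E -> R)
    (Om : B -> E -> E -> E -> R) (x : B) : set (E * E * E) :=
  [set v | let: (v1, v2, v3) := v in
    [/\ free [:: v1; v2; v3], L1 x = <[v3]>%VS, L2 x = <[v2]>%VS,
        w x v1 = 1 & Om x v1 v2 v3 = 1]].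

Definition tau (p q h : B -> R) (Y1 Y2 : B -> E) (x : B) : R :=
  body_diff p x (Y1 x) + body_diff h x (Y2 x) + p x * h x - p x * q x.

(* p, q, h are unique on U; they exist when the span of Y1, Y2 is involutive. *)
Definition tau_vanishes (L1 L2 : B -> {vspace E}) (Om : B -> E -> E -> E -> R) :
    Prop :=
  forall (U : set B) (Y1 Y2 Y3 : B -> E) (p q h : B -> R),
    body_open U ->
    body_smooth U Y1 -> body_smooth U Y2 -> body_smooth U Y3 ->
    body_smooth U p -> body_smooth U q -> body_smooth U h ->
    (forall x, U x ->
      [/\ Y1 x \in L1 x, Y2 x \in L2 x & Om x (Y1 x) (Y2 x) (Y3 x) = 1]) ->
    (forall x, U x -> lie_bracket Y1 Y2 x = p x *: Y1 x + q x *: Y2 x) ->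
    (forall x, U x -> forall v1 v2 v3,
      lie_derivative Y1 Om x v1 v2 v3 = h x * Om x v1 v2 v3) ->
    forall x, U x -> tau p q h Y1 Y2 x = 0.

End Body.

(* Main.v *)
(* When d omega = 0 the leaves of L1 + L2 are locally the level sets of a function F
   with dF = omega. Normalise T, Y2, Y1 by omega(T) = 1 and Omega(T, Y2, Y1) = 1, with
   Y1 in L1 and Y2 in L2, and let eta1, eta2 be dual to Y1, Y2 on the leaves. Then
   h = - q, and tau = 0 says that the form - q eta1 - p eta2 is closed on the leaves.
   If lam is a primitive of it along the leaves, exp(- lam) eta2 and exp(lam) eta1 are
   leafwise closed too, and their leafwise primitives f1, f2 complete F to flat
   coordinates (F, f1, f2). Thus only closed one-forms are integrated, and no
   differential equation is solved. Conversely tau is computed in flat coordinates. *)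
Require Import Defs.
From HB Require Import structures.
From mathcomp Require Import all_boot all_order all_algebra.
From mathcomp Require Import all_classical all_reals all_analysis.
From mathcomp Require Import ring lra.
Import numFieldNormedType.Exports.
Import Order.TTheory GRing.Theory Num.Theory.
Local Open Scope classical_set_scope.
Local Open Scope ring_scope.

Set Implicit Arguments.
Unset Strict Implicit.
Unset Printing Implicit Defensive.

(** * Calculus of maps of class C^n *)

(** For [Y1] in L1 and [Y2] in L2 one has [exp(-lam) Y1, exp(lam) Y2] = (p + Y2(lam)) Y1 + (q +
    Y1(lam)) Y2. The volume condition forces the two scaling factors to be reciprocal, so one
    function [lam] must satisfy both Y1(lam) = - q and Y2(lam) = - p for the rescaled fields to
    commute; tau = 0 is the compatibility condition of this overdetermined system. The identity h =
    - q holds because closedness of omega puts [Y1, T] in the plane of Y1 and Y2, where it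
    contributes nothing to Omega([Y1, T], Y2, Y1). Primitives along the leaves suffice: their
    transverse derivatives only change the coordinate vector e 0 by a vector tangent to the leaf,
    which alters neither omega(e 0) nor Omega(e 0, e 1, e 2), as e 1 and e 2 span the leaf. The
    transverse variable is a parameter that must be carried smoothly through the integration; hence
    the integrals along segments depending on a parameter, and the inverse function theorem, which
    both straightens the leaves and turns (F, f1, f2) into coordinates. *)

Lemma is_diff_littleoP (R : realType) (V W : normedModType R) (f : V -> W)
    (L : {linear V -> W}) (x : V) : continuous L ->
  (forall e : R, 0 < e ->
     \forall y \near x, `|f y - f x - L (y - x)| <= e * `|y - x|) ->
  differentiable f x /\ 'd f x = L :> (V -> W).
Proof.
move=> cL small.
have fE : f \o shift x = cst (f x) + L +o_ 0 id.
  apply/eqaddoP => e e0.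
  have sh : shift x h @[h --> 0] --> x.
    rewrite -[X in _ --> X](add0r x).
    by apply: cvgD; [exact: cvg_id|exact: cvg_cst].
  have := sh _ (small _ e0); rewrite /nbhs/=; apply: filterS => h /=.
  by rewrite addrK !fctE /= opprD addrA.
have dE := diff_unique cL fE; split=> //.
by apply/diff_locallyP; rewrite dE.
Qed.

Lemma diff_littleo (R : realType) (V W : normedModType R) (f : V -> W) (x : V)
    (e : R) : differentiable f x -> 0 < e ->
  \forall y \near x, `|f y - f x - 'd f x (y - x)| <= e * `|y - x|.
Proof.
move=> /diff_locallyP[cd] /eqaddoP H /H {}H.
have cvs : (fun y => y - x) @ x --> (0 : V).
  by rewrite -(subrr x); apply: cvgB; [exact: cvg_id|exact: cvg_cst].
have := cvs _ H; rewrite /nbhs/=; apply: filterS => y /=.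
by rewrite !fctE /= subrK opprD addrA.
Qed.

(** Most identities between maps below hold only on an open set; this is the tool for
    differentiating them. *)
Lemma near_eq_diff (R : realType) (V W : normedModType R) (f g : V -> W)
    (x : V) : (\near x, f x = g x) -> differentiable f x ->
  differentiable g x /\ 'd g x = 'd f x :> (V -> W).
Proof.
move=> fg df; apply: is_diff_littleoP.
  exact: diff_continuous.
move=> e e0; have := diff_littleo df e0; have fgx := nbhs_singleton fg.
by apply: filterS2 fg => y <-; rewrite -fgx.
Qed.

Section ClassC.
Context {R : realType}.
Implicit Types V W : normedModType R.

Lemma class_C_continuous V W n (D : set V) (f : V -> W) x :
  class_C n D f -> D x -> {for x, continuous f}.
Proof.
case: n => [|n]; first by move=> cf Dx; apply: cf.
by case=> df _ Dx; apply: differentiable_continuous; apply: df.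
Qed.

Lemma class_C_pred V W n (D : set V) (f : V -> W) :
  class_C n.+1 D f -> class_C n D f.
Proof.
elim: n f => [|n IH] f [df ddf].
  by move=> x /df/differentiable_continuous.
by split=> // v; apply: IH.
Qed.

Lemma class_C_sub V W n (D D' : set V) (f : V -> W) :
  D' `<=` D -> class_C n D f -> class_C n D' f.
Proof.
move=> DD; elim: n f => [|n IH] f; first by move=> h x /DD/h.
case=> df ddf; split=> [x Dx|v]; first by apply: df; exact: DD.
by apply: IH; exact: ddf.
Qed.

(** Openness of [D] turns equality on [D] into equality of germs, so the differentials also agree on
    [D] and the induction goes on. *)
Lemma class_C_ext V W n (D : set V) (f g : V -> W) : open D ->
  {in D, f =1 g} -> class_C n D f -> class_C n D g.
Proof.
move=> oD; elim: n f g => [|n IH] f g fg.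
  move=> cf x Dx; have fgx : {near x, f =1 g}.
    by near=> y; apply: fg; rewrite inE; near: y; exact: open_nbhs_nbhs.
  have := cf _ Dx; rewrite /prop_for /continuous_at (fg x (mem_set Dx)).
  by apply: cvg_trans; apply: near_eq_cvg; apply: filterS fgx => y ->.
case=> df ddf.
have fgx x : D x -> differentiable g x /\ 'd g x = 'd f x :> (V -> W).
  move=> Dx; apply: near_eq_diff (df _ Dx).
  by near=> y; apply: fg; rewrite inE; near: y; exact: open_nbhs_nbhs.
split=> [x /fgx[]//|v]; apply: IH (ddf v) => x; rewrite inE => /fgx[_ ->//].
Unshelve. all: by end_near. Qed.

Lemma class_C_cst V W n (D : set V) (a : W) : class_C n D (fun=> a).
Proof.
elim: n a => [|n IH] a; first by move=> x _; exact: cst_continuous.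
split=> [x _|v]; first exact: differentiable_cst.
have -> : (fun x : V => 'd (fun=> a) x v) = (fun=> 0); last exact: IH.
by apply/funext => x; rewrite (@diff_cst _ _ _ a).
Qed.

Lemma class_C_lin V W n (D : set V) (f : {linear V -> W}) :
  continuous f -> class_C n D f.
Proof.
move=> cf; case: n => [|n]; first by move=> x _; exact: cf.
split=> [x _|v]; first exact: linear_differentiable.
have -> : (fun x : V => 'd f x v) = (fun=> f v); last exact: class_C_cst.
by apply/funext => x; rewrite diff_lin.
Qed.

Lemma class_CD V W n (D : set V) (f g : V -> W) : open D ->
  class_C n D f -> class_C n D g -> class_C n D (fun x => f x + g x).
Proof.
move=> oD; elim: n f g => [|n IH] f g.
  by move=> cf cg x Dx; apply: cvgD; [exact: cf|exact: cg].
move=> [df ddf] [dg ddg]; split=> [x Dx|v].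
  by apply: differentiableD; [exact: df|exact: dg].
apply: class_C_ext (IH _ _ (ddf v) (ddg v)) => // x; rewrite inE => Dx.
by rewrite (@diffD _ _ _ f g) //; [exact: df|exact: dg].
Qed.

Lemma class_C_sum V W n (D : set V) I (r : seq I) (P : pred I) (f : I -> V -> W) : open D ->
  (forall i, P i -> class_C n D (f i)) ->
  class_C n D (fun x => \sum_(i <- r | P i) f i x).
Proof.
move=> oD cf; elim: r => [|i r IH].
  apply: class_C_ext (class_C_cst n D 0) => // x _.
  by rewrite big_nil.
case Pi : (P i).
  apply: class_C_ext (class_CD oD (cf i Pi) IH) => // x _.
  by rewrite big_cons Pi.
by apply: class_C_ext IH => // x _; rewrite big_cons Pi.
Qed.

Lemma class_CM V n (D : set V) (k f : V -> R) : open D ->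
  class_C n D k -> class_C n D f -> class_C n D (fun x => k x * f x).
Proof.
move=> oD; elim: n k f => [|n IH] k f.
  by move=> ck cf x Dx; apply: cvgM; [exact: ck|exact: cf].
move=> [dk ddk] [df ddf]; split=> [x Dx|v].
  by apply: differentiableM; [exact: dk|exact: df].
have := class_CD oD (IH _ _ (class_C_pred (conj dk ddk)) (ddf v))
  (IH _ _ (class_C_pred (conj df ddf)) (ddk v)).
apply: class_C_ext => // x; rewrite inE => Dx.
by rewrite (@diffM _ _ k f) //; [exact: dk|exact: df].
Qed.

End ClassC.

(** * Coordinates, composition, inverse and exponential in finite dimension *)

Section RowVectors.
Context {R : realType}.
Implicit Types (V W : normedModType R) (m n : nat).

Lemma norm_coord_le m (x : 'rV[R]_m) i : `|x 0 i| <= `|x|.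
Proof.
rewrite [leRHS]/Num.norm/= mx_normrE.
exact: (le_bigmax _ (fun ij : 'I_1 * 'I_m => `|x ij.1 ij.2|) (0, i)).
Qed.

Lemma norm_rV_le m (x : 'rV[R]_m) e :
  0 <= e -> (forall i, `|x 0 i| <= e) -> `|x| <= e.
Proof.
move=> e0 xe; rewrite [leLHS]/Num.norm/= mx_normrE.
by apply: bigmax_le => // -[i j] _ /=; rewrite ord1.
Qed.

Lemma linear_rV_sum W m (f : {linear 'rV[R]_m -> W}) v :
  f v = \sum_i v 0 i *: f (delta_mx 0 i).
Proof.
by rewrite [in LHS](row_sum_delta v) linear_sum; under eq_bigr do rewrite linearZ.
Qed.

Lemma linear_rV_continuous W m (f : {linear 'rV[R]_m -> W}) : continuous f.
Proof.
rewrite (_ : f = (fun v => \sum_i v 0 i *: f (delta_mx 0 i)) :> (_ -> _)).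
  move=> x; suff: class_C 0 setT (fun v : 'rV[R]_m => \sum_i v 0 i *: f (delta_mx 0 i)).
    by apply.
  apply: class_C_sum => [|i _ y _]; first exact: openT.
  apply: (@cvgZr_tmp _ _ _ (nbhs y)); exact: (@coord_continuous R 1 m 0 i y).
by apply/funext => v; exact: linear_rV_sum.
Qed.

Lemma coord_linear m i : linear (fun x : 'rV[R]_m => x 0 i : R).
Proof. by move=> a x y; rewrite !mxE. Qed.

(** Named so that a linear structure can be attached to it: taking a coordinate is then composition
    with a continuous linear map. *)
Definition coord_rV m i (x : 'rV[R]_m) : R := x 0 i.

HB.instance Definition _ m i := GRing.isLinear.Build R 'rV[R]_m R _
  (@coord_rV m i) (@coord_linear m i).

Lemma diff_coord V m (f : V -> 'rV[R]_m) x i : differentiable f x ->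
  differentiable (fun y => f y 0 i) x /\
  forall v, 'd (fun y => f y 0 i) x v = 'd f x v 0 i.
Proof.
move=> df; have lc : continuous (@coord_rV m i) by exact: linear_rV_continuous.
have dc := linear_differentiable (f x) lc.
rewrite -/((@coord_rV m i) \o f); split; first exact: differentiable_comp.
by move=> v; rewrite diff_comp //= diff_lin.
Qed.

Lemma diff_rV V m (f : V -> 'rV[R]_m) x :
  (forall i, differentiable (fun y => f y 0 i) x) -> differentiable f x.
Proof.
move=> df; have -> : f = \sum_i (fun y => f y 0 i *: delta_mx 0 i).
  by apply/funext => y; rewrite fct_sumE {1}(row_sum_delta (f y)).
by apply: differentiable_sum => i; apply: differentiableZl.
Qed.

Lemma class_C_coord V m n (D : set V) (f : V -> 'rV[R]_m) i : open D ->
  class_C n D f -> class_C n D (fun y => f y 0 i).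
Proof.
move=> oD; elim: n f => [|n IH] f.
  move=> cf x Dx; apply: (@continuous_comp _ _ _ f (@coord_rV m i)); first exact: cf.
  exact: coord_continuous.
move=> [df ddf]; split=> [x Dx|v].
  by have [] := diff_coord i (df x Dx).
apply: class_C_ext (IH _ (ddf v)) => // x; rewrite inE => Dx.
by have [_ ->] := diff_coord i (df x Dx).
Qed.

Lemma class_C_rV V m n (D : set V) (f : V -> 'rV[R]_m) : open D ->
  (forall i, class_C n D (fun y => f y 0 i)) -> class_C n D f.
Proof.
move=> oD; elim: n f => [|n IH] f cf.
  have -> : f = (fun y => \sum_i f y 0 i *: delta_mx 0 i).
    by apply/funext => y; rewrite {1}(row_sum_delta (f y)).
  apply: (class_C_sum (n := 0)) => // i _ x Dx.
  by apply: cvgZr_tmp; exact: cf.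
have df x : D x -> differentiable f x.
  by move=> Dx; apply: diff_rV => i; case: (cf i) => /(_ x Dx).
split=> // v; apply: IH => i; case: (cf i) => _ /(_ v).
apply: class_C_ext => // x; rewrite inE => Dx.
by have [_ ->] := diff_coord i (df x Dx).
Qed.

(** The direction ['d f x v] moves with [x], whereas [class_C] differentiates along fixed vectors.
    Expanding it in the basis turns the chain rule into a finite sum of products, to which the
    induction hypothesis applies. *)
Lemma class_C_comp V m n (D : set V) (D' : set 'rV[R]_m) (f : V -> 'rV[R]_m)
    (g : 'rV[R]_m -> R) : open D -> open D' -> (forall x, D x -> D' (f x)) ->
  class_C n D f -> class_C n D' g -> class_C n D (g \o f).
Proof.
move=> oD oD' fD; elim: n g => [|n IH] g.
  move=> cf cg x Dx; apply: continuous_comp; first exact: cf.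
  exact/cg/fD.
move=> Cf; have [df ddf] := Cf; move=> [dg ddg]; split=> [x Dx|v].
  by apply: (@differentiable_comp _ _ _ _ f g); [exact: df|apply: dg; exact: fD].
suff : class_C n D (fun x => \sum_i 'd f x v 0 i * 'd g (f x) (delta_mx 0 i)).
  apply: class_C_ext => // x; rewrite inE => Dx.
  rewrite (@diff_comp _ _ _ _ f g) /=; [|exact: df|by apply: dg; exact: fD].
  by rewrite [RHS]linear_rV_sum.
apply: class_C_sum => // i _; apply: class_CM => //.
  by apply: class_C_coord => //; exact: ddf.
by apply: (IH (fun x => 'd g x (delta_mx 0 i))); [exact: class_C_pred|exact: ddg].
Qed.

Lemma class_C_comp_rV V m k n (D : set V) (D' : set 'rV[R]_m)
    (f : V -> 'rV[R]_m) (g : 'rV[R]_m -> 'rV[R]_k) :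
  open D -> open D' -> (forall x, D x -> D' (f x)) ->
  class_C n D f -> class_C n D' g -> class_C n D (g \o f).
Proof.
move=> oD oD' fD Cf Cg; apply: class_C_rV => // i.
apply: (class_C_comp oD oD' fD Cf (g := fun y => g y 0 i)).
exact: class_C_coord.
Qed.

(** The derivative of 1/f is - (1/f)^2 df, so regularity of 1/f at one level gives the next one. *)
Lemma class_CV V n (D : set V) (f : V -> R) : open D ->
  (forall x, D x -> f x != 0) -> class_C n D f ->
  class_C n D (fun x => (f x)^-1).
Proof.
move=> oD f0; elim: n => [|n IH].
  by move=> cf x Dx; apply: cvgV; [exact: f0|exact: cf].
move=> Cf; have [df ddf] := Cf; split=> [x Dx|v].
  by apply: differentiableV; [exact: df|exact: f0].
have Cfi := IH (class_C_pred Cf).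
have := class_CM oD (class_C_cst n D (-1 : R)) (class_CM oD (class_CM oD Cfi Cfi) (ddf v)).
apply: class_C_ext => // x; rewrite inE => Dx.
rewrite (@diffV _ _ f); [|exact: df|exact: f0].
by rewrite /= mulN1r -mulNr -invfM -expr2.
Qed.

Lemma class_C_expR V n (D : set V) (f : V -> R) : open D ->
  class_C n D f -> class_C n D (fun x => expR (f x)).
Proof.
move=> oD; elim: n => [|n IH].
  by move=> cf x Dx; apply: (@continuous_comp _ _ _ f expR); [exact: cf|exact: continuous_expR].
move=> Cf; have [df ddf] := Cf.
have de (y : R) : differentiable (expR : R -> R) y.
  by apply/derivable1_diffP; exact: derivable_expR.
split=> [x Dx|v].
  by apply: (@differentiable_comp _ _ _ _ f expR); [exact: df|exact: de].
have := class_CM oD (ddf v) (IH (class_C_pred Cf)).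
apply: class_C_ext => // x; rewrite inE => Dx.
rewrite (_ : (fun y => expR (f y)) = expR \o f) // (@diff_comp _ _ _ _ f expR) //=; last exact: df.
by rewrite diff1E // derive1E derive_val.
Qed.

End RowVectors.

(** * Differentiation rules evaluated at a vector *)

Section PointwiseDiff.
Context {R : realType}.
Implicit Types V W : normedModType R.

Lemma diff_compE (U : normedModType R) V W (f : V -> W) (g : W -> U) x v :
  differentiable f x -> differentiable g (f x) ->
  'd (fun y => g (f y)) x v = 'd g (f x) ('d f x v).
Proof. by move=> df dg; exact: (congr1 (@^~ v) (diff_comp df dg)). Qed.

Lemma diff_linE V W (L : {linear V -> W}) x v : continuous L -> 'd L x v = L v.
Proof. by move=> cL; exact: (congr1 (@^~ v) (diff_lin x cL)). Qed.

Lemma diff_cstE V W (c : W) (x v : V) : 'd (fun=> c) x v = 0.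
Proof. exact: (congr1 (@^~ v) (diff_cst c x)). Qed.

Lemma diffDE V W (f g : V -> W) x v : differentiable f x -> differentiable g x ->
  'd (fun y => f y + g y) x v = 'd f x v + 'd g x v.
Proof. by move=> df dg; exact: (congr1 (@^~ v) (diffD df dg)). Qed.

Lemma diffBE V W (f g : V -> W) x v : differentiable f x -> differentiable g x ->
  'd (fun y => f y - g y) x v = 'd f x v - 'd g x v.
Proof. by move=> df dg; exact: (congr1 (@^~ v) (diffB df dg)). Qed.

Lemma diffME V (f g : V -> R) x v : differentiable f x -> differentiable g x ->
  'd (fun y => f y * g y) x v = f x * 'd g x v + g x * 'd f x v.
Proof. by move=> df dg; exact: (congr1 (@^~ v) (diffM df dg)). Qed.

Lemma diffMcE V (k : R) (f : V -> R) x v : differentiable f x ->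
  'd (fun y => k * f y) x v = k * 'd f x v.
Proof. by move=> df; exact: (congr1 (@^~ v) (diffZ k df)). Qed.

End PointwiseDiff.

(** * Mean value theorem and symmetry of second derivatives *)

Section MeanValue.
Context {R : realType}.
Implicit Types V W : normedModType R.

Lemma diff_affine V W (f : V -> W) (L : {linear V -> W}) x : continuous L ->
  (forall y, f y = f x + L (y - x)) ->
  differentiable f x /\ 'd f x = L :> (V -> W).
Proof.
move=> cL fE; apply: is_diff_littleoP => // e e0; near=> y.
by rewrite (fE y) addrAC addrK subrr normr0 mulr_ge0 // ltW.
Unshelve. all: by end_near. Qed.

Lemma diff_line V (x h : V) (t : R) :
  differentiable (fun s : R => x + s *: h) t /\
  'd (fun s : R => x + s *: h) t = ( *:%R^~ h) :> (R -> V).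
Proof.
pose d (s : R) := s *: h.
have dlin : linear d by move=> a u v; rewrite /d scalerDl scalerA.
pose L : {linear _ -> _} := HB.pack d (GRing.isLinear.Build _ _ _ _ _ dlin).
rewrite -[ *:%R^~ h]/(L : R -> V).
apply: diff_affine => [|s]; first exact: scalel_continuous.
by rewrite /L /= /d scalerBl addrA addrAC addrK.
Qed.

Lemma diff_shift V (w x : V) :
  differentiable (fun y => y + w) x /\ 'd (fun y => y + w) x = id :> (V -> V).
Proof.
rewrite -[id]/(idfun : V -> V).
apply: diff_affine; first by move=> y; exact: cvg_id.
by move=> y /=; rewrite [RHS]addrC addrA subrK.
Qed.

Lemma MVT_line V (f : V -> R) x h :
  (forall t : R, 0 <= t <= 1 -> differentiable f (x + t *: h)) ->
  exists2 t : R, 0 <= t <= 1 & f (x + h) - f x = 'd f (x + t *: h) h.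
Proof.
move=> df; pose g (t : R) := x + t *: h.
have dg := diff_line x h.
have dfg (t : R) : 0 <= t <= 1 -> is_derive t 1 (f \o g) ('d f (g t) h).
  move=> t01; have fgt : differentiable (f \o g) t.
    by apply: (@differentiable_comp _ _ _ _ g f); [exact: (dg t).1|exact: df].
  apply: DeriveDef; first exact: diff_derivable.
  rewrite deriveE // (@diff_comp _ _ _ _ g f) /=; last exact: df.
    by rewrite (dg t).2 scale1r.
  exact: (dg t).1.
have [||t] := @MVT_segment R (f \o g) (fun t => 'd f (g t) h) 0 1 ler01.
- by move=> t; rewrite in_itv/= => /andP[t0 t1]; apply: dfg; rewrite !ltW.
- apply: continuous_in_subspaceT => t; rewrite inE/= in_itv/= => t01.
  have /dfg[+ _] := t01; move=> /derivable1_diffP; exact: differentiable_continuous.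
rewrite in_itv/= subr0 mulr1 /g scale1r scale0r addr0 => t01 E.
by exists t.
Qed.

(** Two mean value steps: along [v] for the increment [F] of [f] by [w], then along [w] for the
    derivative of [f] in the direction [v]. *)
Lemma second_difference V (D : set V) (f : V -> R) x v w :
  class_C 2 D f ->
  (forall a b : R, 0 <= a <= 1 -> 0 <= b <= 1 -> D (x + a *: v + b *: w)) ->
  exists a b : R, [/\ 0 <= a <= 1, 0 <= b <= 1 &
    f (x + v + w) - f (x + v) - (f (x + w) - f x) =
    'd (fun y => 'd f y v) (x + a *: v + b *: w) w].
Proof.
move=> [df ddf] xD; pose F y := f (y + w) - f y.
have dF (a : R) : 0 <= a <= 1 -> differentiable F (x + a *: v) /\
    'd F (x + a *: v) v = 'd f (x + a *: v + w) v - 'd f (x + a *: v) v.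
  move=> a01; have d0 : differentiable f (x + a *: v).
    by apply: df; rewrite -[X in D X]addr0 -(scale0r w); apply: xD; rewrite ?lexx ?ler01.
  have d1 : differentiable f (x + a *: v + w).
    by apply: df; rewrite -[X in _ + X]scale1r; apply: xD; rewrite ?lexx ?ler01.
  have d2 : differentiable (fun y => f (y + w)) (x + a *: v).
    apply: (@differentiable_comp _ _ _ _ (fun y : V => y + w) f); last exact: d1.
    exact: (diff_shift _ _).1.
  split; first exact: differentiableB.
  rewrite (@diffB _ _ _ (fun y => f (y + w)) f) //=; congr (_ - _).
  rewrite (@diff_comp _ _ _ _ (fun y : V => y + w) f) //=.
  by rewrite (diff_shift _ _).2.
have [a a01 ->] := MVT_line (fun a a01 => (dF a a01).1).
rewrite (dF a a01).2.
have [|b b01 ->] := @MVT_line _ (fun y => 'd f y v) (x + a *: v) w.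
  by move=> b b01; have [+ _] := ddf v; apply; exact: xD.
by exists a, b.
Qed.

(** The second difference is symmetric in its two increments, so the two mixed derivatives coincide
    at suitable points of an arbitrarily small parallelogram; continuity carries the equality to [x]
    up to any [e]. *)
Lemma diff_symmetric V (D : set V) (f : V -> R) x v w :
  open D -> D x -> class_C 2 D f ->
  'd (fun y => 'd f y v) x w = 'd (fun y => 'd f y w) x v.
Proof.
move=> oD Dx Cf.
pose A y := 'd (fun y => 'd f y v) y w.
pose B y := 'd (fun y => 'd f y w) y v.
have [cA cB] : {for x, continuous A} /\ {for x, continuous B}.
  by case: Cf => _ ddf; split; [case: (ddf v) => _ /(_ w x Dx)|case: (ddf w) => _ /(_ v x Dx)].
apply/eqP; rewrite -subr_eq0 -normr_le0; apply/ler_addgt0Pl => e e0.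
rewrite addr0.
have e20 : 0 < e / 2 by rewrite divr_gt0.
have : \forall y \near x, D y /\ (`|A x - A y| < e / 2 /\ `|B x - B y| < e / 2).
  move/cvgrPdist_lt: cA => /(_ _ e20) nA; move/cvgrPdist_lt: cB => /(_ _ e20) nB.
  by have nD := open_nbhs_nbhs (conj oD Dx); apply: filterI nD (filterI nA nB).
move=> /nbhs_ballP[r /= r0 rP].
(* The sides are shrunk so that the parallelogram stays in the ball: t (1 + |v| + |w|) = r / 2. The
   summand 1 keeps the denominator positive when both vectors vanish. *)
pose t := r / (2 * (1 + `|v| + `|w|)).
have M0 : 0 < 1 + `|v| + `|w| by rewrite ltr_wpDr// ltr_wpDr.
have t0 : 0 < t by rewrite divr_gt0// mulr_gt0.
have inb (a b : R) : 0 <= a <= 1 -> 0 <= b <= 1 ->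
    ball x r (x + a *: (t *: v) + b *: (t *: w)).
  move=> /andP[a0 a1] /andP[b0 b1].
  rewrite -ball_normE /= -addrA opprD addrA subrr add0r normrN.
  have -> : a *: (t *: v) + b *: (t *: w) = t *: (a *: v + b *: w).
    by rewrite scalerDr !scalerA (mulrC t a) (mulrC t b).
  rewrite normrZ gtr0_norm//.
  apply: (@le_lt_trans _ _ (t * (1 + `|v| + `|w|))).
    rewrite ler_pM2l// (le_trans (ler_normD _ _))// !normrZ !ger0_norm//.
    apply: (@le_trans _ _ (`|v| + `|w|)); first by rewrite lerD// ler_piMl.
    by rewrite -addrA lerDr.
  rewrite /t invfM mulrA -mulrA mulVf ?gt_eqF// mulr1.
  by rewrite ltr_pdivrMr// ltr_pMr// ltr1n.
have [a [b [a01 b01 E1]]] := second_difference (class_C_sub (fun y hy => (rP y hy).1) Cf) inb.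
have [a' [b' [a01' b01' E2]]] : exists a b : R, [/\ 0 <= a <= 1, 0 <= b <= 1 &
    f (x + t *: w + t *: v) - f (x + t *: w) - (f (x + t *: v) - f x) =
    'd (fun y => 'd f y (t *: w)) (x + a *: (t *: w) + b *: (t *: v)) (t *: v)].
  apply: (second_difference (D := ball x r)) => [|a' b' h1 h2].
    exact: (class_C_sub (fun y hy => (rP y hy).1) Cf).
  by rewrite addrAC; exact: inb.
have scale_diff u z : D z -> 'd (fun y => 'd f y (t *: u)) z =
    t \*: 'd (fun y => 'd f y u) z :> (V -> R).
  move=> Dz; have -> : (fun y => 'd f y (t *: u)) = t \*: (fun y => 'd f y u).
    by apply/funext => y; rewrite linearZ.
  by rewrite diffZ //; case: Cf => _ /(_ u)[+ _]; exact.
have [Dz1 [zA _]] := rP _ (inb _ _ a01 b01).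
have [Dz2 [_ zB]] := rP _ (inb _ _ b01' a01').
rewrite addrAC in Dz2 zB.
rewrite scale_diff //= linearZ /= in E1; rewrite scale_diff //= linearZ /= in E2.
rewrite -/(A _) in E1; rewrite -/(B _) in E2.
rewrite -/(A _) -/(B _).
(* Both expressions of the second difference carry the factor t^2, which is cancelled one [t] at a
   time. *)
have AB : A (x + a *: (t *: v) + b *: (t *: w)) = B (x + a' *: (t *: w) + b' *: (t *: v)).
  have t_neq0 : t != 0 by rewrite gt_eqF.
  apply: (mulfI t_neq0); apply: (mulfI t_neq0).
  apply: (etrans (esym E1)); apply: (etrans _ E2).
  by rewrite (addrAC x (t *: w)); ring.
rewrite -AB in zB.
rewrite (le_trans (ler_distD (A (x + a *: (t *: v) + b *: (t *: w))) _ _)) //.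
by rewrite (splitr e) lerD // ?ltW // distrC.
Unshelve. all: by end_near. Qed.

End MeanValue.

(** * Inverse function theorem *)

Section SmoothMatrices.
Context {R : realType} {V : normedModType R}.

Lemma class_C_prod n (D : set V) I (r : seq I) (f : I -> V -> R) : open D ->
  (forall i, class_C n D (f i)) -> class_C n D (fun x => \prod_(i <- r) f i x).
Proof.
move=> oD cf; elim: r => [|i r IH].
  apply: class_C_ext (class_C_cst n D (1 : R)) => // x _.
  by rewrite big_nil.
apply: class_C_ext (class_CM oD (cf i) IH) => // x _.
by rewrite big_cons.
Qed.

Lemma class_C_det n (D : set V) m (A : V -> 'M[R]_m) : open D ->
  (forall i j, class_C n D (fun x => A x i j)) ->
  class_C n D (fun x => \det (A x)).
Proof.
move=> oD CA; apply: class_C_sum => // s _; apply: class_CM => //.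
  exact: class_C_cst.
exact: class_C_prod.
Qed.

(** By Cramer's rule each entry of the inverse is a cofactor divided by the determinant. *)
Lemma class_C_invmx n (D : set V) m (A : V -> 'M[R]_m) i j : open D ->
  (forall x, D x -> A x \in unitmx) ->
  (forall i j, class_C n D (fun x => A x i j)) ->
  class_C n D (fun x => invmx (A x) i j).
Proof.
move=> oD Au CA.
suff : class_C n D (fun x => (\det (A x))^-1 *
    ((-1) ^+ (j + i) * \det (row' j (col' i (A x))))).
  apply: class_C_ext => // x; rewrite inE => Dx.
  by rewrite /invmx Au // !mxE.
apply: class_CM => //.
  apply: class_CV => //; last exact: class_C_det.
  by move=> x /Au; rewrite unitmxE unitfE.
apply: class_CM => //; first exact: class_C_cst.
apply: class_C_det => // i' j'.
apply: class_C_ext (CA (lift j i') (lift i j')) => // x _.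
by rewrite !mxE.
Qed.

End SmoothMatrices.

Section InverseFunction.
Context {R : realType} {n : nat}.
Local Notation E := 'rV[R]_n.
Implicit Types (D U : set E) (f g : E -> E) (a x v : E).

(** Transposed from the usual convention: vectors are rows and the matrix acts on the right. *)
Definition jacobian_mx f x : 'M[R]_n := \matrix_i 'd f x (delta_mx 0 i).

Lemma mul_jacobian_mx f x v : v *m jacobian_mx f x = 'd f x v.
Proof.
rewrite [RHS]linear_rV_sum mulmx_sum_row.
by apply: eq_bigr => i _; rewrite rowK.
Qed.

Lemma jacobian_mx_unit f x :
  (forall v, 'd f x v = 0 -> v = 0) -> jacobian_mx f x \in unitmx.
Proof.
move=> inj; rewrite -row_free_unit -kermx_eq0; apply/eqP/row_matrixP => i.
rewrite row0; apply: inj; rewrite -mul_jacobian_mx -row_mul.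
by rewrite mulmx_ker row0.
Qed.

Lemma diff_near_identity D f a : open D -> D a -> class_C 1 D f ->
    'd f a = id :> (E -> E) ->
  exists2 r : R, 0 < r & ball a r `<=` D /\
    forall x v, ball a r x -> `|'d f x v - v| <= 2^-1 * `|v|.
Proof.
move=> oD Da [df ddf] dfa.
(* Each of the [n] basis directions may contribute [e], for a total of at most 1/2; [n.+1] avoids a
   zero denominator. *)
pose e : R := (2 * n.+1%:R)^-1.
have e0 : 0 < e by rewrite invr_gt0 mulr_gt0.
have near_i i : \forall x \near a, `|'d f a (delta_mx 0 i) - 'd f x (delta_mx 0 i)| < e.
  by have /cvgrPdist_lt/(_ _ e0) := ddf (delta_mx 0 i) a Da.
have : \forall x \near a, D x /\ forall i, `|'d f a (delta_mx 0 i) - 'd f x (delta_mx 0 i)| < e.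
  apply: filterI; first exact: open_nbhs_nbhs.
  exact: (@filter_forall _ _ (fun i x =>
    `|'d f a (delta_mx 0 i) - 'd f x (delta_mx 0 i)| < e)) near_i.
move=> /nbhs_ballP[r /= r0 rP]; exists r => //; split=> [x /rP[]//|x v /rP[_ xP]].
have -> : 'd f x v - v = \sum_i v 0 i *: ('d f x (delta_mx 0 i) - 'd f a (delta_mx 0 i)).
  have dfav : 'd f a v = v by exact: (congr1 (fun h : E -> E => h v) dfa).
  apply: (@etrans _ _ ('d f x v - 'd f a v)).
    by congr (_ - _); rewrite dfav.
  rewrite [X in X - _](linear_rV_sum ('d f x)) [X in _ - X](linear_rV_sum ('d f a)).
  by rewrite -sumrB; apply: eq_bigr => i _; rewrite scalerBr.
rewrite (le_trans (ler_norm_sum _ _ _)) //.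
apply: (@le_trans _ _ (\sum_(i < n) `|v| * e)).
  apply: ler_sum => i _; rewrite normrZ ler_pM //; first exact: norm_coord_le.
  by rewrite distrC ltW.
have en : e * n%:R <= 2^-1.
  by rewrite /e invfM -mulrA ler_piMr // mulrC ler_pdivrMr // mul1r ler_nat leqnSn.
by rewrite sumr_const card_ord -mulrnAr mulrC -[e *+ n]mulr_natr ler_wpM2r.
Qed.

(** The mean value theorem concerns real functions, so each coordinate gets its own intermediate
    point; the bound on ['d f] is uniform on the ball, and the sup norm reassembles the
    coordinates. *)
Lemma near_identity_lipschitz a (r : R) f :
  (forall x, ball a r x -> differentiable f x) ->
  (forall x v, ball a r x -> `|'d f x v - v| <= 2^-1 * `|v|) ->
  forall x y, ball a r x -> ball a r y ->
    `|f y - f x - (y - x)| <= 2^-1 * `|y - x|.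
Proof.
move=> df dfv x y bx by_; apply: norm_rV_le => [|i]; first by rewrite mulr_ge0.
have seg (t : R) : 0 <= t <= 1 -> ball a r (x + t *: (y - x)).
  move=> /andP[t0 t1]; move: bx by_; rewrite -!ball_normE /= => bx by_.
  have -> : a - (x + t *: (y - x)) = (1 - t) *: (a - x) + t *: (a - y).
    by apply/rowP => k; rewrite !mxE; ring.
  rewrite (le_lt_trans (ler_normD _ _)) // !normrZ !ger0_norm ?subr_ge0 //.
  have [->|tn0] := eqVneq t 0; first by rewrite subr0 mul1r mul0r addr0.
  have -> : r = (1 - t) * r + t * r by ring.
  by rewrite ler_ltD // ?ler_wpM2l ?subr_ge0 ?(ltW bx)// ltr_pM2l // lt0r tn0.
have dfi (t : R) : 0 <= t <= 1 -> differentiable (fun z => f z 0 i) (x + t *: (y - x)).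
  by move=> /seg/df/(diff_coord i)[].
have [t t01] := MVT_line dfi; rewrite [x + (y - x)]addrC subrK => fE.
rewrite !mxE fE ((diff_coord i (df _ (seg _ t01))).2).
apply: le_trans (dfv _ (y - x) (seg _ t01)).
apply: le_trans (norm_coord_le _ i).
by rewrite !mxE.
Qed.

End InverseFunction.

(** Gives matrices the completeness that the contraction principle asks for. *)
HB.instance Definition _ (R : realType) m n :=
  Complete.copy 'M[R]_(m, n) 'M[R]_(m, n).

Section LocalDiffeomorphism.
Context {R : realType} {n : nat}.
Local Notation E := 'rV[R]_n.
Implicit Types (D U : set E) (f g : E -> E) (a x v : E).

(** Solving f(x) = y amounts to finding a fixed point of x + (y - f(x)), a contraction of ratio 1/2.
    It maps the closed ball of radius [r] about [x0] into itself as soon as |y - f(x0)| < r / 2. *)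
Lemma near_identity_open_image U f : open U ->
  (forall x y, U x -> U y -> `|f y - f x - (y - x)| <= 2^-1 * `|y - x|) ->
  open (f @` U).
Proof.
move=> oU lipf; rewrite openE => _ [x0 Ux0 <-].
have [r /= r0 rU] : exists2 r : R, 0 < r & closed_ball x0 r `<=` U.
  have := open_nbhs_nbhs (conj oU Ux0); rewrite nbhs_closedballP => -[r rU].
  by exists r%:num.
rewrite closed_ballE // in rU.
apply/nbhs_ballP; exists (r / 2) => /=; first by rewrite divr_gt0.
move=> y; rewrite -ball_normE /= => yr.
pose K := closed_ball_ Num.norm x0 r.
have phiK x : K x -> K (x + (y - f x)).
  move=> Kx; have Ux := rU _ Kx; rewrite /K /closed_ball_ /=.
  have -> : x0 - (x + (y - f x)) = (f x0 - y) + (f x - f x0 - (x - x0)).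
    by apply/rowP => k; rewrite !mxE; ring.
  rewrite (le_trans (ler_normD _ _)) // [leRHS](splitr r) lerD ?(ltW yr) //.
  rewrite (le_trans (lipf _ _ _ _)) // mulrC ler_wpM2r //.
  by rewrite distrC.
pose phi := fun x => x + (y - f x).
pose PhiM := isFun.Build _ _ K K phi phiK.
pose Phi : {fun K >-> K} := HB.pack phi PhiM.
have ctr : is_contraction Phi.
  have h0 : 0 <= (2^-1 : R) by [].
  exists (NngNum h0); split => /=.
    by rewrite invf_lt1 // ltr1n.
  move=> [x1 x2] [/= K1 K2].
  have -> : phi x1 - phi x2 = - (f x1 - f x2 - (x1 - x2)).
    by apply/rowP => k; rewrite !mxE; ring.
  by rewrite normrN; apply: lipf; exact: rU.
have clK : closed K by rewrite /K -closed_ballE //; exact: closed_ball_closed.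
have [||p Kp pE] := banach_fixed_point ctr => //.
  by exists x0; rewrite /K /closed_ball_ /= subrr normr0 ltW.
exists p; first exact: rU.
have : phi p = p by [].
by move/(congr1 (fun z => z - p)); rewrite /phi addrAC subrr add0r => /eqP; rewrite subr_eq0 => /eqP.
Qed.

Lemma near_identity_expanding U f :
  (forall x y, U x -> U y -> `|f y - f x - (y - x)| <= 2^-1 * `|y - x|) ->
  forall x y, U x -> U y -> `|y - x| <= 2 * `|f y - f x|.
Proof.
move=> lipf x y Ux Uy.
have h := lipf x y Ux Uy.
have : `|y - x| <= `|f y - f x| + 2^-1 * `|y - x|.
  apply: le_trans (lerD (lexx _) h).
  by rewrite -[X in `|X| <= _](subKr (f y - f x)) ler_normB.
by lra.
Qed.

(** The expansion bound makes the inverse Lipschitz, so an error that is small against |z - x| is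
    also small against |f(z) - f(x)|, and the inverse of the Jacobian is the differential. *)
Lemma diff_local_inverse U f g (C : R) x : open (f @` U) -> U x ->
  (forall x, U x -> g (f x) = x) ->
  (forall x y, U x -> U y -> `|y - x| <= C * `|f y - f x|) ->
  differentiable f x -> (forall v, 'd f x v = 0 -> v = 0) ->
  differentiable g (f x) /\
  forall v, 'd g (f x) v = v *m invmx (jacobian_mx f x).
Proof.
move=> ofU Ux gK lipg df inj; set J := jacobian_mx f x.
have Ju : J \in unitmx by exact: jacobian_mx_unit.
have Llin : linear (fun v : E => v *m invmx J).
  by move=> a u v; rewrite mulmxDl scalemxAl.
pose L : {linear E -> E} := HB.pack (fun v : E => v *m invmx J)
  (GRing.isLinear.Build _ _ _ _ _ Llin).
have Lc : continuous L by exact: linear_rV_continuous.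
suff [dg dgE] : differentiable g (f x) /\ 'd g (f x) = L :> (E -> E).
  by split=> // v; rewrite (congr1 (fun h : E -> E => h v) dgE).
apply: is_diff_littleoP => // e e0.
have [k k0 Lk] : exists2 k : R, 0 < k & forall v, `|L v| <= k * `|v|.
  have /linear_lipschitz[k k0 Lk] := Lc.
  by exists k => // v; exact: Lk.
have C1 : 0 < `|C| + 1 by rewrite ltr_wpDl.
(* The error passes through [L], of norm at most [k], and through the Lipschitz bound, so that k e'
   (|C| + 1) = e. The constant |C| + 1 replaces [C] to be positive. *)
pose e' := e / (k * (`|C| + 1)).
have e'0 : 0 < e' by rewrite divr_gt0 // mulr_gt0.
have /nbhs_ballP[r /= r0 rP] := diff_littleo df e'0.
have : \forall y \near f x, (f @` U) y /\ `|f x - y| < r / (`|C| + 1).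
  apply: filterI.
    by apply: open_nbhs_nbhs; split=> //; exists x.
  apply/nbhs_ballP; exists (r / (`|C| + 1)); first by rewrite /= divr_gt0.
  by move=> y; rewrite -ball_normE.
apply: filterS => _ [[z Uz <-]]; rewrite !gK // => zr.
have zx : `|z - x| <= (`|C| + 1) * `|f z - f x|.
  apply: le_trans (lipg _ _ Ux Uz) _; rewrite ler_wpM2r //.
  by rewrite (le_trans (ler_norm _)) // lerDl.
have /rP zsmall : ball x r z.
  rewrite -ball_normE /= distrC (le_lt_trans zx) //.
  by rewrite mulrC -ltr_pdivlMr // distrC.
have LD : L ('d f x (z - x)) = z - x.
  by rewrite /L /= -mul_jacobian_mx mulmxK.
have -> : z - x - L (f z - f x) = - L (f z - f x - 'd f x (z - x)).
  by rewrite [L (f z - f x - _)]linearB LD opprB.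
rewrite normrN (le_trans (Lk _)) //.
apply: (@le_trans _ _ (k * (e' * `|z - x|))); first by rewrite ler_pM2l.
apply: (@le_trans _ _ (k * (e' * ((`|C| + 1) * `|f z - f x|)))).
  by rewrite ler_pM2l // ler_pM2l.
have -> : e = k * (e' * (`|C| + 1)) by rewrite /e'; field; rewrite !gt_eqF.
by rewrite !mulrA.
Qed.

(** Bootstrap: the differential of [g] at y is the inverse of the Jacobian of [f] at g(y), so [g] of
    class C^k has a differential of class C^k. *)
Lemma smooth_local_inverse U f g (C : R) : open U -> open (f @` U) ->
  (forall x, U x -> g (f x) = x) ->
  (forall x y, U x -> U y -> `|y - x| <= C * `|f y - f x|) ->
  (forall x v, U x -> 'd f x v = 0 -> v = 0) ->
  smooth_on U f -> smooth_on (f @` U) g.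
Proof.
move=> oU ofU gK lipg inj sf k.
have df x : U x -> differentiable f x by case: (sf 1%N) => + _; exact.
have dg x (Ux : U x) := diff_local_inverse ofU Ux gK lipg (df x Ux) (fun v => @inj x v Ux).
elim: k => [|k IH].
  by move=> _ [x Ux <-]; apply: differentiable_continuous; case: (dg x Ux).
split=> [_ [x Ux <-]|v]; first by case: (dg x Ux).
have gU y : (f @` U) y -> U (g y) by move=> [x Ux <-]; rewrite gK.
suff : class_C k (f @` U) (fun y => v *m invmx (jacobian_mx f (g y))).
  by apply: class_C_ext => // _ /set_mem[x Ux <-]; rewrite (dg x Ux).2 gK.
apply: class_C_rV => // i.
suff : class_C k (f @` U) (fun y => \sum_j v 0 j * invmx (jacobian_mx f (g y)) j i).
  by apply: class_C_ext => // y _; rewrite mxE.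
apply: class_C_sum => // j _; apply: class_CM => //; first exact: class_C_cst.
apply: class_C_invmx => // [y /gU Uy|i' j'].
  by apply: jacobian_mx_unit => w; exact: inj.
suff : class_C k (f @` U) ((fun x => 'd f x (delta_mx 0 i') 0 j') \o g).
  by apply: class_C_ext => // y _; rewrite /jacobian_mx /= mxE.
apply: (class_C_comp ofU oU gU IH).
by apply: class_C_coord => //; case: (sf k.+1) => _; exact.
Qed.

(** Composing with the inverse [N] of the Jacobian at [a] reduces to a map whose differential at [a]
    is the identity. *)
Theorem inverse_function D f a : open D -> D a -> smooth_on D f ->
  (forall v, 'd f a v = 0 -> v = 0) ->
  exists U g, [/\ open U, U a & U `<=` D] /\
    [/\ open (f @` U), forall x, U x -> g (f x) = x, smooth_on (f @` U) g
      & forall x v, U x -> 'd f x v = 0 -> v = 0].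
Proof.
move=> oD Da sf inj; set N := invmx (jacobian_mx f a).
have Ju : jacobian_mx f a \in unitmx by exact: jacobian_mx_unit.
have Nu : N \in unitmx by rewrite unitmx_inv.
have Llin : linear (fun v : E => v *m N).
  by move=> k u v; rewrite mulmxDl scalemxAl.
pose L : {linear E -> E} := HB.pack (fun v : E => v *m N)
  (GRing.isLinear.Build _ _ _ _ _ Llin).
have Lc : continuous L by exact: linear_rV_continuous.
have [k k0 Lk] : exists2 k : R, 0 < k & forall v, `|v *m N| <= k * `|v|.
  have /linear_lipschitz[k k0 Lk] := Lc.
  by exists k => // v; exact: Lk.
pose h x := f x *m N.
have Ch : class_C 1 D h.
  by apply: (class_C_comp_rV (g := L) oD openT _ (sf 1%N)) => //; exact: class_C_lin.
have df x : D x -> differentiable f x by case: (sf 1%N) => + _; exact.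
have dh x v : D x -> 'd h x v = 'd f x v *m N.
  move=> Dx; have dL : differentiable L (f x) by exact: linear_differentiable.
  have hE := congr1 (fun F : E -> E => F v) (diff_comp (df x Dx) dL).
  have LE := congr1 (fun F : E -> E => F ('d f x v)) (diff_lin (f x) Lc).
  exact: (etrans hE LE).
have dha : 'd h a = id :> (E -> E).
  by apply/funext => v; rewrite dh // -mul_jacobian_mx mulmxK.
have [r r0 [rD dhv]] := diff_near_identity oD Da Ch dha.
pose U := ball a r.
have oU : open U by exact: ball_open.
have Ua : U a by exact: ballxx.
have lip := near_identity_lipschitz (fun x Ux => Ch.1 x (rD x Ux)) dhv.
have expand := near_identity_expanding lip.
have expandf x y : U x -> U y -> `|y - x| <= 2 * k * `|f y - f x|.
  move=> Ux Uy; rewrite -mulrA (le_trans (expand _ _ Ux Uy)) // ler_pM2l //.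
  by rewrite /h -mulmxBl.
have injf x y : U x -> U y -> f x = f y -> x = y.
  move=> Ux Uy fxy; apply/eqP; rewrite eq_sym -subr_eq0 -normr_le0.
  by rewrite (le_trans (expandf _ _ Ux Uy)) // fxy subrr normr0 mulr0.
have ofU : open (f @` U).
  have -> : f @` U = L @^-1` (h @` U).
    apply/seteqP; split=> [_ [x Ux <-]|y [x Ux xy]]; first by exists x.
    exists x => //; apply: (can_inj (mulmxK Nu)); exact: xy.
  by apply: open_comp; [move=> x _; exact: Lc|exact: near_identity_open_image].
(* The inverse picks the preimage lying in [U], unique by [injf]; the default [a] is taken off the
   image. *)
have gK x : U x -> xget a [set z | U z /\ f z = f x] = x.
  move=> Ux; have [Uz fz] := @xgetPex _ a [set z | U z /\ f z = f x] (ex_intro _ x (conj Ux erefl)).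
  exact: injf.
(* On [U] the differential of [h] is within 1/2 of the identity, so a vector killed by ['d f x]
   satisfies |v| <= |v| / 2. *)
have injd x v : U x -> 'd f x v = 0 -> v = 0.
  move=> Ux dv0; have := dhv x v Ux; rewrite dh ?dv0; last exact: rD.
  rewrite mul0mx sub0r normrN => hv; apply/eqP; rewrite -normr_le0.
  by have := normr_ge0 v; lra.
exists U, (fun y => xget a [set z | U z /\ f z = y]); split; split => //.
apply: (smooth_local_inverse oU ofU gK expandf injd) => m.
by apply: class_C_sub (sf m).
Qed.

End LocalDiffeomorphism.

(** * Integrals depending on a parameter *)

Section UnitIntegral.
Context {R : realType}.
Implicit Types (h k F : R -> R).

Definition integral01 h : R := \int[lebesgue_measure]_(s in `[0%R, 1%R]) h s.

(** Continuity is two-sided even at 0 and 1. The integrands below come from functions on open sets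
    and extend past the interval. *)
Definition continuous01 h := forall s : R, 0 <= s <= 1 -> {for s, continuous h}.

Lemma continuous01_integrable h : continuous01 h ->
  lebesgue_measure.-integrable `[0%R, 1%R] (EFin \o h).
Proof.
move=> ch; apply: continuous_compact_integrable; first exact: segment_compact.
by apply: continuous_in_subspaceT => s /set_mem /=; rewrite in_itv; exact: ch.
Qed.

Lemma eq_integral01 h k : (forall s : R, 0 <= s <= 1 -> h s = k s) ->
  integral01 h = integral01 k.
Proof.
by move=> hk; apply: eq_Rintegral => s /set_mem /=; rewrite in_itv; exact: hk.
Qed.

Lemma integral01D h k : continuous01 h -> continuous01 k ->
  integral01 (fun s => h s + k s) = integral01 h + integral01 k.
Proof. by move=> ch ck; apply: RintegralD => //; exact: continuous01_integrable. Qed.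

Lemma integral01Z (c : R) h : continuous01 h ->
  integral01 (fun s => c * h s) = c * integral01 h.
Proof. by move=> ch; apply: RintegralZl => //; exact: continuous01_integrable. Qed.

Lemma continuous01D h k : continuous01 h -> continuous01 k ->
  continuous01 (fun s => h s + k s).
Proof. by move=> ch ck s s01; apply: cvgD; [exact: ch|exact: ck]. Qed.

Lemma continuous01M h k : continuous01 h -> continuous01 k ->
  continuous01 (fun s => h s * k s).
Proof. by move=> ch ck s s01; apply: cvgM; [exact: ch|exact: ck]. Qed.

Lemma continuous01_cst (c : R) : continuous01 (fun=> c).
Proof. by move=> s _; exact: cvg_cst. Qed.

Lemma integral01B h k : continuous01 h -> continuous01 k ->
  integral01 (fun s => h s - k s) = integral01 h - integral01 k.
Proof. by move=> ch ck; apply: RintegralB => //; exact: continuous01_integrable. Qed.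

Lemma integral01_0 : integral01 (fun=> 0) = 0.
Proof.
rewrite -[RHS](mul0r (integral01 (fun=> 0))) -integral01Z.
  by apply: eq_integral01 => s _; rewrite mul0r.
exact: continuous01_cst.
Qed.

Lemma integral01_sum I (r : seq I) (f : I -> R -> R) :
  (forall i, continuous01 (f i)) ->
  continuous01 (fun s => \sum_(i <- r) f i s) /\
  integral01 (fun s => \sum_(i <- r) f i s) = \sum_(i <- r) integral01 (f i).
Proof.
move=> cf; elim: r => [|i r [cIH IH]].
  have -> : (fun s => \sum_(i <- [::]) f i s) = (fun=> 0).
    by apply/funext => s; rewrite big_nil.
  by rewrite big_nil integral01_0; split=> //; exact: continuous01_cst.
have -> : (fun s => \sum_(j <- i :: r) f j s) =
          (fun s => f i s + \sum_(j <- r) f j s).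
  by apply/funext => s; rewrite big_cons.
by split; [exact: continuous01D|rewrite integral01D // IH big_cons].
Qed.

Lemma normr_integral01_le h (e : R) : continuous01 h ->
  (forall s, 0 <= s <= 1 -> `|h s| <= e) -> `|integral01 h| <= e.
Proof.
move=> ch he; have ih := continuous01_integrable ch.
apply: le_trans (le_normr_Rintegral _ ih) _ => //.
have -> : e = \int[lebesgue_measure]_(s in `[0%R, 1%R]) (cst e s).
  rewrite Rintegral_cst //= lebesgue_measure_itv /= lte_fin ltr01.
  by rewrite oppr0 adde0 /= mulr1.
apply: le_Rintegral => //.
- exact: integrable_norm.
- by apply: continuous01_integrable; exact: continuous01_cst.
Qed.

Lemma integral01_derivative F h : continuous01 h ->
  (forall s : R, 0 <= s <= 1 -> is_derive s 1 F (h s)) ->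
  integral01 h = F 1 - F 0.
Proof.
move=> ch dF.
have cF s : 0 <= s <= 1 -> {for s, continuous F}.
  by move=> /dF[+ _] => /derivable1_diffP; exact: differentiable_continuous.
rewrite /integral01 /Rintegral (@continuous_FTC2 _ h F 0 1) //=.
- by apply: continuous_in_subspaceT => s /set_mem /=; rewrite in_itv; exact: ch.
- split.
  + by move=> s; rewrite in_itv /= => /andP[s0 s1]; have [|//] := dF s; rewrite !ltW.
  + by apply: cvg_at_right_filter; apply: cF; rewrite lexx ler01.
  + by apply: cvg_at_left_filter; apply: cF; rewrite lexx ler01.
- move=> s; rewrite in_itv /= => /andP[s0 s1]; rewrite derive1E.
  by have [|_ ->//] := dF s; rewrite !ltW.
Qed.

End UnitIntegral.

Section ParametricIntegral.
Context {R : realType}.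
Implicit Types V : normedModType R.

(** A tube argument: joint continuity gives a product neighbourhood for each [s], and compactness of
    the interval makes the neighbourhood of [x] independent of [s]. *)
Lemma near_uniform01 V (f : V -> R -> R) x (e : R) :
  (forall s : R, 0 <= s <= 1 ->
     {for (x, s), continuous (fun z : V * R => f z.1 z.2)}) -> 0 < e ->
  \forall y \near x, forall s : R, 0 <= s <= 1 -> `|f y s - f x s| <= e.
Proof.
move=> cf e0; have e20 : 0 < e / 2 by rewrite divr_gt0.
have cov := (compact_near_coveringP _).1 (@segment_compact R 0 1).
have := cov V (nbhs x) (fun y s => `|f y s - f x s| <= e) (nbhs_filter x).
have /[swap]/[apply] : forall s : R, [set` `[0%R, 1%R]] s ->
    \forall s' \near s & y \near x, `|f y s' - f x s'| <= e.
  move=> s /=; rewrite in_itv => /cf/cvgrPdist_lt/(_ _ e20)[[A B] /= [nA nB] AB].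
  exists (B, A) => //= -[s' y] [/= Bs' Ay].
  have := AB (y, s') (conj Ay Bs'); have := AB (x, s') (conj (nbhs_singleton nA) Bs').
  rewrite /= => h1 h2.
  rewrite (le_trans (ler_distD (f x s) _ _)) // (splitr e) lerD // ?(ltW h1) //.
  by rewrite distrC ltW.
by apply: filterS => y yP s s01; apply: yP; rewrite /= in_itv.
Qed.

Lemma joint_continuous01 V (f : V -> R -> R) x :
  (forall s : R, 0 <= s <= 1 ->
     {for (x, s), continuous (fun z : V * R => f z.1 z.2)}) ->
  continuous01 (f x).
Proof.
move=> cf s s01; apply: (@continuous_comp _ _ _ (fun s => (x, s)) (fun z : V * R => f z.1 z.2)).
  exact: (@cvg_pair _ _ _ (nbhs s) (nbhs x) (nbhs s) _ _ _ (fun=> x) id (cvg_cst x) cvg_id).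
exact: cf.
Qed.

Lemma continuous_integral01 V (D : set V) (f : V -> R -> R) : open D ->
  (forall x (s : R), D x -> 0 <= s <= 1 ->
     {for (x, s), continuous (fun z : V * R => f z.1 z.2)}) ->
  class_C 0 D (fun x => integral01 (f x)).
Proof.
move=> oD cf x Dx; apply/cvgrPdist_le => e e0.
have nD := open_nbhs_nbhs (conj oD Dx).
apply: filterS2 nD (near_uniform01 (fun s => cf x s Dx) e0) => y Dy fy.
have cx := joint_continuous01 (fun s => cf x s Dx).
have cy := joint_continuous01 (fun s => cf y s Dy).
rewrite -integral01B //; apply: normr_integral01_le => [s s01|s s01].
  by apply: cvgB; [exact: cx|exact: cy].
by rewrite distrC; exact: fy.
Qed.

(** For each [s] the mean value theorem on the segment from [x] to [y] replaces the increment by a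
    differential at an intermediate point. That differential is close to the one at [x] uniformly in
    [s], since only finitely many basis directions have to be controlled. *)
Lemma diff_integral01 n (D : set 'rV[R]_n) (f : 'rV[R]_n -> R -> R) x :
  open D -> D x ->
  (forall x (s : R), D x -> 0 <= s <= 1 ->
     {for (x, s), continuous (fun z : 'rV[R]_n * R => f z.1 z.2)}) ->
  (forall x (s : R), D x -> 0 <= s <= 1 -> differentiable (f^~ s) x) ->
  (forall (v x : 'rV[R]_n) (s : R), D x -> 0 <= s <= 1 ->
     {for (x, s), continuous (fun z : 'rV[R]_n * R =>
       'd (f^~ z.2 : 'rV[R]_n -> R) (z.1 : 'rV[R]_n) v : R)}) ->
  differentiable (fun x => integral01 (f x)) x /\
  forall v, 'd (fun x => integral01 (f x)) x v =
    integral01 (fun s => 'd (f^~ s) x v).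
Proof.
move=> oD Dx cf df cdf.
have cx v : continuous01 (fun s => 'd (f^~ s) x v).
  exact: (@joint_continuous01 _ (fun (x : 'rV[R]_n) (s : R) => 'd (f^~ s) x v : R) x (fun s => cdf v x s Dx)).
have Llin : linear (fun v => integral01 (fun s => 'd (f^~ s) x v)).
  move=> k u v; rewrite -[k *: integral01 _]/(k * _) -integral01Z // -integral01D //.
    by apply: eq_integral01 => s _; rewrite linearP.
  by apply: continuous01M => //; exact: continuous01_cst.
pose L : {linear 'rV[R]_n -> R} :=
  HB.pack (fun v => integral01 (fun s => 'd (f^~ s) x v))
  (GRing.isLinear.Build _ _ _ _ _ Llin).
suff [dJ dJE] : differentiable (fun x => integral01 (f x)) x /\
    'd (fun x => integral01 (f x)) x = L :> (_ -> _).
  by split=> // v; rewrite (congr1 (fun h : 'rV[R]_n -> R => h v) dJE).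
apply: is_diff_littleoP; first exact: linear_rV_continuous.
move=> e e0; pose e' := e / n.+1%:R.
have e'0 : 0 < e' by rewrite divr_gt0.
have : \forall y \near x, D y /\ forall (i : 'I_n) (s : R), 0 <= s <= 1 ->
    `|'d (f^~ s) y (delta_mx 0 i) - 'd (f^~ s) x (delta_mx 0 i)| <= e'.
  apply: filterI; first exact: open_nbhs_nbhs.
  have near_i (i : 'I_n) : \forall y \near x, forall s : R, 0 <= s <= 1 ->
      `|'d (f^~ s) y (delta_mx 0 i) - 'd (f^~ s) x (delta_mx 0 i)| <= e'.
    have dcont (s : R) := @cdf (delta_mx 0 i) x s Dx.
    exact: (@near_uniform01 _ (fun (x : 'rV[R]_n) (s : R) =>
      'd (f^~ s) x (delta_mx 0 i) : R) x e' dcont e'0).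
  exact: (@filter_forall _ _ (fun i y => forall s : R, 0 <= s <= 1 ->
      `|'d (f^~ s) y (delta_mx 0 i) - 'd (f^~ s) x (delta_mx 0 i)| <= e')) near_i.
move=> /nbhs_ballP[r /= r0 rP]; apply/nbhs_ballP; exists r => //= y yr.
have [Dy _] := rP _ yr.
have ctx := joint_continuous01 (fun s => cf x s Dx).
have cty := joint_continuous01 (fun s => cf y s Dy).
rewrite -integral01B // /L /= -integral01B //; last first.
  by move=> s s01; apply: cvgB; [exact: cty|exact: ctx].
apply: normr_integral01_le => [s s01|s s01].
  by apply: cvgB; [apply: cvgB; [exact: cty|exact: ctx]|exact: cx].
have seg (t : R) : 0 <= t <= 1 -> ball x r (x + t *: (y - x)).
  move=> /andP[t0 t1]; move: yr; rewrite -!ball_normE /= => yr.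
  rewrite opprD addrA subrr add0r normrN normrZ ger0_norm //.
  by rewrite (le_lt_trans _ yr) // distrC ler_piMl.
have [t t01] := MVT_line (fun t t01 => df _ s (rP _ (seg t t01)).1 s01).
rewrite [x + (y - x)]addrC subrK => ->.
set z := x + t *: (y - x).
have zP : forall i, `|'d (f^~ s) z (delta_mx 0 i) - 'd (f^~ s) x (delta_mx 0 i)| <= e'.
  by move=> i; apply: (rP _ (seg _ t01)).2.
have -> : 'd (f^~ s) z (y - x) - 'd (f^~ s) x (y - x) = \sum_i (y - x) 0 i *
    ('d (f^~ s) z (delta_mx 0 i) - 'd (f^~ s) x (delta_mx 0 i)).
  rewrite [X in X - _](linear_rV_sum ('d (f^~ s) z)).
  rewrite [X in _ - X](linear_rV_sum ('d (f^~ s) x)).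
  by rewrite -sumrB; apply: eq_bigr => i _; rewrite mulrBr.
rewrite (le_trans (ler_norm_sum _ _ _)) //.
apply: (@le_trans _ _ (\sum_(i < n) `|y - x| * e')).
  by apply: ler_sum => i _; rewrite normrM ler_pM //; exact: norm_coord_le.
rewrite sumr_const card_ord -mulrnAr mulrC -[e' *+ n]mulr_natr ler_wpM2r //.
by rewrite /e' mulrAC ler_pdivrMr // ler_wpM2l ?(ltW e0) // ler_nat leqnSn.
Qed.

End ParametricIntegral.

Section ConeIntegral.
Context {R : realType} {n : nat}.
Local Notation E := 'rV[R]_n.
Implicit Types (D : set E) (b : E -> R) (w : R -> R).
Context (a : E) (p q : {linear E -> E}).

(** With [p] a projection and [q] its complement, this is the segment from a + p (x - a) to [x];
    with [p] zero and [q] the identity, it is the segment from [a] to [x]. *)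
Let cone (x : E) (s : R) : E := a + p (x - a) + s *: q (x - a).

Let cone_continuous (z : E * R) : {for z, continuous (fun z => cone z.1 z.2)}.
Proof.
have cst_a : (fun=> a) y @[y --> z] --> a by exact: cvg_cst.
have sub_a : (fun y : E * R => y.1 - a) y @[y --> z] --> z.1 - a.
  by apply: cvgB cst_a; exact: cvg_fst.
have lin_a (l : {linear E -> E}) : (fun y : E * R => l (y.1 - a)) y @[y --> z] --> l (z.1 - a).
  by apply: (cvg_comp _ _ sub_a); exact: linear_rV_continuous.
apply: cvgD; first exact: cvgD cst_a (lin_a p).
by apply: cvgZ (lin_a q); exact: cvg_snd.
Qed.

Let weighted_continuous b w (x : E) (s : R) : {for s, continuous w} ->
  {for cone x s, continuous b} ->
  {for (x, s), continuous (fun z : E * R => w z.2 * b (cone z.1 z.2))}.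
Proof.
move=> cw cb; apply: cvgM.
  by apply: (@continuous_comp _ _ _ (fun z : E * R => z.2) w); [exact: cvg_snd|].
apply: (@continuous_comp _ _ _ (fun z : E * R => cone z.1 z.2) b).
  exact: cone_continuous.
exact: cb.
Qed.

Let cone_diff (x : E) (s : R) : differentiable (cone^~ s) x /\
  'd (cone^~ s) x = (p \+ (s \*: q)) :> (E -> E).
Proof.
apply: diff_affine; first exact: linear_rV_continuous.
move=> y; rewrite /cone /=.
have E1 (l : {linear E -> E}) : l (y - a) = l (x - a) + l (y - x).
  by rewrite -linearD; congr (l _); rewrite [RHS]addrC addrA subrK.
rewrite (E1 p) (E1 q) scalerDr !addrA.
by apply/rowP => k; rewrite !mxE; ring.
Qed.

Let weighted_scalar (L : {linear E -> R}) (c s : R) (u v : E) :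
  c * L (u + s *: v) = c * L u + c * s * L v.
Proof. by rewrite linearD linearZ mulrDr -mulrA. Qed.

Let near_eq_continuous (f g : E * R -> R) z : (\near z, f z = g z) ->
  {for z, continuous f} -> {for z, continuous g}.
Proof.
move=> fg; rewrite /prop_for /continuous_at (nbhs_singleton fg).
by apply: cvg_trans; apply: near_eq_cvg; apply: filterS fg => y ->.
Qed.

Section Weighted.
Context (D D0 : set E) (oD : open D) (oD0 : open D0).
Context (coneD : forall x (s : R), D0 x -> 0 <= s <= 1 -> D (cone x s)).

Lemma diff_integral_cone b w x : continuous w -> class_C 1 D b -> D0 x ->
  differentiable (fun x => integral01 (fun s => w s * b (cone x s))) x /\
  forall v, 'd (fun x => integral01 (fun s => w s * b (cone x s))) x v =
    integral01 (fun s => w s * 'd b (cone x s) (p v + s *: q v)).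
Proof.
move=> cw Cb D0x; have [db ddb] := Cb.
have cb := class_C_pred Cb.
have dbc y (s : R) : D (cone y s) ->
    differentiable (fun y => w s * b (cone y s)) y /\
    forall v, 'd (fun y => w s * b (cone y s)) y v =
      w s * 'd b (cone y s) (p v + s *: q v).
  move=> Dys; have dby := db _ Dys.
  have [dc dcE] := cone_diff y s.
  have dbc : differentiable (fun y => b (cone y s)) y by exact: (differentiable_comp dc dby).
  split; first exact: (differentiableZ (w s) dbc).
  move=> v; apply: (etrans (diffMcE _ _ dbc)); congr (_ * _).
  apply: (etrans (diff_compE _ dc dby)).
  exact: (congr1 (fun F : E -> E => 'd b (cone y s) (F v)) dcE).
have [|||dJ dJE] := @diff_integral01 R n D0 (fun x s => w s * b (cone x s)) x oD0 D0x.
- move=> y s D0y s01; apply: weighted_continuous; first exact: cw.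
  by apply: cb; exact: coneD.
- by move=> y s D0y s01; case: (dbc y s (coneD D0y s01)).
- move=> v y s D0y s01; have Dys := coneD D0y s01.
  (* The direction p v + s q v varies with [s], while [ddb] gives continuity along fixed directions
     only; hence the splitting by linearity. *)
  apply: (near_eq_continuous (f := fun z => w z.2 * 'd b (cone z.1 z.2) (p v) +
      (w z.2 * z.2) * 'd b (cone z.1 z.2) (q v))).
    have : \forall z \near (y, s), D (cone z.1 z.2).
      exact: (cone_continuous (open_nbhs_nbhs (conj oD (Dys : D (cone (y, s).1 (y, s).2))))).
    apply: filterS => -[y' s'] Dys'; have [_ dbE] := dbc _ _ Dys'.
    by apply: (etrans _ (esym (dbE v))); rewrite weighted_scalar.
  apply: cvgD.
    apply: (@weighted_continuous (fun x => 'd b x (p v))); first exact: cw.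
    by apply: ddb.
  apply: (@weighted_continuous (fun x => 'd b x (q v)) (fun s => w s * s)).
    by apply: cvgM; [exact: cw|exact: cvg_id].
  by apply: ddb.
split; first exact: dJ.
move=> v; apply: (etrans (dJE v)); apply: eq_integral01 => s s01.
exact: (dbc x s (coneD D0x s01)).2.
Qed.

(** Differentiating in the direction [v] gives two integrals of the same kind: weight w(s) with the
    derivative of [b] along [p v], and weight s w(s) with its derivative along [q v]. The arbitrary
    weight makes the family stable, which the induction on [m] requires. *)
Lemma class_C_integral_cone m b w : continuous w -> class_C m D b ->
  class_C m D0 (fun x => integral01 (fun s => w s * b (cone x s))).
Proof.
elim: m b w => [|m IH] b w cw Cb.
  apply: (@continuous_integral01 _ _ D0 (fun x s => w s * b (cone x s)) oD0).
  move=> x s D0x s01; apply: weighted_continuous; first exact: cw.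
  by apply: Cb; exact: coneD.
have Cb1 : class_C 1 D b.
  by case: Cb => db ddb; split=> // v x Dx; exact: class_C_continuous (ddb v) Dx.
have dJ x D0x := @diff_integral_cone b w x cw Cb1 D0x.
split=> [x D0x|v]; first by case: (dJ x D0x).
have cws : continuous (fun s => w s * s).
  by move=> s; apply: cvgM; [exact: cw|exact: cvg_id].
have Cbv u : class_C m D (fun x => 'd b x u) by case: Cb => _; exact.
apply: class_C_ext (class_CD oD0 (IH _ _ cw (Cbv (p v))) (IH _ _ cws (Cbv (q v)))) => //.
move=> x /set_mem D0x; apply: esym; apply: (etrans ((dJ x D0x).2 v)).
apply: esym; rewrite -integral01D.
- apply: eq_integral01 => s _.
  by rewrite weighted_scalar.
- apply: (@joint_continuous01 _ _ (fun x s => w s * 'd b (cone x s) (p v))).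
  move=> s s01; apply: (@weighted_continuous (fun x => 'd b x (p v))); first exact: cw.
  by apply: Cb1.2; exact: coneD.
- apply: (@joint_continuous01 _ _ (fun x s => (w s * s) * 'd b (cone x s) (q v))).
  move=> s s01; apply: (@weighted_continuous (fun x => 'd b x (q v)) (fun s => w s * s)).
    exact: cws.
  by apply: Cb1.2; exact: coneD.
Qed.

End Weighted.
End ConeIntegral.

(** * Primitives of leafwise closed one-forms *)

Lemma diff_sumE (R : realType) (V W : normedModType R) (I : Type) (r : seq I)
    (f : I -> V -> W) x : (forall i, differentiable (f i) x) ->
  differentiable (fun y => \sum_(i <- r) f i y) x /\
  forall v, 'd (fun y => \sum_(i <- r) f i y) x v = \sum_(i <- r) 'd (f i) x v.
Proof.
move=> df; elim: r => [|i r [IH1 IH2]].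
  have -> : (fun y => \sum_(i <- [::]) f i y) = (fun=> 0).
    by apply/funext => y; rewrite big_nil.
  split=> [|v]; first exact: differentiable_cst.
  by rewrite big_nil diff_cstE.
have -> : (fun y => \sum_(j <- i :: r) f j y) =
          (fun y => f i y + \sum_(j <- r) f j y).
  by apply/funext => y; rewrite big_cons.
split=> [|v]; first exact: (differentiableD (df i) IH1).
by apply: (etrans (diffDE v (df i) IH1)); rewrite IH2 big_cons.
Qed.

Section FiberwisePoincare.
Context {R : realType} {n : nat}.
Local Notation E := 'rV[R]_n.
Context (D : set E) (b : E -> E -> R) (c : {linear E -> E}).
Context (bscal : forall x, scalar (b x)).
Context (bsmooth : forall v, smooth_on D (b^~ v)).
Context (cc : forall v, c (c v) = c v).

Lemma scalar_sum_basis x v : b x v = \sum_i v 0 i * b x (delta_mx 0 i).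
Proof.
pose L : {linear E -> R} := HB.pack (b x) (GRing.isLinear.Build _ _ _ _ _ (bscal x)).
exact: (linear_rV_sum L v).
Qed.

Lemma diff_scalar_sum_basis x u v : D x ->
  'd (b^~ u) x v = \sum_i u 0 i * 'd (b^~ (delta_mx 0 i)) x v.
Proof.
move=> Dx; have -> : b^~ u = (fun y => \sum_i u 0 i * b y (delta_mx 0 i)).
  by apply/funext => y; exact: scalar_sum_basis.
have db w : differentiable (b^~ w) x by case: (bsmooth w 1%N) => + _; exact.
have [|_ ->] := @diff_sumE R _ _ _ (index_enum 'I_n)
    (fun i y => u 0 i * b y (delta_mx 0 i)) x.
  by move=> i; exact: (differentiableZ (u 0 i) (db _)).
by apply: eq_bigr => i _; exact: (diffMcE _ _ (db _)).
Qed.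

(* The primitive at [x] is the integral of [b] along the segment from
   [a + c (x - a)] to [x], whose direction lies in the kernel of the projection [c]. *)
Lemma fiberwise_poincare a : open D -> D a ->
  (forall x u v, D x -> c u = 0 -> c v = 0 ->
     'd (b^~ v) x u = 'd (b^~ u) x v) ->
  exists D0 (g : E -> R), [/\ open D0, D0 a, D0 `<=` D, smooth_on D0 g
    & forall x v, D0 x -> c v = 0 -> 'd g x v = b x v].
Proof.
move=> oD Da closed_b.
pose q : {linear E -> E} := idfun \- c.
have /nbhs_ballP[r /= r0 rD] := open_nbhs_nbhs (conj oD Da).
have [k k0 ck] : exists2 k : R, 0 < k & forall v, `|c v| <= k * `|v|.
  have /linear_lipschitz[k k0 ck] := @linear_rV_continuous _ _ _ c.
  by exists k => // v; exact: ck.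
have k1 : 1 <= 2 * k + 1 by rewrite lerDr mulr_ge0 // ltW.
have k10 : 0 < 2 * k + 1 by exact: lt_le_trans k1.
(* If |c v| <= k |v|, then |c v| + |q v| <= (2 k + 1) |v|, so the segments issued from this smaller
   ball stay in the ball of radius [r]. *)
pose D0 := ball a (r / (2 * k + 1)).
have oD0 : open D0 by exact: ball_open.
have D0a : D0 a by apply: ballxx; rewrite divr_gt0.
have D0D : D0 `<=` D.
  move=> x; rewrite /D0 -ball_normE /= => xr; apply: rD; rewrite -ball_normE /=.
  by rewrite (lt_le_trans xr) // ler_piMr ?(ltW r0) // invf_le1.
have coneD x (s : R) : D0 x -> 0 <= s <= 1 -> D (a + c (x - a) + s *: q (x - a)).
  rewrite /D0 -ball_normE /= => xr /andP[s0 s1]; apply: rD; rewrite -ball_normE /=.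
  rewrite -addrA opprD addrA subrr add0r normrN.
  rewrite (le_lt_trans (ler_normD _ _)) // normrZ ger0_norm //.
  apply: (@le_lt_trans _ _ ((2 * k + 1) * `|x - a|)); last first.
    by rewrite mulrC -ltr_pdivlMr // distrC.
  have h1 := ck (x - a).
  have h2 : `|q (x - a)| <= `|x - a| + `|c (x - a)| by exact: ler_normB.
  have h3 : s * `|q (x - a)| <= `|q (x - a)| by rewrite ler_piMl.
  lra.
pose cone x (s : R) := a + c (x - a) + s *: q (x - a).
have c1 : continuous (fun _ : R => 1 : R) by move=> s; exact: cvg_cst.
pose J i x := integral01 (fun s => 1 * b (cone x s) (delta_mx 0 i)).
have CJ i m : class_C m D0 (J i).
  exact: (class_C_integral_cone oD oD0 coneD c1 (bsmooth (delta_mx 0 i) m)).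
have cq v : c (q v) = 0.
  by rewrite /q /= linearB cc subrr.
have qker v : c v = 0 -> q v = v by rewrite /q /= => ->; rewrite subr0.
have qD x y : q (y - a) = q (x - a) + q (y - x).
  by rewrite -linearD; congr (q _); rewrite [RHS]addrC addrA subrK.
have dcoord i x : differentiable (fun x => q (x - a) 0 i) x /\
    forall v, 'd (fun x => q (x - a) 0 i) x v = q v 0 i.
  pose L : {linear E -> R} := @coord_rV R n i \o q.
  have [d dE] : differentiable (fun x => q (x - a) 0 i) x /\
      'd (fun x => q (x - a) 0 i) x = L :> (E -> R).
    apply: diff_affine => [|y]; first exact: linear_rV_continuous.
    by rewrite -[RHS]/(coord_rV i (q (x - a)) + coord_rV i (q (y - x))) -linearD -qD.
  by split=> // v; exact: (congr1 (@^~ v) dE).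
have Ccoord i m : class_C m D0 (fun x => q (x - a) 0 i).
  have dq x : differentiable (fun x => q (x - a)) x /\
      'd (fun x => q (x - a)) x = q :> (E -> E).
    apply: diff_affine => [|y]; first exact: linear_rV_continuous.
    exact: qD.
  apply: class_C_coord => //; case: m => [|m].
    by move=> x _; apply: differentiable_continuous; exact: (dq x).1.
  split=> [x _|v]; first exact: (dq x).1.
  apply: class_C_ext (class_C_cst m D0 (q v)) => // x _.
  exact: esym (congr1 (@^~ v) (dq x).2).
(* By linearity this sum is the integral over [s] of [b] at [cone x s], applied to the velocity q (x
   - a) of the segment. *)
exists D0, (fun x => \sum_i q (x - a) 0 i * J i x); split=> //.
  by move=> m; apply: class_C_sum => // i _; exact: class_CM.
move=> x v D0x cv.
have dJ i : differentiable (J i) x /\ 'd (J i) x v =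
    integral01 (fun s => s * 'd (b^~ (delta_mx 0 i)) (cone x s) v).
  have [d dE] := diff_integral_cone oD oD0 coneD c1 (bsmooth (delta_mx 0 i) 1) D0x.
  split; first exact: d.
  apply: (etrans (dE v)); apply: eq_integral01 => s _.
  apply: (etrans (mul1r _)).
  have -> : c v + s *: q v = s *: v by rewrite cv add0r qker.
  exact: linearZ.
have [|_ ->] := @diff_sumE R _ _ _ (index_enum 'I_n)
    (fun i y => q (y - a) 0 i * J i y) x.
  by move=> i; apply: differentiableM; [exact: (dcoord i x).1|exact: (dJ i).1].
have ccone s : {for s, continuous (cone x)}.
  by apply: differentiable_continuous; exact: (diff_line _ _ _).1.
have compc (h : E -> R) : (forall m, class_C m D h) ->
    continuous01 (fun s => h (cone x s)).
  move=> Ch s s01; apply: (@continuous_comp _ _ _ (cone x) h); first exact: ccone.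
  by apply: (Ch 0%N); exact: coneD.
have cb u : continuous01 (fun s => b (cone x s) u) by exact: (compc (b^~ u) (bsmooth u)).
have cdb u w : continuous01 (fun s => s * 'd (b^~ u) (cone x s) w).
  apply: continuous01M; first by move=> s _; exact: cvg_id.
  by apply: (compc (fun y => 'd (b^~ u) y w)) => m; case: (bsmooth u m.+1) => _; exact.
have cst01 (k' : R) : continuous01 (fun=> k') by exact: continuous01_cst.
have dterm i : 'd (fun y => q (y - a) 0 i * J i y) x v =
    integral01 (fun s => q (x - a) 0 i * (s * 'd (b^~ (delta_mx 0 i)) (cone x s) v)
      + v 0 i * b (cone x s) (delta_mx 0 i)).
  apply: (etrans (diffME v (dcoord i x).1 (dJ i).1)).
  apply: (etrans (congr2 (fun A B => q (x - a) 0 i * A + J i x * B)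
    (dJ i).2 ((dcoord i x).2 v))).
  have cA : continuous01 (fun s => q (x - a) 0 i *
      (s * 'd (b^~ (delta_mx 0 i)) (cone x s) v)).
    by apply: continuous01M; [exact: cst01|exact: cdb].
  have cB : continuous01 (fun s => v 0 i * b (cone x s) (delta_mx 0 i)).
    by apply: continuous01M; [exact: cst01|exact: cb].
  apply: esym; apply: (etrans (integral01D cA cB)).
  congr (_ + _); first exact: (integral01Z _ (cdb _ _)).
  apply: (etrans (integral01Z _ (cb _))); rewrite mulrC qker //; congr (_ * _).
  by apply: eq_integral01 => s _; rewrite mul1r.
apply: (etrans (eq_bigr _ (fun i _ => dterm i))).
have [|_ <-] := @integral01_sum R _ (index_enum 'I_n) (fun i s =>
    q (x - a) 0 i * (s * 'd (b^~ (delta_mx 0 i)) (cone x s) v)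
      + v 0 i * b (cone x s) (delta_mx 0 i)).
  by move=> i; apply: continuous01D; apply: continuous01M.
pose kap := q (x - a).
(* Both [kap] and [v] lie in the kernel of [c], so closedness exchanges them. The integrand is then
   the derivative in [s] of s b(cone x s)(v), whose values at the ends are 0 and b(x)(v). *)
have -> : integral01 (fun s => \sum_i (kap 0 i * (s * 'd (b^~ (delta_mx 0 i)) (cone x s) v)
      + v 0 i * b (cone x s) (delta_mx 0 i))) =
    integral01 (fun s => s * 'd (b^~ v) (cone x s) kap + b (cone x s) v).
  apply: eq_integral01 => s s01; have Ds := coneD _ _ D0x s01.
  rewrite big_split /= -scalar_sum_basis; congr (_ + _).
  apply: esym; apply: (etrans (congr1 ( *%R s) (etrans (closed_b _ kap v Ds (cq _) cv)
    (diff_scalar_sum_basis kap v Ds)))).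
  by rewrite mulr_sumr; apply: eq_bigr => i _; exact: mulrCA.
have cI : continuous01 (fun s => s * 'd (b^~ v) (cone x s) kap + b (cone x s) v).
  by apply: continuous01D; [exact: cdb|exact: cb].
have dF (s : R) : 0 <= s <= 1 -> is_derive s 1 (fun s => s * b (cone x s) v)
    (s * 'd (b^~ v) (cone x s) kap + b (cone x s) v).
  move=> s01; have Ds := coneD _ _ D0x s01.
  have [dl dlE] := diff_line (a + c (x - a)) kap s.
  have db : differentiable (b^~ v) (cone x s) by case: (bsmooth v 1%N) => + _; exact.
  have dbc : differentiable (fun s => b (cone x s) v) s.
    exact: (differentiable_comp dl db).
  have did : differentiable (fun s : R => s) s.
    by apply/derivable1_diffP; exact: derivable_id.
  have dM : differentiable (fun s : R => s * b (cone x s) v) s.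
    exact: (differentiableM did dbc).
  apply: DeriveDef.
    exact: diff_derivable.
  apply: (etrans (deriveE _ dM)); apply: (etrans (diffME _ did dbc)).
  have -> : 'd (fun s : R => s) s 1 = 1.
    by rewrite -deriveE // derive_id.
  rewrite mulr1; congr (s * _ + _).
  apply: (etrans (diff_compE _ dl db)); congr ('d (b^~ v) (cone x s) _).
  by apply: (etrans (congr1 (@^~ 1) dlE)); exact: scale1r.
apply: (etrans (integral01_derivative cI dF)).
rewrite mul1r mul0r subr0 /cone scale1r; congr (b _ v).
by rewrite /q /= -addrA [c _ + _]addrC subrK addrC subrK.
Qed.

End FiberwisePoincare.

Lemma diff_cancel (R : realType) (V W : normedModType R) (f : V -> W)
    (g : W -> V) x v : (\near x, g (f x) = x) -> differentiable f x ->
  differentiable g (f x) -> 'd g (f x) ('d f x v) = v.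
Proof.
move=> gfx df dg; apply: etrans (esym (diff_compE v df dg)) _.
have cid : continuous (idfun : V -> V) by move=> y; exact: cvg_id.
have gfx' : \near x, (idfun : V -> V) x = g (f x) by apply: filterS gfx => y ->.
have [_ dE] := near_eq_diff gfx' (linear_differentiable x cid).
by apply: (etrans (congr1 (@^~ v) dE)); exact: diff_linE.
Qed.

Lemma open_setI_preimage (T U : topologicalType) (D : set T) (A : set U)
    (f : T -> U) : open D -> (forall x, D x -> {for x, continuous f}) ->
  open A -> open [set x | D x /\ A (f x)].
Proof.
move=> oD cf oA; rewrite openE => x [Dx Afx].
apply: filterI; first exact: open_nbhs_nbhs.
by apply: (cf x Dx); exact: open_nbhs_nbhs.
Qed.

(** * Pullback of one-forms *)

Section Pullback.
Context {R : realType} {n : nat}.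
Local Notation E := 'rV[R]_n.
Context (D W : set E) (oD : open D) (oW : open W).
Context (G : E -> E) (GW : forall y, W y -> D (G y)) (Gsmooth : smooth_on W G).
Context (b : E -> E -> R) (bscal : forall x, scalar (b x)).
Context (bsmooth : forall v, smooth_on D (b^~ v)).

Definition pullback (y w : E) : R := b (G y) ('d G y w).

Lemma pullback_scalar y : scalar (pullback y).
Proof. by move=> k u v; rewrite /pullback linearP; exact: bscal. Qed.

Lemma pullback_smooth w : smooth_on W (pullback^~ w).
Proof.
move=> m; suff : class_C m W (fun y => \sum_i 'd G y w 0 i * b (G y) (delta_mx 0 i)).
  by apply: class_C_ext => // y _; rewrite /pullback [RHS]scalar_sum_basis.
apply: class_C_sum => // i _; apply: class_CM => //.
  by apply: class_C_coord => //; case: (Gsmooth m.+1) => _; exact.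
exact: (class_C_comp oW oD GW (Gsmooth m) (bsmooth (delta_mx 0 i) m)).
Qed.

Lemma diff_pullback y w w' : W y ->
  'd (pullback^~ w') y w =
  \sum_i b (G y) (delta_mx 0 i) * 'd (fun z => 'd (fun z => G z 0 i) z w') y w
  + 'd (b^~ ('d G y w')) (G y) ('d G y w).
Proof.
move=> Wy.
have dG z : W z -> differentiable G z by case: (Gsmooth 1%N) => + _; exact.
have db u : differentiable (b^~ u) (G y).
  by case: (bsmooth u 1%N) => + _; apply; exact: GW.
have ddG i : differentiable (fun z => 'd G z w' 0 i) y.
  have [+ _] := class_C_coord (n := 1%N) i oW ((Gsmooth 2%N).2 w').
  exact.
have dbG i : differentiable (fun z => b (G z) (delta_mx 0 i)) y.
  exact: (differentiable_comp (dG y Wy) (db _)).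
have pE : pullback^~ w' = (fun y => \sum_i 'd G y w' 0 i * b (G y) (delta_mx 0 i)).
  by apply/funext => z; rewrite /pullback [LHS]scalar_sum_basis.
have [|_ dsum] := @diff_sumE R _ _ _ (index_enum 'I_n)
    (fun i z => 'd G z w' 0 i * b (G z) (delta_mx 0 i)) y.
  by move=> i; exact: (differentiableM (ddG i) (dbG i)).
apply: (etrans (congr1 (fun f : E -> R => 'd f y w) pE)).
apply: (etrans (dsum w)); apply: esym.
apply: (etrans (congr1 (fun t => _ + t)
  (diff_scalar_sum_basis bscal bsmooth ('d G y w') ('d G y w) (GW Wy)))).
rewrite -big_split; apply: esym.
apply: eq_bigr => i _; apply: (etrans (diffME w (ddG i) (dbG i))).
apply: (etrans (addrC _ _)); apply: congr2; apply: congr1.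
  have coordE : \near y, 'd G y w' 0 i = 'd (fun z => G z 0 i) y w'.
    apply: filterS (open_nbhs_nbhs (conj oW Wy)) => z Wz.
    by rewrite (diff_coord i (dG z Wz)).2.
  exact: esym (congr1 (@^~ w) (near_eq_diff coordE (ddG i)).2).
exact: (diff_compE w (dG y Wy) (db _)).
Qed.

(** The terms involving second derivatives of [G] are symmetric in [w] and [w']. The hypothesis
    concerns this single pair of directions, so it covers forms that are closed only along
    leaves. *)
Lemma pullback_closed y w w' : W y ->
  'd (b^~ ('d G y w')) (G y) ('d G y w) = 'd (b^~ ('d G y w)) (G y) ('d G y w') ->
  'd (pullback^~ w') y w = 'd (pullback^~ w) y w'.
Proof.
move=> Wy dbs; apply: (etrans (diff_pullback w w' Wy)).
apply: (etrans _ (esym (diff_pullback w' w Wy))).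
apply: congr2; last exact: dbs.
apply: eq_bigr => i _; apply: congr1.
by apply: diff_symmetric oW Wy _; apply: class_C_coord => //; exact: Gsmooth.
Qed.

End Pullback.

Section LeafwisePrimitive.
Context {R : realType} {n : nat}.
Local Notation E := 'rV[R]_n.

(* The map [S] straightens the leaves of [F] into the hyperplanes parallel to
   the kernel of [l], where the primitive is an integral along segments. *)
Theorem leafwise_primitive (D : set E) (F : E -> R) (b : E -> E -> R) (a : E) :
  open D -> D a -> smooth_on D F -> (exists v, 'd F a v <> 0) ->
  (forall x, scalar (b x)) -> (forall v, smooth_on D (b^~ v)) ->
  (forall x u v, D x -> 'd F x u = 0 -> 'd F x v = 0 ->
     'd (b^~ v) x u = 'd (b^~ u) x v) ->
  exists D0 (g : E -> R), [/\ open D0, D0 a, D0 `<=` D, smooth_on D0 g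
    & forall x v, D0 x -> 'd F x v = 0 -> 'd g x v = b x v].
Proof.
move=> oD Da sF [v0 Fv0] bscal bsmooth closed_b.
pose l : {linear E -> R} := 'd F a.
pose n0 := (l v0)^-1 *: v0.
have ln0 : l n0 = 1 by rewrite /n0 linearZ; apply: mulVf; apply/eqP.
have lc : continuous l by exact: linear_rV_continuous.
pose k x := F x - l x.
(* The correction along [n0] gives l(S x) = F x, so level sets of [F] go to level sets of [l]; since
   [l] is the differential of [F] at [a], the differential of [S] there is the identity. *)
pose S x := x + k x *: n0.
have dF x (Dx : D x) : differentiable F x := (sF 1%N).1 x Dx.
have dk x : D x -> differentiable k x /\ forall v, 'd k x v = 'd F x v - l v.
  move=> Dx; have dl := linear_differentiable x lc.
  split; first exact: (differentiableB (dF x Dx) dl).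
  move=> v; apply: (etrans (diffBE v (dF x Dx) dl)).
  by apply: congr1; apply: congr1; exact: diff_linE.
have sk : smooth_on D k.
  move=> m; apply: class_C_ext (class_CD oD (sF m)
    (class_CM oD (class_C_cst m D (-1 : R)) (class_C_lin m D lc))) => // x _.
  by rewrite mulN1r.
have idc : continuous (idfun : E -> E) by move=> y; exact: cvg_id.
have dS x : D x -> differentiable S x /\ forall v, 'd S x v = v + 'd k x v *: n0.
  move=> Dx; have did := linear_differentiable x idc.
  have dkn := differentiableZl n0 (dk x Dx).1.
  split; first exact: (differentiableD did dkn).
  move=> v; apply: (etrans (diffDE v did dkn)); apply: congr2.
    exact: (diff_linE x v idc).
  exact: (congr1 (@^~ v) (diffZl n0 (dk x Dx).1)).
have sS : smooth_on D S.
  move=> m; apply: class_CD => //; first exact: (class_C_lin m D idc).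
  apply: class_C_rV => // i.
  apply: class_C_ext (class_CM oD (sk m) (class_C_cst m D (n0 0 i))) => // x _.
  by rewrite !mxE.
have dSa v : 'd S a v = v.
  apply: (etrans ((dS a Da).2 v)); rewrite (_ : 'd k a v = 0) ?scale0r ?addr0 //.
  by apply: (etrans ((dk a Da).2 v)); exact: subrr.
have lS x : l (S x) = F x.
  rewrite /S linearD linearZ -[X in _ + X]/(k x * l n0) ln0 mulr1 /k.
  by rewrite addrC subrK.
have [|U [G [[oU Ua UD] [oW GK sG injS]]]] := inverse_function oD Da sS.
  by move=> v; rewrite dSa.
set W := S @` U in oW sG.
have GU y : W y -> U (G y) by move=> [x Ux <-]; rewrite GK.
have SG y : W y -> S (G y) = y by move=> [x Ux <-]; rewrite GK.
have FG y : W y -> F (G y) = l y by move=> Wy; rewrite -lS SG.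
have dG y : W y -> differentiable G y by case: (sG 1%N) => + _; exact.
have dFG y w : W y -> 'd F (G y) ('d G y w) = l w.
  move=> Wy; have dFy := dF _ (UD _ (GU y Wy)).
  apply: (etrans (esym (diff_compE w (dG y Wy) dFy))).
  have FGl : \near y, l y = F (G y).
    by apply: filterS (open_nbhs_nbhs (conj oW Wy)) => z /FG.
  have [_ dE] := near_eq_diff FGl (linear_differentiable y lc).
  by apply: (etrans (congr1 (@^~ w) dE)); exact: diff_linE.
(* The projection onto the line of [n0] along the kernel of [l]: its fibres are the straightened
   leaves. *)
pose cfun v := l v *: n0.
have clin : linear cfun by move=> t u v; rewrite /cfun linearP scalerDl scalerA.
pose c : {linear E -> E} := HB.pack cfun (GRing.isLinear.Build _ _ _ _ _ clin).
have cE v : c v = l v *: n0 by [].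
have cc v : c (c v) = c v.
  have llv : l (l v *: n0) = l v * l n0 by rewrite linearZ.
  by rewrite !cE llv ln0 mulr1.
have n0_neq0 : n0 != 0.
  by apply/eqP => n00; move: ln0; rewrite n00 linear0 => /esym/eqP; rewrite oner_eq0.
have ckerP v : c v = 0 <-> l v = 0.
  rewrite cE; split=> [/eqP|->]; last by rewrite scale0r.
  by rewrite scaler_eq0 (negbTE n0_neq0) orbF => /eqP.
have GD y (Wy : W y) := UD _ (GU y Wy).
have [||D0 [g [oD0 D0a D0W sg dg]]] := @fiberwise_poincare R n W (pullback G b) c
  (pullback_scalar G bscal) (pullback_smooth oD oW GD sG bscal bsmooth) cc (S a) oW.
- by exists a.
- move=> y u v Wy /ckerP lu /ckerP lv.
  apply: (pullback_closed oW GD sG bscal bsmooth Wy).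
  by apply: closed_b; [exact: GD|rewrite dFG|rewrite dFG].
have Sc x : U x -> {for x, continuous S}.
  by move=> /UD Dx; apply: differentiable_continuous; exact: (dS x Dx).1.
exists [set x | U x /\ D0 (S x)], (g \o S); split.
- exact: open_setI_preimage.
- by [].
- by move=> x [/UD].
- move=> m; apply: (class_C_comp (D' := D0)) => //.
  + exact: open_setI_preimage.
  + by move=> x [].
  + by apply: class_C_sub (sS m) => x [/UD].
move=> x v [Ux D0Sx] Fxv; have Dx := UD x Ux.
have WS : W (S x) by exists x.
have dgS : differentiable g (S x) by case: (sg 1%N) => + _; apply.
apply: (etrans (diff_compE v (dS x Dx).1 dgS)).
have GS : 'd G (S x) ('d S x v) = v.
  apply: (diff_cancel v _ (dS x Dx).1 (dG _ WS)).
  by apply: filterS (open_nbhs_nbhs (conj oU Ux)) => z /GK.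
rewrite dg //; first by rewrite /pullback GK // GS.
apply/ckerP; apply: (etrans (esym (dFG _ _ WS))).
by rewrite GS GK.
Qed.

End LeafwisePrimitive.

(** * Forms, brackets and Lie derivatives *)

Section Forms.
Context {R : realType} {n : nat}.
Local Notation E := 'rV[R]_n.
Implicit Types (b : E -> E -> R) (X Y : E -> E).

Lemma smooth_form_apply (D : set E) b Y : open D -> (forall x, scalar (b x)) ->
  (forall v, smooth_on D (b^~ v)) -> smooth_on D Y ->
  smooth_on D (fun z => b z (Y z)).
Proof.
move=> oD bscal bs sY m.
suff : class_C m D (fun z => \sum_i Y z 0 i * b z (delta_mx 0 i)).
  by apply: class_C_ext => // z _; rewrite [RHS]scalar_sum_basis.
by apply: class_C_sum => // i _; apply: class_CM => //; [exact: class_C_coord|exact: bs].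
Qed.

Lemma diff_form_apply (D : set E) b Y z v : D z -> (forall x, scalar (b x)) ->
  (forall v, smooth_on D (b^~ v)) -> smooth_on D Y ->
  'd (fun z => b z (Y z)) z v = 'd (b^~ (Y z)) z v + b z ('d Y z v).
Proof.
move=> Dz bscal bs sY.
have dY : differentiable Y z := (sY 1%N).1 z Dz.
have db u : differentiable (b^~ u) z := (bs u 1%N).1 z Dz.
have E1 : (fun z => b z (Y z)) = (fun z => \sum_i Y z 0 i * b z (delta_mx 0 i)).
  by apply/funext => y; rewrite [LHS]scalar_sum_basis.
have [|_ dsum] := @diff_sumE R _ _ _ (index_enum 'I_n)
    (fun i z => Y z 0 i * b z (delta_mx 0 i)) z.
  by move=> i; exact: (differentiableM (diff_coord i dY).1 (db _)).
apply: (etrans (congr1 (fun f : E -> R => 'd f z v) E1)).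
apply: (etrans (dsum v)); apply: esym.
apply: (etrans (congr2 (fun s t => s + t) (diff_scalar_sum_basis bscal bs (Y z) v Dz)
  (scalar_sum_basis bscal z ('d Y z v)))).
rewrite -big_split; apply: esym; apply: eq_bigr => i _.
apply: (etrans (diffME v (diff_coord i dY).1 (db _))); apply: congr1.
apply: (etrans (congr1 _ ((diff_coord i dY).2 v))); exact: mulrC.
Qed.

Definition bracket X Y z := 'd Y z (X z) - 'd X z (Y z).

Lemma bracket_smooth (D : set E) X Y : open D -> smooth_on D X ->
  smooth_on D Y -> smooth_on D (bracket X Y).
Proof.
have diff_smooth (A B : E -> E) : open D -> smooth_on D A -> smooth_on D B ->
    smooth_on D (fun z => 'd A z (B z)).
  move=> oD sA sB m; apply: class_C_rV => // j.
  suff : class_C m D (fun z => \sum_i B z 0 i * 'd A z (delta_mx 0 i) 0 j).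
    apply: class_C_ext => // z _; apply: esym.
    apply: (etrans (congr1 (fun u : E => u 0 j) (linear_rV_sum ('d A z) (B z)))).
    by rewrite summxE; apply: eq_bigr => i _; rewrite mxE.
  apply: class_C_sum => // i _; apply: class_CM => //; apply: class_C_coord => //.
  exact: (sA m.+1).2.
move=> oD sX sY m; apply: class_C_rV => // j.
have h := class_CM oD (class_C_cst m D (-1 : R))
  (class_C_coord j oD (diff_smooth _ _ oD sX sY m)).
apply: class_C_ext (class_CD oD (class_C_coord j oD (diff_smooth _ _ oD sY sX m)) h) => //.
by move=> z _; rewrite mulN1r !mxE.
Qed.

(** The left side is db(X, Y), with the fields frozen at [z]. Letting them vary adds b('d Y z (X z))
    and b('d X z (Y z)), whose difference is [b] on the bracket. *)
Lemma cartan_formula (D : set E) b X Y z : D z -> (forall x, scalar (b x)) ->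
  (forall v, smooth_on D (b^~ v)) -> smooth_on D X -> smooth_on D Y ->
  'd (b^~ (Y z)) z (X z) - 'd (b^~ (X z)) z (Y z) =
  'd (fun z => b z (Y z)) z (X z) - 'd (fun z => b z (X z)) z (Y z)
  - b z (bracket X Y z).
Proof.
move=> Dz bscal bs sX sY.
have bB u v : b z (u - v) = b z u - b z v.
  by have := bscal z (-1) v u; rewrite scaleN1r mulN1r ![- _ + _]addrC.
rewrite /bracket bB.
have h1 := diff_form_apply (X z) Dz bscal bs sY.
have h2 := diff_form_apply (Y z) Dz bscal bs sX.
apply: esym; apply: (etrans (congr2 (fun s t => s - t - _) h1 h2)).
by ring.
Qed.

End Forms.

(** The pointwise, purely algebraic content of [three_form], shared by [Om] and by its Lie
    derivative. *)
Definition alternating3 (R : comRingType) (V : lmodType R)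
    (phi : V -> V -> V -> R) : Prop :=
  [/\ forall v w, scalar (fun u => phi u v w),
      forall u w, scalar (fun v => phi u v w),
      forall u v, scalar (fun w => phi u v w)
    & forall u v, [/\ phi u u v = 0, phi u v u = 0 & phi v u u = 0]].

Section Alternating.
Context {R : comRingType} {V : lmodType R}.

Lemma scalar_formD (f : V -> R) u v : scalar f -> f (u + v) = f u + f v.
Proof. by move=> sf; have := sf 1 u v; rewrite scale1r mul1r. Qed.

Lemma scalar_formZ (f : V -> R) k u : scalar f -> f (k *: u) = k * f u.
Proof.
move=> sf; have f0 : f 0 = 0.
  by apply: (addIr (f 0)); rewrite -scalar_formD // addr0 add0r.
by have := sf k u 0; rewrite !addr0 f0 addr0.
Qed.

Lemma scalar_comb3 (f : V -> R) a b c u v w : scalar f ->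
  f (a *: u + b *: v + c *: w) = a * f u + b * f v + c * f w.
Proof. by move=> sf; rewrite !scalar_formD // !scalar_formZ. Qed.

Context (phi : V -> V -> V -> R) (aphi : alternating3 phi).

Lemma alternating3_swap12 u v w : phi v u w = - phi u v w.
Proof.
have [s1 s2 s3 a] := aphi; have [E _ _] := a (u + v) w.
have [Eu _ _] := a u w; have [Ev _ _] := a v w.
move: E; rewrite (scalar_formD _ _ (s1 _ _)) !(scalar_formD _ _ (s2 _ _)) Eu Ev add0r addr0.
by move=> /eqP; rewrite addr_eq0 => /eqP ->; rewrite opprK.
Qed.

Lemma alternating3_swap23 u v w : phi u w v = - phi u v w.
Proof.
have [s1 s2 s3 a] := aphi; have [_ _ E] := a (v + w) u.
have [_ _ Ev] := a v u; have [_ _ Ew] := a w u.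
move: E; rewrite (scalar_formD _ _ (s2 _ _)) !(scalar_formD _ _ (s3 _ _)) Ev Ew add0r addr0.
by move=> /eqP; rewrite addr_eq0 => /eqP ->; rewrite opprK.
Qed.

(** The scalar is the determinant of the coefficients. Consequently two alternating forms that are
    proportional on one spanning triple are proportional everywhere. *)
Lemma alternating3_det (u v w : V) a1 b1 c1 a2 b2 c2 a3 b3 c3 :
  phi (a1 *: u + b1 *: v + c1 *: w) (a2 *: u + b2 *: v + c2 *: w)
      (a3 *: u + b3 *: v + c3 *: w) =
  (a1 * (b2 * c3 - b3 * c2) - b1 * (a2 * c3 - a3 * c2)
   + c1 * (a2 * b3 - a3 * b2)) * phi u v w.
Proof.
have [s1 s2 s3 a] := aphi.
have z1 x y : phi x x y = 0 by case: (a x y).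
have z2 x y : phi x y x = 0 by case: (a x y).
have z3 x y : phi y x x = 0 by case: (a x y).
rewrite (scalar_comb3 _ _ _ _ _ _ (s1 _ _)) !(scalar_comb3 _ _ _ _ _ _ (s2 _ _)).
rewrite !(scalar_comb3 _ _ _ _ _ _ (s3 _ _)) !z1 !z2 !z3.
rewrite (alternating3_swap12 v w u) (alternating3_swap23 v u w).
rewrite (alternating3_swap12 u w v) (alternating3_swap23 u v w).
rewrite (alternating3_swap12 u v w).
by ring.
Qed.

End Alternating.

(** * Lie derivative of a three-form *)

Section LieDerivative.
Context {R : realType} {n : nat}.
Local Notation E := 'rV[R]_n.
Context (D : set E) (oD : open D) (Om : E -> E -> E -> E -> R).
Context (aOm : forall z, alternating3 (Om z)).
Context (sOm : forall v1 v2 v3, smooth_on D (fun z => Om z v1 v2 v3)).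
Implicit Types (X Y : E -> E) (z v : E).

(** This is [lie_derivative] read in the chart: the bracket of [Y] with a constant field v is - 'd Y
    z v, whence the plus signs. *)
Definition lie_der Y z v1 v2 v3 : R :=
  'd (fun y => Om y v1 v2 v3) z (Y z) + Om z ('d Y z v1) v2 v3
  + Om z v1 ('d Y z v2) v3 + Om z v1 v2 ('d Y z v3).

Lemma smooth_three_form_apply X1 X2 X3 : smooth_on D X1 -> smooth_on D X2 ->
  smooth_on D X3 -> smooth_on D (fun z => Om z (X1 z) (X2 z) (X3 z)).
Proof.
move=> s1 s2 s3.
apply: (smooth_form_apply (b := fun z v => Om z (X1 z) (X2 z) v)) => //.
  by move=> z; have [_ _ + _] := aOm z.
move=> v3; apply: (smooth_form_apply (b := fun z v => Om z (X1 z) v v3)) => //.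
  by move=> z; have [_ + _ _] := aOm z.
move=> v2; apply: (smooth_form_apply (b := fun z v => Om z v v2 v3)) => //.
by move=> z; have [+ _ _ _] := aOm z.
Qed.

Lemma smooth_cst (V W : normedModType R) (A : set V) (c : W) :
  smooth_on A (fun=> c).
Proof. by move=> m; exact: class_C_cst. Qed.

Lemma diff_three_form_apply X1 X2 X3 z v : D z -> smooth_on D X1 ->
  smooth_on D X2 -> smooth_on D X3 ->
  'd (fun z => Om z (X1 z) (X2 z) (X3 z)) z v =
  'd (fun y => Om y (X1 z) (X2 z) (X3 z)) z v
  + Om z ('d X1 z v) (X2 z) (X3 z) + Om z (X1 z) ('d X2 z v) (X3 z)
  + Om z (X1 z) (X2 z) ('d X3 z v).
Proof.
move=> Dz s1 s2 s3.
have sc1 y v2 v3 : scalar (fun u => Om y u v2 v3) by have [+ _ _ _] := aOm y.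
have sc2 y v1 v3 : scalar (fun u => Om y v1 u v3) by have [_ + _ _] := aOm y.
have sc3 y v1 v2 : scalar (fun u => Om y v1 v2 u) by have [_ _ + _] := aOm y.
apply: (etrans (diff_form_apply (b := fun z v => Om z (X1 z) (X2 z) v) v Dz
  (fun y => sc3 _ _ _) (fun v3 => smooth_three_form_apply s1 s2 (smooth_cst _ v3)) s3)).
congr (_ + _).
apply: (etrans (diff_form_apply (b := fun y u => Om y (X1 y) u (X3 z)) v Dz
  (fun y => sc2 _ _ _) (fun v2 => smooth_three_form_apply s1 (smooth_cst _ v2)
    (smooth_cst _ (X3 z))) s2)).
congr (_ + _).
exact: (diff_form_apply (b := fun y u => Om y u (X2 z) (X3 z)) v Dz
  (fun y => sc1 _ _ _) (fun v1 => sOm v1 (X2 z) (X3 z)) s1).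
Qed.

(** Leibniz rule on variable fields: the derivatives of the [Xi] along [Y] combine with those of [Y]
    along the [Xi] into brackets. *)
Lemma lie_der_apply Y X1 X2 X3 z : D z -> smooth_on D X1 ->
  smooth_on D X2 -> smooth_on D X3 ->
  'd (fun z => Om z (X1 z) (X2 z) (X3 z)) z (Y z) =
  lie_der Y z (X1 z) (X2 z) (X3 z)
  + Om z (bracket Y X1 z) (X2 z) (X3 z) + Om z (X1 z) (bracket Y X2 z) (X3 z)
  + Om z (X1 z) (X2 z) (bracket Y X3 z).
Proof.
move=> Dz s1 s2 s3; apply: (etrans (diff_three_form_apply (Y z) Dz s1 s2 s3)).
have [sc1 sc2 sc3 _] := aOm z.
have scB (f : E -> R) u v : scalar f -> f (u - v) = f u - f v.
  by move=> sf; rewrite scalar_formD // -scaleN1r scalar_formZ // mulN1r.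
rewrite /lie_der /bracket (scB _ _ _ (sc1 _ _)) (scB _ _ _ (sc2 _ _)) (scB _ _ _ (sc3 _ _)).
by ring.
Qed.

(** Together with [alternating3_det], this lets the Lie derivative be computed from its value on a
    single frame. *)
Lemma lie_der_alternating Y z : D z -> alternating3 (lie_der Y z).
Proof.
move=> Dz; have [sc1 sc2 sc3 a] := aOm z.
have dOm v1 v2 v3 : differentiable (fun y => Om y v1 v2 v3) z := (sOm v1 v2 v3 1%N).1 z Dz.
have dcomb (f g h : E -> R) k : differentiable g z -> differentiable h z ->
    (forall y, f y = k * g y + h y) ->
    'd f z (Y z) = k * 'd g z (Y z) + 'd h z (Y z).
  move=> dg dh fE; have -> : f = (fun y => k * g y + h y) by apply/funext.
  have dkg : differentiable (fun y => k * g y) z := differentiableZ k dg.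
  by apply: (etrans (diffDE (Y z) dkg dh)); apply: congr2 => //; exact: diffMcE.
have dzero (f : E -> R) : (forall y, f y = 0) -> 'd f z (Y z) = 0.
  by move=> f0; have -> : f = (fun=> 0) by [apply/funext]; exact: diff_cstE.
have scD4 (f1 f2 f3 f4 : E -> R) : scalar f1 -> scalar f2 -> scalar f3 ->
    scalar f4 -> scalar (fun u => f1 u + f2 u + f3 u + f4 u).
  by move=> h1 h2 h3 h4 k u v; rewrite h1 h2 h3 h4; ring.
have dYP k u v : 'd Y z (k *: u + v) = k *: 'd Y z u + 'd Y z v by exact: linearP.
have scY (f : E -> R) : scalar f -> scalar (fun u => f ('d Y z u)).
  move=> sf k u v; apply: (etrans (congr1 f (dYP k u v))); exact: sf.
split.
- move=> v2 v3; apply: (scD4 (fun u => 'd (fun y => Om y u v2 v3) z (Y z))) => //.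
    by move=> k u v; apply: dcomb => // y; have [+ _ _ _] := aOm y; exact.
  exact: (scY (fun u => Om z u v2 v3)).
- move=> v1 v3; apply: (scD4 (fun u => 'd (fun y => Om y v1 u v3) z (Y z))) => //.
    by move=> k u v; apply: dcomb => // y; have [_ + _ _] := aOm y; exact.
  exact: (scY (fun u => Om z v1 u v3)).
- move=> v1 v2; apply: (scD4 (fun u => 'd (fun y => Om y v1 v2 u) z (Y z))) => //.
    by move=> k u v; apply: dcomb => // y; have [_ _ + _] := aOm y; exact.
  exact: (scY (fun u => Om z v1 v2 u)).
have sw12 := alternating3_swap12 (aOm z); have sw23 := alternating3_swap23 (aOm z).
have z1 x y : Om z x x y = 0 by case: (a x y).
have z2 x y : Om z x y x = 0 by case: (a x y).
have z3 x y : Om z y x x = 0 by case: (a x y).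
move=> u v; split; rewrite /lie_der.
- apply: (etrans (congr1 (fun t => t + _ + _ + _) (dzero (fun y => Om y u u v) _))).
    by move=> y; have [_ _ _ /(_ u v)[]] := aOm y.
  by rewrite z1 (sw12 u); ring.
- apply: (etrans (congr1 (fun t => t + _ + _ + _) (dzero (fun y => Om y u v u) _))).
    by move=> y; have [_ _ _ /(_ u v)[]] := aOm y.
  by rewrite z2 (sw12 v) (sw23 v u) (sw12 u v); ring.
- apply: (etrans (congr1 (fun t => t + _ + _ + _) (dzero (fun y => Om y v u u) _))).
    by move=> y; have [_ _ _ /(_ u v)[]] := aOm y.
  by rewrite z3 (sw23 v u); ring.
Qed.

End LieDerivative.

(** * Flat coordinates *)

Section FlatCoordinates.
Context {R : realType}.
Local Notation E := 'rV[R]_3.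
Context (D : set E) (oD : open D) (w : E -> E -> R) (Om : E -> E -> E -> E -> R).
Context (wscal : forall z, scalar (w z)) (ws : forall v, smooth_on D (w^~ v)).
Context (aOm : forall z, alternating3 (Om z)).
Context (sOm : forall v1 v2 v3, smooth_on D (fun z => Om z v1 v2 v3)).
Context (T Y1 Y2 : E -> E).
Context (sT : smooth_on D T) (sY1 : smooth_on D Y1) (sY2 : smooth_on D Y2).
Context (wT : forall z, D z -> w z (T z) = 1).
Context (wY1 : forall z, D z -> w z (Y1 z) = 0).
Context (wY2 : forall z, D z -> w z (Y2 z) = 0).
Context (kerw : forall z v, D z -> w z v = 0 ->
  exists s t, v = s *: Y1 z + t *: Y2 z).
Context (OmTY : forall z, D z -> Om z (T z) (Y2 z) (Y1 z) = 1).
Context (dw : forall z u v, D z -> 'd (w^~ v) z u = 'd (w^~ u) z v).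

(** The dual coframe along the leaves is obtained by contracting [Om] with the normalised frame, so
    it inherits smoothness without inverting a matrix. *)
Let eta1 z v := Om z (T z) (Y2 z) v.
Let eta2 z v := Om z (T z) v (Y1 z).

Let eta1_scalar z : scalar (eta1 z).
Proof. by have [_ _ + _] := aOm z; exact. Qed.

Let eta2_scalar z : scalar (eta2 z).
Proof. by have [_ + _ _] := aOm z; exact. Qed.

Let eta1_smooth v : smooth_on D (eta1^~ v).
Proof. by apply: smooth_three_form_apply => //; exact: smooth_cst. Qed.

Let eta2_smooth v : smooth_on D (eta2^~ v).
Proof. by apply: smooth_three_form_apply => //; exact: smooth_cst. Qed.

Let eta1Y2 z : eta1 z (Y2 z) = 0.
Proof. by have [_ _ _ /(_ (Y2 z) (T z))[]] := aOm z. Qed.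

Let eta2Y1 z : eta2 z (Y1 z) = 0.
Proof. by have [_ _ _ /(_ (Y1 z) (T z))[]] := aOm z. Qed.

Let eta1Y1 z : D z -> eta1 z (Y1 z) = 1.
Proof. exact: OmTY. Qed.

Let eta2Y2 z : D z -> eta2 z (Y2 z) = 1.
Proof. exact: OmTY. Qed.

Let ker_decomposition z v : D z -> w z v = 0 ->
  v = eta1 z v *: Y1 z + eta2 z v *: Y2 z.
Proof.
move=> Dz /(kerw Dz)[s [t ->]].
rewrite (scalar_formD _ _ (eta1_scalar z)) !(scalar_formZ _ _ (eta1_scalar z)).
rewrite (scalar_formD _ _ (eta2_scalar z)) !(scalar_formZ _ _ (eta2_scalar z)).
rewrite eta1Y1 // eta1Y2 eta2Y1 eta2Y2 //.
by rewrite !mulr1 !mulr0 addr0 add0r.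
Qed.

Let diff_constant (f : E -> R) (k : R) z v : D z ->
  (forall z, D z -> f z = k) -> 'd f z v = 0.
Proof.
move=> Dz fk; have kn : \near z, (fun=> k) z = f z.
  by apply: filterS (open_nbhs_nbhs (conj oD Dz)) => y /fk ->.
have [_ dE] := near_eq_diff kn (differentiable_cst k z).
by apply: (etrans (congr1 (@^~ v) dE)); exact: diff_cstE.
Qed.

(** In Cartan's formula [w] is closed and both w(Y1) and w(Y2) are constantly zero on [D], so only
    the bracket term is left. *)
Let w_bracket z : D z -> w z (bracket Y1 Y2 z) = 0.
Proof.
move=> Dz.
have aux (l s t c : R) : l = s - t - c -> l = 0 -> s = 0 -> t = 0 -> c = 0 by lra.
apply: aux (cartan_formula Dz wscal ws sY1 sY2) _ _ _.
- exact: (etrans (congr1 (fun t => t - _) (dw (Y1 z) (Y2 z) Dz)) (subrr _)).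
- exact: diff_constant wY2.
- exact: diff_constant wY1.
Qed.

Lemma bracket_decomposition z : D z ->
  bracket Y1 Y2 z = eta1 z (bracket Y1 Y2 z) *: Y1 z
                  + eta2 z (bracket Y1 Y2 z) *: Y2 z.
Proof. by move=> Dz; apply: ker_decomposition => //; exact: w_bracket. Qed.

(** This is h = - q. Differentiate Om(T, Y2, Y1) = 1 along [Y1]: the term in [Y1, T] vanishes
    because w(T) is constant and [w] closed, which puts this bracket in the span of [Y1] and [Y2];
    [Y1, Y1] is zero; the term left is [eta2] of [Y1, Y2]. *)
Lemma lie_der_normalized_frame z v1 v2 v3 : D z ->
  lie_der Om Y1 z v1 v2 v3 = - eta2 z (bracket Y1 Y2 z) * Om z v1 v2 v3.
Proof.
move=> Dz.
have wT0 : w z (bracket Y1 T z) = 0.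
  have aux (l s t c : R) : l = s - t - c -> l = 0 -> s = 0 -> t = 0 -> c = 0.
    by move=> -> + s0 t0; rewrite s0 t0 subr0 sub0r => /eqP; rewrite oppr_eq0 => /eqP.
  apply: aux (cartan_formula Dz wscal ws sY1 sT) _ _ _.
  - exact: (etrans (congr1 (fun t => t - _) (dw (Y1 z) (T z) Dz)) (subrr _)).
  - exact: diff_constant wT.
  - exact: diff_constant wY1.
have OmT0 : Om z (bracket Y1 T z) (Y2 z) (Y1 z) = 0.
  have [s1 _ _ a] := aOm z; have [s [t ->]] := kerw Dz wT0.
  rewrite (scalar_formD _ _ (s1 _ _)) !(scalar_formZ _ _ (s1 _ _)).
  have [_ -> _] := a (Y1 z) (Y2 z); have [-> _ _] := a (Y2 z) (Y1 z).
  by rewrite !mulr0 addr0.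
have OmY0 : Om z (T z) (Y2 z) (bracket Y1 Y1 z) = 0.
  have [_ _ s3 _] := aOm z.
  have -> : bracket Y1 Y1 z = 0 *: Y1 z by rewrite /bracket subrr scale0r.
  by rewrite (scalar_formZ _ _ (s3 _ _)) mul0r.
have lieT : lie_der Om Y1 z (T z) (Y2 z) (Y1 z) = - eta2 z (bracket Y1 Y2 z).
  have := etrans (esym (diff_constant (Y1 z) Dz OmTY))
    (lie_der_apply oD aOm sOm Y1 Dz sT sY2 sY1).
  rewrite OmT0 OmY0 !addr0 => /eqP; rewrite eq_sym addr_eq0 => /eqP ->.
  by [].
have vE v : exists s t r, v = s *: T z + t *: Y2 z + r *: Y1 z.
  have wv0 : w z (v - w z v *: T z) = 0.
    rewrite (scalar_formD _ _ (wscal z)) -scaleNr (scalar_formZ _ _ (wscal z)).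
    by rewrite wT // mulr1 subrr.
  have [s [t vE]] := kerw Dz wv0.
  by exists (w z v), t, s; rewrite -addrA [t *: _ + _]addrC -vE addrC subrK.
have [s1 [t1 [r1 ->]]] := vE v1; have [s2 [t2 [r2 ->]]] := vE v2.
have [s3 [t3 [r3 ->]]] := vE v3.
rewrite (alternating3_det (lie_der_alternating aOm sOm Y1 Dz)).
by rewrite (alternating3_det (aOm z)) lieT OmTY // mulr1 mulrC.
Qed.

(** The kernel of [w] is a plane, so the exterior derivative restricted to it is determined by its
    value on the pair (Y1, Y2), given by Cartan's formula. *)
Let closed_on_kernel (D' : set E) (b : E -> E -> R) z u v : D' `<=` D ->
  D' z -> (forall z, scalar (b z)) -> (forall v, smooth_on D' (b^~ v)) ->
  'd (fun z => b z (Y2 z)) z (Y1 z) - 'd (fun z => b z (Y1 z)) z (Y2 z) =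
    b z (bracket Y1 Y2 z) ->
  w z u = 0 -> w z v = 0 -> 'd (b^~ v) z u = 'd (b^~ u) z v.
Proof.
move=> D'D D'z bs sb db wu wv; have Dz := D'D _ D'z.
have sub (X : E -> E) : smooth_on D X -> smooth_on D' X.
  by move=> sX m; apply: class_C_sub (sX m).
have A12 : 'd (b^~ (Y2 z)) z (Y1 z) - 'd (b^~ (Y1 z)) z (Y2 z) = 0.
  apply: (etrans (cartan_formula D'z bs sb (sub _ sY1) (sub _ sY2))).
  by rewrite db subrr.
pose A (x y : E) := \sum_i y 0 i * 'd (b^~ (delta_mx 0 i)) z x.
have AE x y : 'd (b^~ y) z x = A x y by exact: diff_scalar_sum_basis.
have ADr x y y' k k' : A x (k *: y + k' *: y') = k * A x y + k' * A x y'.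
  rewrite /A !mulr_sumr -big_split; apply: eq_bigr => i _.
  by rewrite !mxE /= mulrDl !mulrA.
have ADl x x' y k k' : A (k *: x + k' *: x') y = k * A x y + k' * A x' y.
  rewrite /A !mulr_sumr -big_split; apply: eq_bigr => i _.
  have -> : 'd (b^~ (delta_mx 0 i)) z (k *: x + k' *: x') =
    k * 'd (b^~ (delta_mx 0 i)) z x + k' * 'd (b^~ (delta_mx 0 i)) z x'.
    by rewrite linearP linearZ.
  by rewrite /= mulrDr; congr (_ + _); exact: mulrCA.
rewrite (AE (Y1 z) (Y2 z)) (AE (Y2 z) (Y1 z)) in A12.
apply: (etrans (AE u v)); apply: (etrans _ (esym (AE v u))).
have [s [t ->]] := kerw Dz wu; have [s' [t' ->]] := kerw Dz wv.
rewrite !ADr !ADl; move/eqP: A12; rewrite subr_eq0 => /eqP ->.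
by ring.
Qed.

(** The vectors e 1 and e 2 are Y2 and Y1 multiplied by exp(lam) and exp(-lam). Only [s != 0] is
    recorded, as a line sees no more, and the reciprocity is contained in the volume identity. Index
    1 goes with [Y2] and index 2 with [Y1], in agreement with [G2B_structure]. *)
Theorem flat_coordinates z0 : D z0 ->
  (forall z, D z ->
    let p z := eta1 z (bracket Y1 Y2 z) in let q z := eta2 z (bracket Y1 Y2 z) in
    'd p z (Y1 z) - 'd q z (Y2 z) - 2 * p z * q z = 0) ->
  exists U (Phi G : E -> E),
    [/\ open U, U z0, U `<=` D & open (Phi @` U)] /\
    [/\ forall z, U z -> G (Phi z) = z, smooth_on U Phi, smooth_on (Phi @` U) G
      & forall z, U z -> let e i := 'd G (Phi z) (delta_mx 0 i) in
        [/\ w z (e 0) = 1, Om z (e 0) (e 1) (e 2) = 1,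
          exists2 s, s != 0 & e 1 = s *: Y2 z
        & exists2 s, s != 0 & e 2 = s *: Y1 z]].
Proof.
move=> Dz0 /= tau0.
pose p z := eta1 z (bracket Y1 Y2 z); pose q z := eta2 z (bracket Y1 Y2 z).
have sB : smooth_on D (bracket Y1 Y2) by exact: bracket_smooth.
have sp : smooth_on D p by exact: smooth_form_apply.
have sq : smooth_on D q by exact: smooth_form_apply.
have z0lin : linear (fun _ : E => 0 : E) by move=> k u v; rewrite scaler0 addr0.
(* With the zero projection the fibre is the whole space, so the fibrewise statement is the ordinary
   Poincaré lemma and yields [F] with dF = w. *)
pose c0 : {linear E -> E} := HB.pack (fun _ : E => 0 : E)
  (GRing.isLinear.Build _ _ _ _ _ z0lin).
have dwc (z u v : E) : D z -> c0 u = 0 -> c0 v = 0 -> 'd (w^~ v) z u = 'd (w^~ u) z v.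
  by move=> Dz _ _; exact: dw.
have [D0 [F [oD0 D0z0 D0D sF dF]]] :=
  @fiberwise_poincare R 3 D w c0 wscal ws (fun=> erefl) z0 oD Dz0 dwc.
have {}dF z v : D0 z -> 'd F z v = w z v by move=> D0z; exact: dF.
have sub (D' : set E) (W : normedModType R) (X : E -> W) : D' `<=` D ->
    smooth_on D X -> smooth_on D' X.
  by move=> D'D sX m; apply: class_C_sub (sX m).
(* Closedness on the leaves is tested on the pair (Y1, Y2) only. The same statement produces [lam],
   [f2] and [f1]. *)
have primitive (D' : set E) (b : E -> E -> R) : open D' -> D' z0 -> D' `<=` D0 ->
    (forall z, scalar (b z)) -> (forall v, smooth_on D' (b^~ v)) ->
    (forall z, D' z -> 'd (fun z => b z (Y2 z)) z (Y1 z)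
      - 'd (fun z => b z (Y1 z)) z (Y2 z) = b z (bracket Y1 Y2 z)) ->
    exists D1 (g : E -> R), [/\ open D1, D1 z0, D1 `<=` D', smooth_on D1 g
      & forall z v, D1 z -> w z v = 0 -> 'd g z v = b z v].
  move=> oD' D'z0 D'D0 bs sb db.
  have D'D := subset_trans D'D0 D0D.
  have F0 : exists v, 'd F z0 v <> 0.
    exists (T z0) => FT; have := wT Dz0.
    rewrite -(dF _ _ D0z0) FT => /esym/eqP; exact/negP/oner_neq0.
  have closed_b x u v : D' x -> 'd F x u = 0 -> 'd F x v = 0 ->
      'd (b^~ v) x u = 'd (b^~ u) x v.
    move=> D'x Fu Fv; apply: (closed_on_kernel D'D D'x bs sb (db x D'x)).
      by apply: (etrans (esym (dF _ _ (D'D0 _ D'x)))).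
    by apply: (etrans (esym (dF _ _ (D'D0 _ D'x)))).
  have sF' : smooth_on D' F by move=> m; apply: class_C_sub (sF m).
  have [D1 [g [h1 h2 h3 h4 h5]]] := leafwise_primitive oD' D'z0 sF' F0 bs sb closed_b.
  exists D1, g; split=> // z v D1z wv; apply: h5 => //.
  by apply: (etrans (dF _ _ (D'D0 _ (h3 _ D1z)))).
(* d lam = - q eta1 - p eta2 on the leaves makes exp(lam) eta1 and exp(-lam) eta2
   closed there, and tau = 0 is the condition for such a lam to exist. *)
pose b0 z v := - (q z * eta1 z v + p z * eta2 z v).
have b0scal z : scalar (b0 z).
  by move=> k u v; rewrite /b0 (eta1_scalar z) (eta2_scalar z); ring.
have b0s v : smooth_on D (b0^~ v).
  move=> m; have h := class_CD oD (class_CM oD (sq m) (eta1_smooth v m))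
    (class_CM oD (sp m) (eta2_smooth v m)).
  apply: class_C_ext (class_CM oD (class_C_cst m D (-1 : R)) h) => // z _.
  by rewrite mulN1r.
have eta1B z : D z -> eta1 z (bracket Y1 Y2 z) = p z by [].
have eta2B z : D z -> eta2 z (bracket Y1 Y2 z) = q z by [].
have scN f : smooth_on D f -> forall z v, D z -> 'd (fun z => - f z : R) z v = - 'd f z v.
  move=> sf z v Dz; have df : differentiable f z := (sf 1%N).1 z Dz.
  exact: (congr1 (@^~ v) (diffN df)).
have diff_eq_on (D' : set E) (f g : E -> R) z v : open D' -> D' z ->
    differentiable f z -> (forall z, D' z -> f z = g z) -> 'd g z v = 'd f z v.
  move=> oD' D'z df fg; have fgn : \near z, f z = g z.
    by apply: filterS (open_nbhs_nbhs (conj oD' D'z)) => y /fg.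
  exact: (congr1 (@^~ v) (near_eq_diff fgn df).2).
have [D1 [lam [oD1 D1z0 D1D0 slam dlam]]] : exists D1 (g : E -> R),
    [/\ open D1, D1 z0, D1 `<=` D0, smooth_on D1 g
      & forall z v, D1 z -> w z v = 0 -> 'd g z v = b0 z v].
  apply: primitive => // [v|z D0z]; first exact: sub (b0s v).
  have Dz := D0D _ D0z.
  have e2 : 'd (fun z => b0 z (Y2 z)) z (Y1 z) = - 'd p z (Y1 z).
    have dp : differentiable (fun z => - p z) z.
      by apply: differentiableN; exact: (sp 1%N).1.
    apply: (etrans (diff_eq_on D _ _ z _ oD Dz dp _)); last exact: scN.
    by move=> y Dy; rewrite /b0 eta1Y2 eta2Y2 // mulr0 add0r mulr1.
  have e1 : 'd (fun z => b0 z (Y1 z)) z (Y2 z) = - 'd q z (Y2 z).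
    have dq : differentiable (fun z => - q z) z.
      by apply: differentiableN; exact: (sq 1%N).1.
    apply: (etrans (diff_eq_on D _ _ z _ oD Dz dq _)); last exact: scN.
    by move=> y Dy; rewrite /b0 eta2Y1 eta1Y1 // mulr0 addr0 mulr1.
  apply: (etrans (congr2 (fun s t => s - t) e2 e1)).
  have t0 := tau0 z Dz; rewrite -/p -/q -/(p z) -/(q z) in t0.
  rewrite /b0 eta1B // eta2B //.
  have aux (s t c d : R) : s - t - 2 * c * d = 0 -> - s - - t = - (d * c + c * d) by lra.
  exact: aux t0.
have D1D := subset_trans D1D0 D0D.
(* The factor [k] will be 1 or -1, so both exponentials are treated at once. *)
have elam m (k : R) : class_C m D1 (fun z => expR (k * lam z)).
  apply: class_C_expR => //; apply: class_CM => //; exact: class_C_cst.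
have delam (k : R) z v : D1 z -> differentiable (fun z => expR (k * lam z)) z /\
    'd (fun z => expR (k * lam z)) z v = k * 'd lam z v * expR (k * lam z).
  move=> D1z; have dl : differentiable lam z := (slam 1%N).1 z D1z.
  have dkl : differentiable (fun z => k * lam z) z := differentiableZ k dl.
  have de (y : R) : differentiable (expR : R -> R) y.
    by apply/derivable1_diffP; exact: derivable_expR.
  split; first exact: (differentiable_comp dkl (de _)).
  apply: (etrans (diff_compE v dkl (de _))).
  apply: (etrans (congr1 (@^~ _) (diff1E (de (k * lam z))))).
  rewrite derive1E derive_val; apply: congr2 => //; exact: diffMcE.
have dlamY1 z : D1 z -> 'd lam z (Y1 z) = - q z.
  move=> D1z; have Dz := D1D _ D1z; apply: (etrans (dlam _ _ D1z (wY1 Dz))).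
  by rewrite /b0 eta2Y1 eta1Y1 // mulr0 addr0 mulr1.
have dlamY2 z : D1 z -> 'd lam z (Y2 z) = - p z.
  move=> D1z; have Dz := D1D _ D1z; apply: (etrans (dlam _ _ D1z (wY2 Dz))).
  by rewrite /b0 eta1Y2 eta2Y2 // mulr0 add0r mulr1.
pose b2 z v := expR (1 * lam z) * eta1 z v.
pose b1 z v := expR (-1 * lam z) * eta2 z v.
have b2scal z : scalar (b2 z).
  by move=> k u v; rewrite /b2 (eta1_scalar z); ring.
have b1scal z : scalar (b1 z).
  by move=> k u v; rewrite /b1 (eta2_scalar z); ring.
have [D2 [f2 [oD2 D2z0 D2D1 sf2 df2]]] : exists D2 (g : E -> R),
    [/\ open D2, D2 z0, D2 `<=` D1, smooth_on D2 g
      & forall z v, D2 z -> w z v = 0 -> 'd g z v = b2 z v].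
  apply: primitive => // [v m|z D1z].
    by apply: class_CM; [|exact: elam|exact: (sub _ _ _ D1D (eta1_smooth v) m)].
  have Dz := D1D _ D1z.
  have e2 : 'd (fun z => b2 z (Y2 z)) z (Y1 z) = 0.
    by apply: (diff_constant _ Dz) => y Dy; rewrite /b2 eta1Y2 mulr0.
  have e1 : 'd (fun z => b2 z (Y1 z)) z (Y2 z) = 1 * 'd lam z (Y2 z) * expR (1 * lam z).
    have [de deE] := delam 1 z (Y2 z) D1z.
    apply: (etrans (diff_eq_on D1 _ _ z _ oD1 D1z de _)); last exact: deE.
    by move=> y D1y; rewrite /b2 eta1Y1 ?mulr1 //; exact: D1D.
  apply: (etrans (congr2 (fun s t => s - t) e2 e1)).
  apply: (etrans (congr1 (fun t => 0 - 1 * t * _) (dlamY2 z D1z))).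
  by rewrite /b2 eta1B //; ring.
have [D3 [f1 [oD3 D3z0 D3D2 sf1 df1]]] : exists D3 (g : E -> R),
    [/\ open D3, D3 z0, D3 `<=` D2, smooth_on D3 g
      & forall z v, D3 z -> w z v = 0 -> 'd g z v = b1 z v].
  apply: primitive => // [|v m|z D2z].
  - exact: subset_trans D1D0.
  - apply: class_C_sub D2D1 _.
    by apply: class_CM; [|exact: elam|exact: (sub _ _ _ D1D (eta2_smooth v) m)].
  have D1z := D2D1 _ D2z; have Dz := D1D _ D1z.
  have e2 : 'd (fun z => b1 z (Y1 z)) z (Y2 z) = 0.
    by apply: (diff_constant _ Dz) => y Dy; rewrite /b1 eta2Y1 mulr0.
  have e1 : 'd (fun z => b1 z (Y2 z)) z (Y1 z) = -1 * 'd lam z (Y1 z) * expR (-1 * lam z).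
    have [de deE] := delam (-1) z (Y1 z) D1z.
    apply: (etrans (diff_eq_on D1 _ _ z _ oD1 D1z de _)); last exact: deE.
    by move=> y D1y; rewrite /b1 eta2Y2 ?mulr1 //; exact: D1D.
  apply: (etrans (congr2 (fun s t => s - t) e1 e2)).
  apply: (etrans (congr1 (fun t => -1 * t * _ - 0) (dlamY1 z D1z))).
  by rewrite /b1 eta2B //; ring.
have D3D1 := subset_trans D3D2 D2D1.
have D3D0 := subset_trans D3D1 D1D0.
have D3D := subset_trans D3D0 D0D.
pose Phi (z : E) : E := \row_i [:: F z; f1 z; f2 z]`_i.
have Phi0 : (fun z => Phi z 0 0) = F by apply/funext => z; rewrite mxE.
have Phi1 : (fun z => Phi z 0 1) = f1 by apply/funext => z; rewrite mxE.
have Phi2 : (fun z => Phi z 0 2) = f2 by apply/funext => z; rewrite mxE.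
have I3 (P : 'I_3 -> Prop) : P 0 -> P 1 -> P 2 -> forall i, P i.
  move=> P0 P1 P2 [[|[|[|//]]] Hi].
  - by rewrite (_ : Ordinal Hi = 0) //; apply: val_inj.
  - by rewrite (_ : Ordinal Hi = 1) //; apply: val_inj.
  - by rewrite (_ : Ordinal Hi = 2) //; apply: val_inj.
have sPhi : smooth_on D3 Phi.
  move=> m; apply: class_C_rV => //; apply: I3.
  - by rewrite Phi0; apply: class_C_sub (sF m).
  - by rewrite Phi1; exact: sf1.
  - by rewrite Phi2; apply: class_C_sub (sf2 m).
have dPhi z : D3 z -> differentiable Phi z := (sPhi 1%N).1 z.
have dPhi0 z v : D3 z -> 'd Phi z v 0 0 = w z v.
  move=> D3z; apply: (etrans (esym ((diff_coord 0 (dPhi z D3z)).2 v))).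
  by rewrite Phi0; exact: dF (D3D0 _ D3z).
have dPhi1 z v : D3 z -> 'd Phi z v 0 1 = 'd f1 z v.
  move=> D3z; apply: (etrans (esym ((diff_coord 1 (dPhi z D3z)).2 v))).
  by rewrite Phi1.
have dPhi2 z v : D3 z -> 'd Phi z v 0 2 = 'd f2 z v.
  move=> D3z; apply: (etrans (esym ((diff_coord 2 (dPhi z D3z)).2 v))).
  by rewrite Phi2.
(* On the kernel of [w], df2 = exp(lam) eta1 and df1 = exp(-lam) eta2. Inverting these relations
   recovers [v] from ['d Phi z v], which gives both the injectivity of the differential and the
   vectors e 1 and e 2. *)
have kerPhi z v : D3 z -> w z v = 0 ->
    v = ('d Phi z v 0 2 * expR (-1 * lam z)) *: Y1 z
      + ('d Phi z v 0 1 * expR (1 * lam z)) *: Y2 z.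
  move=> D3z wv.
  have E2 := etrans (dPhi2 z v D3z) (df2 z v (D3D2 _ D3z) wv).
  have E1 := etrans (dPhi1 z v D3z) (df1 z v D3z wv).
  have ee : expR (1 * lam z) * expR (-1 * lam z) = 1.
    by rewrite -expRD mul1r mulN1r subrr expR0.
  apply: (etrans (ker_decomposition (D3D _ D3z) wv)); apply: congr2.
    congr (_ *: _); apply: esym; apply: (etrans (congr1 (fun t => t * _) E2)).
    by rewrite /b2 mulrAC ee mul1r.
  congr (_ *: _); apply: esym; apply: (etrans (congr1 (fun t => t * _) E1)).
  by rewrite /b1 mulrC mulrA ee mul1r.
have [|U [G [[oU Uz0 UD3] [oPU GK sG _]]]] := inverse_function oD3 D3z0 sPhi.
  move=> v dv0.
  have wv : w z0 v = 0 by apply: (etrans (esym (dPhi0 z0 v D3z0))); rewrite dv0 mxE.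
  apply: (etrans (kerPhi z0 v D3z0 wv)).
  by rewrite dv0 !mxE !mul0r !scale0r addr0.
exists U, Phi, G; split; split=> //.
- exact: subset_trans D3D.
- by move=> m; apply: class_C_sub (sPhi m).
move=> z Uz; pose e i := 'd G (Phi z) (delta_mx 0 i).
rewrite -/(e 0) -/(e 1) -/(e 2); have D3z := UD3 _ Uz; have Dz := D3D _ D3z.
have de i : 'd Phi z (e i) = delta_mx 0 i.
  have dG : differentiable G (Phi z) by apply: (sG 1%N).1; exists z.
  have dPhiG : differentiable Phi (G (Phi z)) by rewrite GK //; exact: dPhi.
  have PhiG : \forall y \near Phi z, Phi (G y) = y.
    have PU : (Phi @` U) (Phi z) by exists z.
    by apply: filterS (open_nbhs_nbhs (conj oPU PU)) => _ [y Uy <-]; rewrite GK.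
  by have := diff_cancel (delta_mx 0 i) PhiG dG dPhiG; rewrite GK.
have we i : w z (e i) = (delta_mx 0 i : E) 0 0.
  by apply: (etrans (esym (dPhi0 z _ D3z))); rewrite de.
have e1E : e 1 = expR (1 * lam z) *: Y2 z.
  have we1 : w z (e 1) = 0 by rewrite we mxE.
  apply: (etrans (kerPhi z (e 1) D3z we1)).
  by rewrite de !mxE /= mulr0n mulr1n mul0r scale0r add0r mul1r.
have e2E : e 2 = expR (-1 * lam z) *: Y1 z.
  have we2 : w z (e 2) = 0 by rewrite we mxE.
  apply: (etrans (kerPhi z (e 2) D3z we2)).
  by rewrite de !mxE /= mulr0n mulr1n mul0r scale0r addr0 mul1r.
have we0 : w z (e 0) = 1 by rewrite we mxE.
split=> //.
(* Whatever the transverse derivatives of [f1] and [f2], e 0 differs from [T] by a vector of the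
   leaf; the matrix of (e 0, e 1, e 2) in the frame (T, Y2, Y1) is triangular with diagonal 1,
   exp(lam), exp(-lam). *)
- have we0T : w z (e 0 - T z) = 0.
    rewrite (scalar_formD _ _ (wscal z)) -scaleN1r (scalar_formZ _ _ (wscal z)).
    by rewrite we0 wT //; ring.
  have [s [t e0E]] := kerw Dz we0T.
  have -> : e 0 = 1 *: T z + t *: Y2 z + s *: Y1 z.
    by rewrite scale1r -addrA [t *: _ + _]addrC -e0E addrC subrK.
  have -> : e 1 = 0 *: T z + expR (1 * lam z) *: Y2 z + 0 *: Y1 z.
    by rewrite !scale0r add0r addr0.
  have -> : e 2 = 0 *: T z + 0 *: Y2 z + expR (-1 * lam z) *: Y1 z.
    by rewrite !scale0r !add0r.
  rewrite (alternating3_det (aOm z)) OmTY // mulr1.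
  have ee : expR (1 * lam z) * expR (-1 * lam z) = 1.
    by rewrite -expRD mul1r mulN1r subrr expR0.
  by apply: etrans ee; ring.
- by exists (expR (1 * lam z)) => //; rewrite gt_eqF // expR_gt0.
- by exists (expR (-1 * lam z)) => //; rewrite gt_eqF // expR_gt0.
Qed.

End FlatCoordinates.

(** * Frames of flat coordinates *)

Section CoordinateFrames.
Context {R : realType}.
Local Notation E := 'rV[R]_3.
Context (D : set E) (oD : open D) (w : E -> E -> R) (Om : E -> E -> E -> E -> R).
Context (wscal : forall z, scalar (w z)) (ws : forall v, smooth_on D (w^~ v)).
Context (aOm : forall z, alternating3 (Om z)).
Context (sOm : forall v1 v2 v3, smooth_on D (fun z => Om z v1 v2 v3)).
Context (f G : E -> E) (sf : smooth_on D f) (ofD : open (f @` D)).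
Context (sG : smooth_on (f @` D) G) (GK : forall z, D z -> G (f z) = z).

Let e i z := 'd G (f z) (delta_mx 0 i) : E.

Context (we0 : forall z, D z -> w z (e 0 z) = 1).
Context (we1 : forall z, D z -> w z (e 1 z) = 0).
Context (we2 : forall z, D z -> w z (e 2 z) = 0).
Context (Ome : forall z, D z -> Om z (e 0 z) (e 1 z) (e 2 z) = 1).

Let x i z := f z 0 i.

Let x_smooth i : smooth_on D (x i).
Proof. by move=> m; exact: class_C_coord. Qed.

Lemma exact_form_smooth (A : set E) (g : E -> R) v : smooth_on A g ->
  smooth_on A (fun z => 'd g z v).
Proof. by move=> sg m; exact: (sg m.+1).2. Qed.

Lemma exact_form_scalar (g : E -> R) z : scalar (fun v => 'd g z v).
Proof. by move=> k u v; exact: linearP. Qed.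

Lemma diff_scaleE (g : E -> R) z k v : 'd g z (k *: v) = k * 'd g z v.
Proof. exact: linearZ. Qed.

Let frame_decomposition z v : D z ->
  v = 'd (x 0) z v *: e 0 z + 'd (x 1) z v *: e 1 z + 'd (x 2) z v *: e 2 z.
Proof.
move=> Dz; have df : differentiable f z := (sf 1%N).1 z Dz.
have dG : differentiable G (f z) by apply: (sG 1%N).1; exists z.
have GKn : \near z, G (f z) = z by apply: filterS (open_nbhs_nbhs (conj oD Dz)) => y /GK.
apply: (etrans (esym (diff_cancel v GKn df dG))).
apply: (etrans (linear_rV_sum ('d G (f z)) ('d f z v))).
have xE i : 'd f z v 0 i = 'd (x i) z v by apply: esym; exact: (diff_coord i df).2.
rewrite !big_ord_recl big_ord0 addr0 addrA; apply: congr2.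
  apply: congr2.
    exact: (congr1 (fun t => t *: _) (xE 0)).
  rewrite (_ : lift ord0 ord0 = 1); last exact: val_inj.
  exact: (congr1 (fun t => t *: _) (xE 1)).
rewrite (_ : lift ord0 (lift ord0 ord0) = 2); last exact: val_inj.
exact: (congr1 (fun t => t *: _) (xE 2)).
Qed.

Let dx_frame i j z : D z -> 'd (x i) z (e j z) = (j == i)%:R.
Proof.
move=> Dz; have df : differentiable f z := (sf 1%N).1 z Dz.
have dG : differentiable G (f z) by apply: (sG 1%N).1; exists z.
have fGn : \forall y \near f z, f (G y) = y.
  have fD : (f @` D) (f z) by exists z.
  by apply: filterS (open_nbhs_nbhs (conj ofD fD)) => _ [y Dy <-]; rewrite GK.
have dfG : differentiable f (G (f z)) by rewrite GK.
apply: (etrans ((diff_coord i df).2 (e j z))).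
have fGE := diff_cancel (delta_mx 0 j) fGn dG dfG.
rewrite GK // in fGE.
by apply: (etrans (congr1 (fun u : E => u 0 i) fGE)); rewrite mxE eqxx /= eq_sym.
Qed.

Let w_dx z v : D z -> w z v = 'd (x 0) z v.
Proof.
move=> Dz; apply: (etrans (congr1 (w z) (frame_decomposition v Dz))).
apply: (etrans (scalar_comb3 _ _ _ _ _ _ (wscal z))).
have aux (A B C k l m : R) : A = 1 -> B = 0 -> C = 0 -> k * A + l * B + m * C = k.
  by move=> -> -> ->; rewrite !mulr0 !addr0 mulr1.
exact: aux (we0 Dz) (we1 Dz) (we2 Dz).
Qed.

(** Both [w] and the differential of the coordinate x 0 take the values 1, 0, 0 on the frame, so w =
    d(x 0), and second derivatives commute. *)
Lemma coordinate_form_closed z u v : D z -> 'd (w^~ v) z u = 'd (w^~ u) z v.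
Proof.
move=> Dz.
have wE t s : 'd (w^~ t) z s = 'd (fun y => 'd (x 0) y t) z s.
  have dxt : differentiable (fun y => 'd (x 0) y t) z.
    exact: (exact_form_smooth t (x_smooth 0) 1%N).1.
  have wn : \forall y \near z, 'd (x 0) y t = w y t.
    by apply: filterS (open_nbhs_nbhs (conj oD Dz)) => y /w_dx ->.
  exact: (congr1 (@^~ s) (near_eq_diff wn dxt).2).
apply: (etrans (wE v u)); apply: (etrans _ (esym (wE u v))).
exact: diff_symmetric oD Dz (x_smooth 0 2%N).
Qed.

Let e_smooth i : smooth_on D (e i).
Proof.
have fD z : D z -> (f @` D) (f z) by exists z.
by move=> m; exact: (class_C_comp_rV oD ofD fD (sf m) ((sG m.+1).2 (delta_mx 0 i))).
Qed.

(* Here Y1 = a e2 and Y2 = b e1 with Y1(a) = h a, Y2(a) = - p a and Y1(b) = q b;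
   tau = 0 is the equality of the two expressions for [Y1, Y2](a). *)
Theorem tau_coordinate_frame (D' : set E) (Y1 Y2 : E -> E) (p q h : E -> R) z :
  open D' -> D' `<=` D -> smooth_on D' Y1 -> smooth_on D' Y2 ->
  smooth_on D' p -> smooth_on D' h ->
  (forall z, D' z -> exists2 s, s != 0 & Y1 z = s *: e 2 z) ->
  (forall z, D' z -> exists2 s, s != 0 & Y2 z = s *: e 1 z) ->
  (forall z, D' z -> bracket Y1 Y2 z = p z *: Y1 z + q z *: Y2 z) ->
  (forall z v1 v2 v3, D' z -> lie_der Om Y1 z v1 v2 v3 = h z * Om z v1 v2 v3) ->
  D' z -> 'd p z (Y1 z) + 'd h z (Y2 z) + p z * h z - p z * q z = 0.
Proof.
move=> oD' D'D sY1 sY2 sp sh Y1e Y2e brE lieE D'z.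
have sub (W : normedModType R) (X : E -> W) : smooth_on D X -> smooth_on D' X.
  by move=> sX m; apply: class_C_sub (sX m).
have diffl (g : E -> R) y : smooth_on D' g -> D' y -> differentiable g y.
  by move=> sg; exact: (sg 1%N).1.
have diff_eq_on (g k : E -> R) y v : D' y -> differentiable g y ->
    (forall y, D' y -> g y = k y) -> 'd k y v = 'd g y v.
  move=> D'y dg gk; have gkn : \forall y \near y, g y = k y.
    by apply: filterS (open_nbhs_nbhs (conj oD' D'y)) => t /gk.
  exact: (congr1 (@^~ v) (near_eq_diff gkn dg).2).
have diff_cst_on (k : E -> R) (c : R) y v : D' y -> (forall y, D' y -> k y = c) ->
    'd k y v = 0.
  move=> D'y kc; apply: (etrans (diff_eq_on (fun=> c) k y v D'y _ _)).
  - exact: differentiable_cst.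
  - by move=> t /kc.
  - exact: diff_cstE.
(* Cartan's formula for the exact form dg: the bracket acts on functions as a commutator of
   derivations. *)
have exact_cartan (g : E -> R) (X Y : E -> E) y : smooth_on D' g -> D' y ->
    smooth_on D' X -> smooth_on D' Y ->
    'd g y (bracket X Y y) = 'd (fun z => 'd g z (Y z)) y (X y)
      - 'd (fun z => 'd g z (X z)) y (Y y).
  move=> sg D'y sX sY.
  have c := cartan_formula (b := fun z v => 'd g z v) D'y (exact_form_scalar g)
    (fun v => exact_form_smooth v sg) sX sY.
  have aux (l s t u : R) : l = s - t - u -> l = 0 -> u = s - t.
    by move=> -> /eqP; rewrite subr_eq0 => /eqP ->.
  apply: aux c _; apply: (etrans (congr1 (fun t => t - _)
    (diff_symmetric _ _ oD' D'y (sg 2%N)))); exact: subrr.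
(* The coefficients of [Y1] on e 2 and of [Y2] on e 1, written through coordinate differentials so
   that their smoothness is inherited. *)
pose a z := 'd (x 2) z (Y1 z); pose b z := 'd (x 1) z (Y2 z).
have sx i : smooth_on D' (x i) by exact: sub.
have sdx (i : 'I_3) (Y : E -> E) : smooth_on D' Y -> smooth_on D' (fun z => 'd (x i) z (Y z)).
  move=> sY; exact: (smooth_form_apply (b := fun z v => 'd (x i) z v) oD'
    (exact_form_scalar (x i)) (fun v => exact_form_smooth v (sx i)) sY).
have sa : smooth_on D' a by exact: sdx.
have sb : smooth_on D' b by exact: sdx.
have dxY (y : E) (i j : 'I_3) (s : R) : D' y ->
    'd (x i) y (s *: e j y) = s * (j == i)%:R.
  move=> D'y; apply: (etrans (diff_scaleE _ _ _ _)).
  by apply: congr1; apply: dx_frame; exact: D'D.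
have Y1E y : D' y -> Y1 y = a y *: e 2 y.
  move=> D'y; have [s _ YE] := Y1e y D'y; rewrite YE; congr (_ *: _); apply: esym.
  by apply: (etrans (congr1 ('d (x 2) y) YE)); rewrite dxY // mulr1.
have Y2E y : D' y -> Y2 y = b y *: e 1 y.
  move=> D'y; have [s _ YE] := Y2e y D'y; rewrite YE; congr (_ *: _); apply: esym.
  by apply: (etrans (congr1 ('d (x 1) y) YE)); rewrite dxY // mulr1.
have a_neq0 y : D' y -> a y != 0.
  move=> D'y; have [s s0 YE] := Y1e y D'y.
  by rewrite /a YE dxY // mulr1.
have b_neq0 y : D' y -> b y != 0.
  move=> D'y; have [s s0 YE] := Y2e y D'y.
  by rewrite /b YE dxY // mulr1.
have x1Y1 y : D' y -> 'd (x 1) y (Y1 y) = 0.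
  by move=> D'y; rewrite Y1E // dxY //= mulr0.
have x2Y2 y : D' y -> 'd (x 2) y (Y2 y) = 0.
  by move=> D'y; rewrite Y2E // dxY //= mulr0.
have dbr (g : E -> R) y : D' y -> 'd g y (bracket Y1 Y2 y) =
    p y * 'd g y (Y1 y) + q y * 'd g y (Y2 y).
  move=> D'y; rewrite brE //; apply: (etrans (exact_form_scalar g y (p y) (Y1 y) _)).
  by apply: congr1; exact: diff_scaleE.
(* Apply the bracket to the coordinate x 1, which [Y1] annihilates: the commutator gives Y1(b), the
   decomposition of the bracket gives q b. The coordinate x 2 gives Y2(a) in the same way. *)
have Y1b y : D' y -> 'd b y (Y1 y) = q y * b y.
  move=> D'y; have H1 := exact_cartan _ _ _ _ (sx 1) D'y sY1 sY2.
  have H2 := dbr (x 1) y D'y.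
  have H3 := diff_cst_on _ 0 y (Y2 y) D'y x1Y1.
  have H4 := x1Y1 y D'y.
  have aux (l s t u k1 k2 r : R) : l = s - t -> l = k1 * u + k2 * r -> t = 0 -> u = 0 ->
    s = k2 * r.
    by move=> -> H t0 u0; move: H; rewrite t0 u0 subr0 mulr0 add0r.
  exact: (aux _ _ _ _ _ _ _ H1 H2 H3 H4).
have Y2a y : D' y -> 'd a y (Y2 y) = - p y * a y.
  move=> D'y; have H1 := exact_cartan _ _ _ _ (sx 2) D'y sY1 sY2.
  have H2 := dbr (x 2) y D'y.
  have H3 := diff_cst_on _ 0 y (Y1 y) D'y x2Y2.
  have H4 := x2Y2 y D'y.
  have aux (l s t u k1 k2 r : R) : l = s - t -> l = k1 * r + k2 * u -> s = 0 -> u = 0 ->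
    t = - k1 * r.
    by move=> -> H s0 u0; move: H; rewrite s0 u0 sub0r mulr0 addr0 mulNr => <-; rewrite opprK.
  exact: (aux _ _ _ _ _ _ _ H1 H2 H3 H4).
have se0 : smooth_on D' (e 0) by exact: sub.
have Om_frame y (s t : R) : D' y -> Om y (e 0 y) (s *: e 1 y) (t *: e 2 y) = s * t.
  move=> D'y; have [_ s2 s3 _] := aOm y.
  by rewrite (scalar_formZ _ _ (s2 _ _)) (scalar_formZ _ _ (s3 _ _)) Ome ?mulr1 //; exact: D'D.
have Om_Y y : D' y -> Om y (e 0 y) (Y2 y) (Y1 y) = b y * a y.
  by move=> D'y; rewrite Y1E // Y2E //; exact: Om_frame.
have x0_br y : D' y -> 'd (x 0) y (bracket Y1 (e 0) y) = 0.
  move=> D'y; apply: (etrans (exact_cartan _ _ _ _ (sx 0) D'y sY1 se0)).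
  have x0e0 t : D' t -> 'd (x 0) t (e 0 t) = 1 by move=> D't; apply: dx_frame; exact: D'D.
  have x0Y1 t : D' t -> 'd (x 0) t (Y1 t) = 0.
    by move=> D't; rewrite Y1E // dxY //= mulr0.
  apply: (etrans (congr2 (fun s t => s - t) (diff_cst_on _ 1 y (Y1 y) D'y x0e0)
    (diff_cst_on _ 0 y (e 0 y) D'y x0Y1))).
  exact: subrr.
have Om_br y : D' y -> Om y (bracket Y1 (e 0) y) (Y2 y) (Y1 y) = 0.
  move=> D'y; set u := bracket Y1 (e 0) y.
  have -> : u = 0 *: e 0 y + 'd (x 1) y u *: e 1 y + 'd (x 2) y u *: e 2 y.
    apply: (etrans (frame_decomposition u (D'D _ D'y))).
    exact: (congr1 (fun t => t *: _ + _ + _) (x0_br y D'y)).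
  have -> : Y2 y = 0 *: e 0 y + b y *: e 1 y + 0 *: e 2 y.
    by rewrite !scale0r add0r addr0 Y2E.
  have -> : Y1 y = 0 *: e 0 y + 0 *: e 1 y + a y *: e 2 y.
    by rewrite !scale0r !add0r Y1E.
  rewrite (alternating3_det (aOm y)).
  by rewrite !mul0r !subrr !mulr0 subrr addr0 mul0r.
have Om_br2 y : D' y -> Om y (e 0 y) (bracket Y1 Y2 y) (Y1 y) = q y * (b y * a y).
  move=> D'y; have [_ s2 _ /(_ (Y1 y) (e 0 y))[_ _ z3]] := aOm y.
  rewrite brE // (scalar_formD _ _ (s2 _ _)) !(scalar_formZ _ _ (s2 _ _)) z3.
  by rewrite mulr0 add0r Om_Y.
have Om_br3 y : Om y (e 0 y) (Y2 y) (bracket Y1 Y1 y) = 0.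
  have [_ _ s3 _] := aOm y.
  have -> : bracket Y1 Y1 y = 0 *: Y1 y by rewrite /bracket subrr scale0r.
  by rewrite (scalar_formZ _ _ (s3 _ _)) mul0r.
(* Take the Lie derivative on (e 0, Y2, Y1), where [Om] equals b a. The derivative of [b] cancels
   the term in [Y1, Y2], both being q a b, and h a b is left. *)
have Y1a y : D' y -> 'd a y (Y1 y) = h y * a y.
  move=> D'y; have da := diffl _ _ sa D'y; have db := diffl _ _ sb D'y.
  have sOm' v1 v2 v3 : smooth_on D' (fun z => Om z v1 v2 v3) by exact: sub.
  have H1 := lie_der_apply oD' aOm sOm' Y1 D'y se0 sY2 sY1.
  have H2 : 'd (fun z => Om z (e 0 z) (Y2 z) (Y1 z)) y (Y1 y) =
      b y * 'd a y (Y1 y) + a y * 'd b y (Y1 y).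
    have dab : differentiable (fun y => b y * a y) y := differentiableM db da.
    apply: (etrans (diff_eq_on (fun y => b y * a y) _ y (Y1 y) D'y dab _)).
      by move=> t D't; rewrite Om_Y.
    exact: (diffME (Y1 y) db da).
  have H3 := etrans (esym H2) H1.
  rewrite lieE // Om_Y // Om_br // Om_br2 // Om_br3 Y1b // in H3.
  apply: (mulfI (b_neq0 y D'y)).
  have aux (A B a' q' h' : R) : B * A + a' * (q' * B) = h' * (B * a') + 0 + q' * (B * a') + 0 ->
    B * A = B * (h' * a').
    by move=> H; apply: (addIr (a' * (q' * B))); rewrite H; ring.
  exact: aux H3.
have dap : 'd (fun z => 'd a z (Y2 z)) z (Y1 z) = - (p z * 'd a z (Y1 z) + a z * 'd p z (Y1 z)).
  have dp := diffl _ _ sp D'z; have da := diffl _ _ sa D'z.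
  have dpa : differentiable (fun y => p y * a y) z := differentiableM dp da.
  have dNpa : differentiable (fun y => - (p y * a y)) z := differentiableN dpa.
  apply: (etrans (diff_eq_on _ _ z (Y1 z) D'z dNpa _)).
    by move=> y D'y; rewrite Y2a // mulNr.
  apply: (etrans (congr1 (@^~ (Y1 z)) (diffN dpa))).
  exact: (congr1 (fun t => - t) (diffME (Y1 z) dp da)).
have dah : 'd (fun z => 'd a z (Y1 z)) z (Y2 z) = h z * 'd a z (Y2 z) + a z * 'd h z (Y2 z).
  have dh := diffl _ _ sh D'z; have da := diffl _ _ sa D'z.
  have dha : differentiable (fun y => h y * a y) z := differentiableM dh da.
  apply: (etrans (diff_eq_on _ _ z (Y2 z) D'z dha _)).
    by move=> y D'y; rewrite Y1a.
  exact: (diffME (Y2 z) dh da).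
(* Each side of [Y1, Y2](a) = Y1(Y2(a)) - Y2(Y1(a)) is [a] times an expression in p, q, h;
   cancelling the nonzero factor [a] leaves tau = 0. *)
have H1 := exact_cartan a Y1 Y2 z sa D'z sY1 sY2.
have H2 := etrans (etrans (esym (dbr a z D'z)) H1) (congr2 (fun s t => s - t) dap dah).
rewrite Y1a // Y2a // in H2.
apply: (mulfI (a_neq0 z D'z)); rewrite mulr0.
have aux (a' p' q' h' P H : R) :
    p' * (h' * a') + q' * (- p' * a') = - (p' * (h' * a') + a' * P) - (h' * (- p' * a') + a' * H) ->
    a' * (P + H + p' * h' - p' * q') = 0.
  by move/eqP; rewrite -subr_eq0 => /eqP <-; ring.
exact: aux H2.
Qed.

End CoordinateFrames.

(** * From the chart to the body *)

(** Replacing one of the three vectors by a vanishing combination multiplies [phi u v w] by the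
    corresponding coefficient, which is therefore zero. *)
Lemma alternating3_free (F : fieldType) (V : vectType F) (phi : V -> V -> V -> F)
    u v w : alternating3 phi -> phi u v w != 0 -> free [:: u; v; w].
Proof.
move=> aphi phi0; apply/(freeP (X := [tuple u; v; w])) => k.
rewrite !big_ord_recl big_ord0 /= addr0 addrA => k0.
set k1 := k (lift _ _) in k0 *; set k2 := k (lift _ _) in k0 *.
have det := alternating3_det aphi u v w.
have phi00 x y : [/\ phi 0 x y = 0, phi x 0 y = 0 & phi x y 0 = 0].
  have [s1 s2 s3 _] := aphi; rewrite -(scale0r 0) (scalar_formZ _ _ (s1 _ _)).
  by rewrite (scalar_formZ _ _ (s2 _ _)) (scalar_formZ _ _ (s3 _ _)) !mul0r.
have coef0 c d : d * phi u v w = 0 -> d = c -> c = 0.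
  by move/eqP; rewrite mulf_eq0 (negbTE phi0) orbF => /eqP -> <-.
have e0 : k ord0 = 0.
  have := det (k ord0) k1 k2 0 1 0 0 0 1; rewrite k0; have [-> _ _] := phi00
    (0 *: u + 1 *: v + 0 *: w) (0 *: u + 0 *: v + 1 *: w).
  by move/esym/coef0; apply; ring.
have e1 : k1 = 0.
  have := det 1 0 0 (k ord0) k1 k2 0 0 1; rewrite k0; have [_ -> _] := phi00
    (1 *: u + 0 *: v + 0 *: w) (0 *: u + 0 *: v + 1 *: w).
  by move/esym/coef0; apply; ring.
have e2 : k2 = 0.
  have := det 1 0 0 0 1 0 (k ord0) k1 k2; rewrite k0; have [_ _ ->] := phi00
    (1 *: u + 0 *: v + 0 *: w) (0 *: u + 1 *: v + 0 *: w).
  by move/esym/coef0; apply; ring.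
move=> [[|[|[|//]]] Hi].
- by rewrite (_ : Ordinal Hi = ord0) //; apply: val_inj.
- by rewrite (_ : Ordinal Hi = lift ord0 ord0) //; apply: val_inj.
- by rewrite (_ : Ordinal Hi = lift ord0 (lift ord0 ord0)) //; apply: val_inj.
Qed.

(** * Dictionary between the body and the image of its chart *)

Section Transfer.
Context {R : realType} {B : body R}.
Local Notation E := 'rV[R]_3.
Implicit Types (U : set B) (X Y : B -> E).

Lemma param_image U z : ((chart : B -> E) @` U) z -> U (param z) /\ chart (param z : B) = z.
Proof. by move=> [x Ux <-]; rewrite chartK. Qed.

Lemma paramK z : range (chart : B -> E) z -> chart (param z : B) = z.
Proof. by move=> [x _ <-]; rewrite chartK. Qed.

Lemma chart_preimage_image (D : set E) : D `<=` range (chart : B -> E) ->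
  (chart : B -> E) @` [set x : B | D (chart x)] = D.
Proof.
move=> DR; apply/seteqP; split=> [_ [x Dx <-] //|z Dz].
by exists (param z); rewrite /= paramK //; exact: DR.
Qed.

Lemma lie_bracketE X Y (x : B) :
  lie_bracket X Y x = bracket (X \o param) (Y \o param) (chart x).
Proof. by rewrite /bracket /lie_bracket /body_diff /= chartK. Qed.

Lemma lie_derivativeE Y (Om : B -> E -> E -> E -> R) (x : B) v1 v2 v3 :
  (forall x, alternating3 (Om x)) ->
  lie_derivative Y Om x v1 v2 v3 =
  lie_der (fun z => Om (param z)) (Y \o param) (chart x) v1 v2 v3.
Proof.
move=> aOm; have [s1 s2 s3 _] := aOm x.
have brc v : lie_bracket Y (cst v) x = - 1 *: 'd (Y \o param) (chart x) v.
  rewrite /lie_bracket /body_diff scaleN1r.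
  by apply: (etrans (congr1 (fun t => t - _) (diff_cstE v (chart x) (Y x)))); rewrite sub0r.
rewrite /lie_derivative /lie_der !brc /= chartK.
rewrite (scalar_formZ _ _ (s1 _ _)) (scalar_formZ _ _ (s2 _ _)) (scalar_formZ _ _ (s3 _ _)).
by rewrite /body_diff !mulN1r !opprK.
Qed.

Lemma chart_comp_smooth (W : normedModType R) (D : set E) (g : E -> W) :
  open D -> D `<=` range (chart : B -> E) -> smooth_on D g ->
  body_smooth [set x : B | D (chart x)] (g \o chart).
Proof.
move=> oD DR sg m; rewrite chart_preimage_image //.
by apply: class_C_ext (sg m) => // z /set_mem Dz; rewrite /= paramK //; exact: DR.
Qed.

Lemma diff_chart_comp (W : normedModType R) (D : set E) (g : E -> W) z v :
  open D -> D `<=` range (chart : B -> E) -> D z -> differentiable g z ->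
  'd ((g \o chart) \o (param : E -> B)) z v = 'd g z v.
Proof.
move=> oD DR Dz dg.
have gn : \forall y \near z, g y = ((g \o chart) \o (param : E -> B)) y.
  by apply: filterS (open_nbhs_nbhs (conj oD Dz)) => y /DR Ry; rewrite /= paramK.
exact: (congr1 (@^~ v) (near_eq_diff gn dg).2).
Qed.

End Transfer.

Lemma vline_scale (F : fieldType) (V : vectType F) (s : F) (v : V) : s != 0 ->
  <[s *: v]>%VS = <[v]>%VS.
Proof.
move=> s0; apply/eqP; rewrite eqEsubv -!memvE memvZ ?memv_line //=.
by rewrite -[X in X \in _](scalerK s0 v) memvZ // memv_line.
Qed.

(** * The two implications for the given structure *)

Section G2BStructure.
Context {R : realType} {B : body R}.
Local Notation E := 'rV[R]_3.
Context (L1 L2 : B -> {vspace E}) (omega : B -> E -> R).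
Context (Omega : B -> E -> E -> E -> R).
Context (homega : one_form omega).
Context (hker : forall (x : B) (v : E), v \in (L1 x + L2 x)%VS <-> omega x v = 0).
Context (hOmega : volume_form Omega).

Let w z := omega (param z).
Let Om z := Omega (param z).

Let w_scalar z : scalar (w z).
Proof. exact: homega.1. Qed.

Let w_smooth v : smooth_on (range (chart : B -> E)) (w^~ v).
Proof. exact: homega.2 v. Qed.

Let Omega_alternating x : alternating3 (Omega x).
Proof. by have [[s1 s2 s3 a _] _] := hOmega; split. Qed.

Let Om_smooth v1 v2 v3 :
  smooth_on (range (chart : B -> E)) (fun z => Om z v1 v2 v3).
Proof. by have [[_ _ _ _ s] _] := hOmega; exact: s. Qed.

Let w_line1 z v : v \in L1 (param z) -> w z v = 0.
Proof. by move=> vL; apply/hker; apply: (subvP (addvSl _ _)). Qed.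

Let w_line2 z v : v \in L2 (param z) -> w z v = 0.
Proof. by move=> vL; apply/hker; apply: (subvP (addvSr _ _)). Qed.

Let restrict (W : normedModType R) (D : set E) (g : E -> W) :
  D `<=` range (chart : B -> E) -> smooth_on (range (chart : B -> E)) g -> smooth_on D g.
Proof. by move=> DR sg m; apply: class_C_sub (sg m). Qed.

Section Integrable.
Context (hint : integrable_structure (G2B_structure L1 L2 omega Omega)).

(** Read in the global chart, local coordinates of the body become a diffeomorphism [f] between open
    sets of R^3 with inverse [G], the setting in which tau is computed. *)
Let chart_frame (x : B) : exists (D : set E) (f G : E -> E),
  let e i z := 'd G (f z) (delta_mx 0 i) : E in
  [/\ open D, D (chart x) & D `<=` range (chart : B -> E)] /\
  [/\ smooth_on D f, open (f @` D), smooth_on (f @` D) G & forall z, D z -> G (f z) = z] /\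
  forall z, D z -> [/\ L1 (param z) = <[e 2 z]>%VS, L2 (param z) = <[e 1 z]>%VS,
    w z (e 0 z) = 1 & Om z (e 0 z) (e 1 z) (e 2 z) = 1].
Proof.
have [U [coord [coord_inv [[oU oC CK sC sI] Ux fr]]]] := hint x.
have fD : (coord \o (param : E -> B)) @` (chart @` U) = coord @` U.
  apply/seteqP; split=> [_ [_ [y Uy <-] <-]|_ [y Uy <-]].
    by exists y => //; rewrite /= chartK.
  by exists (chart y); [exists y|rewrite /= chartK].
exists (chart @` U), (coord \o param), (chart \o coord_inv) => /=.
split; [|split].
- split=> //; first by exists x.
  by move=> _ [y _ <-]; exists y.
- split; rewrite ?fD // => _ [y Uy <-].
  by rewrite /= chartK CK.
move=> _ [y Uy <-]; rewrite /w /Om /= chartK.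
by have [_ h1 h2 h3 h4] := fr y Uy; split.
Qed.

Lemma integrable_closed x v1 v2 : ext_deriv omega x v1 v2 = 0.
Proof.
have [D [f [G [[oD Dx DR] [[sf ofD sG GK] fr]]]]] := chart_frame x.
pose e i z := 'd G (f z) (delta_mx 0 i) : E.
have we0 z : D z -> w z (e 0 z) = 1 by case/fr.
have we1 z : D z -> w z (e 1 z) = 0.
  by case/fr => _ h _ _; apply: w_line2; rewrite h memv_line.
have we2 z : D z -> w z (e 2 z) = 0.
  by case/fr => h _ _ _; apply: w_line1; rewrite h memv_line.
have h := @coordinate_form_closed R D oD w w_scalar f G sf sG GK we0 we1 we2
  (chart x) v1 v2 Dx.
exact: (etrans (congr1 (fun t => t - _) h) (subrr _)).
Qed.

Lemma integrable_tau : tau_vanishes L1 L2 Omega.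
Proof.
move=> U Y1 Y2 Y3 p q h oU sY1 sY2 sY3 sp sq sh hY hbr hlie x Ux.
have [D [f [G [[oD Dx DR] [[sf ofD sG GK] fr]]]]] := chart_frame x.
pose e i z := 'd G (f z) (delta_mx 0 i) : E.
pose D' := D `&` (chart @` U).
have oD' : open D' by exact: openI.
have D'D : D' `<=` D by move=> z [].
have D'U z : D' z -> U (param z) /\ chart (param z : B) = z by move=> [_ /param_image].
have sub (W : normedModType R) (g : B -> W) : body_smooth U g -> smooth_on D' (g \o param).
  by move=> sg m; apply: class_C_sub (sg m) => z [].
have Ome z : D z -> Om z (e 0 z) (e 1 z) (e 2 z) = 1 by case/fr.
(* Omega(Y1, Y2, Y3) = 1 excludes zeros of [Y1] and [Y2], so they are nonzero multiples of the
   coordinate vectors spanning the two lines. *)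
have Y_neq0 z : D' z -> Y1 (param z) != 0 /\ Y2 (param z) != 0.
  move=> /D'U[/hY[_ _ OmY] _]; have [s1 s2 _ _] := Omega_alternating (param z).
  split; apply/eqP => Y0; move: OmY; rewrite Y0 -(scale0r 0).
    by rewrite (scalar_formZ _ _ (s1 _ _)) mul0r => /esym/eqP; rewrite oner_eq0.
  by rewrite (scalar_formZ _ _ (s2 _ _)) mul0r => /esym/eqP; rewrite oner_eq0.
have D'x : D' (chart x) by split=> //; exists x.
have Y1e z : D' z -> exists2 s, s != 0 & (Y1 \o param) z = s *: e 2 z.
  move=> D'z; have [L1E _ _ _] := fr z (D'D _ D'z).
  have [/hY[YL _ _] _] := D'U z D'z; have [Y0 _] := Y_neq0 z D'z.
  move: YL; rewrite L1E => /vlineP[s YE]; exists s => //.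
  by apply: contra_neq Y0 => s0; rewrite YE s0 scale0r.
have Y2e z : D' z -> exists2 s, s != 0 & (Y2 \o param) z = s *: e 1 z.
  move=> D'z; have [_ L2E _ _] := fr z (D'D _ D'z).
  have [/hY[_ YL _] _] := D'U z D'z; have [_ Y0] := Y_neq0 z D'z.
  move: YL; rewrite L2E => /vlineP[s YE]; exists s => //.
  by apply: contra_neq Y0 => s0; rewrite YE s0 scale0r.
have brE z : D' z -> bracket (Y1 \o param) (Y2 \o param) z =
    (p \o param) z *: (Y1 \o param) z + (q \o param) z *: (Y2 \o param) z.
  by move=> /D'U[/hbr brz pz]; rewrite -[in LHS]pz -lie_bracketE.
have lieE z v1 v2 v3 : D' z ->
    lie_der Om (Y1 \o param) z v1 v2 v3 = (h \o param) z * Om z v1 v2 v3.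
  move=> /D'U[/hlie liez pz]; rewrite -[in LHS]pz.
  by rewrite -(lie_derivativeE _ _ _ _ _ Omega_alternating) liez.
have sOmD v1 v2 v3 : smooth_on D (fun z => Om z v1 v2 v3) by exact: restrict.
have := tau_coordinate_frame oD (fun z => Omega_alternating (param z)) sOmD sf ofD sG GK
  Ome oD' D'D (sub _ _ sY1) (sub _ _ sY2) (sub _ _ sp) (sub _ _ sh) Y1e Y2e brE lieE D'x.
by rewrite /= chartK.
Qed.

End Integrable.

(** L1 + L2 is the kernel of omega. For two sections of it, Cartan's formula leaves only omega of
    their bracket, which closedness makes zero. *)
Lemma closed_involutive : (forall x v1 v2, ext_deriv omega x v1 v2 = 0) ->
  involutive_distribution (fun x : B => (L1 x + L2 x)%VS).
Proof.
move=> dom U X Y oU sX sY XYL x Ux.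
have UR : chart @` U `<=` range (chart : B -> E) by move=> _ [y _ <-]; exists y.
have Dx : (chart @` U) (chart x) by exists x.
have ws v : smooth_on (chart @` U) (w^~ v) by exact: restrict.
have w0 Z : (forall y, U y -> Z y \in (L1 y + L2 y)%VS) -> forall v,
    'd (fun z => w z ((Z \o param) z)) (chart x) v = 0.
  move=> ZL v; have zn : \forall z \near chart x, (fun=> 0) z = w z ((Z \o param) z).
    apply: filterS (open_nbhs_nbhs (conj oU Dx)) => _ [y Uy <-].
    by rewrite /w /= chartK; apply/esym/hker; exact: ZL.
  have [_ dE] := near_eq_diff zn (differentiable_cst (0 : R) _).
  by apply: (etrans (congr1 (@^~ v) dE)); exact: diff_cstE.
have aux (l s t c : R) : l = s - t - c -> l = 0 -> s = 0 -> t = 0 -> c = 0.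
  by move=> -> + s0 t0; rewrite s0 t0 subr0 sub0r => /eqP; rewrite oppr_eq0 => /eqP.
apply/hker; rewrite lie_bracketE.
have := aux _ _ _ _ (cartan_formula Dx w_scalar ws sX sY) _ _ _.
rewrite /w chartK; apply.
- exact: dom.
- by apply: w0 => y /XYL[].
- by apply: w0 => y /XYL[].
Qed.

(** The normalised frame is built from local generators of the two lines and a vector transverse to
    them at [x0]; the hypothesis on tau is then applied to this frame alone. *)
Lemma flat_integrable : line_distribution L1 -> line_distribution L2 ->
  (forall x : B, exists v : E, omega x v <> 0) ->
  tau_vanishes L1 L2 Omega ->
  (forall x v1 v2, ext_deriv omega x v1 v2 = 0) ->
  integrable_structure (G2B_structure L1 L2 omega Omega).
Proof.
move=> hL1 hL2 homega0 htau dom x0.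
have [U1 [Z1b [oU1 U1x sZ1 Z1P]]] := hL1 x0.
have [U2 [Z2b [oU2 U2x sZ2 Z2P]]] := hL2 x0.
have [v0 /eqP wv0] := homega0 x0.
pose D1 := (chart @` U1) `&` (chart @` U2).
have oD1 : open D1 by exact: openI.
have D1R : D1 `<=` range (chart : B -> E) by move=> z [[y _ <-] _]; exists y.
(* The domain is shrunk to where the constant vector [v0] stays transverse, so that it can be
   rescaled to the field [T] with w(T) = 1. *)
pose D := [set z | D1 z /\ [set r : R | r != 0] (w z v0)].
have oD : open D.
  apply: open_setI_preimage => // z D1z.
  by apply: (class_C_continuous (n := 0) (D := D1)) => //; exact: restrict (w_smooth v0) 0%N.
have DD1 : D `<=` D1 by move=> z [].
have DR : D `<=` range (chart : B -> E) := subset_trans DD1 D1R.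
have Dx0 : D (chart x0).
  by split; [split; [exists x0|exists x0]|rewrite /w /= chartK].
pose T z : E := (w z v0)^-1 *: v0.
pose Y1 := Z1b \o (param : E -> B); pose Z2 := Z2b \o (param : E -> B).
have sY1 : smooth_on D Y1 by move=> m; apply: class_C_sub (sZ1 m) => z [[]].
have sZ2D : smooth_on D Z2 by move=> m; apply: class_C_sub (sZ2 m) => z [[]].
have ws v : smooth_on D (w^~ v) by exact: restrict.
have sOmD v1 v2 v3 : smooth_on D (fun z => Om z v1 v2 v3) by exact: restrict.
have aOm z : alternating3 (Om z) by exact: Omega_alternating.
have sT : smooth_on D T.
  move=> m; apply: class_C_rV => // i.
  have h := class_CM oD (class_CV oD (fun z (Dz : D z) => Dz.2) (ws v0 m))
    (class_C_cst m D (v0 0 i)).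
  by apply: class_C_ext h => // z _; rewrite mxE.
have wT z : D z -> w z (T z) = 1.
  by case=> _ wz; rewrite (scalar_formZ _ _ (w_scalar z)) mulVf.
have Y1P z : D z -> Y1 z != 0 /\ L1 (param z) = <[Y1 z]>%VS.
  by move=> [[/param_image[/Z1P]]].
have Z2P' z : D z -> Z2 z != 0 /\ L2 (param z) = <[Z2 z]>%VS.
  by move=> [[_ /param_image[/Z2P]]].
have wY1 z : D z -> w z (Y1 z) = 0.
  by move=> /Y1P[_ LE]; apply: w_line1; rewrite LE memv_line.
have wZ2 z : D z -> w z (Z2 z) = 0.
  by move=> /Z2P'[_ LE]; apply: w_line2; rewrite LE memv_line.
have kerZ z v : D z -> w z v = 0 -> exists s t, v = s *: Y1 z + t *: Z2 z.
  move=> Dz /hker /memv_addP[u uL [u' u'L ->]].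
  move: uL u'L; rewrite (Y1P z Dz).2 (Z2P' z Dz).2 => /vlineP[s ->] /vlineP[t ->].
  by exists s, t.
pose th z := Om z (T z) (Z2 z) (Y1 z).
have sth : smooth_on D th by exact: smooth_three_form_apply.
(* T, Z2 and Y1 span the tangent space; if [Om] vanished on them, it would vanish on every
   triple. *)
have th_neq0 z : D z -> th z != 0.
  move=> Dz; apply/eqP => th0; have [_ /(_ (param z))[v1 [v2 [v3]]]] := hOmega; apply.
  have vE v : exists s t r, v = s *: T z + t *: Z2 z + r *: Y1 z.
    have wv : w z (v - w z v *: T z) = 0.
      rewrite (scalar_formD _ _ (w_scalar z)) -scaleNr (scalar_formZ _ _ (w_scalar z)).
      by rewrite wT // mulr1 subrr.
    have [s [t vE]] := kerZ z _ Dz wv.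
    by exists (w z v), t, s; rewrite -addrA [t *: _ + _]addrC -vE addrC subrK.
  have [s1 [t1 [r1 ->]]] := vE v1; have [s2 [t2 [r2 ->]]] := vE v2.
  have [s3 [t3 [r3 ->]]] := vE v3.
  by rewrite (alternating3_det (Omega_alternating (param z))) -/(Om z) -/(th z) th0 mulr0.
(* Only [Y2] absorbs the volume factor; [Y1] remains an arbitrary local generator of L1. *)
pose Y2 z : E := (th z)^-1 *: Z2 z.
have sY2 : smooth_on D Y2.
  move=> m; apply: class_C_rV => // i.
  have h := class_CM oD (class_CV oD th_neq0 (sth m)) (class_C_coord i oD (sZ2D m)).
  by apply: class_C_ext h => // z _; rewrite mxE.
have wY2 z : D z -> w z (Y2 z) = 0.
  by move=> Dz; rewrite (scalar_formZ _ _ (w_scalar z)) wZ2 // mulr0.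
have kerw z v : D z -> w z v = 0 -> exists s t, v = s *: Y1 z + t *: Y2 z.
  move=> Dz /(kerZ z v Dz)[s [t ->]]; exists s, (t * th z).
  by rewrite /Y2 scalerA mulfK // th_neq0.
have OmTY z : D z -> Om z (T z) (Y2 z) (Y1 z) = 1.
  move=> Dz; have [_ s2 _ _] := aOm z.
  by rewrite (scalar_formZ _ _ (s2 _ _)) mulVf // th_neq0.
have dw z u v : D z -> 'd (w^~ v) z u = 'd (w^~ u) z v.
  move=> /DR Rz; apply/eqP; rewrite -subr_eq0; apply/eqP.
  by have := dom (param z) u v; rewrite /ext_deriv /body_diff paramK.
have brd z (Dz : D z) := bracket_decomposition oD w_scalar ws aOm sY1 sY2 wY1 wY2 kerw OmTY dw Dz.
have lieE z v1 v2 v3 (Dz : D z) := lie_der_normalized_frame oD w_scalar ws aOm sOmD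
  sT sY1 sY2 wT wY1 kerw OmTY dw v1 v2 v3 Dz.
pose p z := Om z (T z) (Y2 z) (bracket Y1 Y2 z).
pose q z := Om z (T z) (bracket Y1 Y2 z) (Y1 z).
have sbr : smooth_on D (bracket Y1 Y2) by exact: bracket_smooth.
have sp : smooth_on D p by exact: smooth_three_form_apply.
have sq : smooth_on D q by exact: smooth_three_form_apply.
pose h z := - q z.
have sh : smooth_on D h.
  move=> m; apply: class_C_ext (class_CM oD (class_C_cst m D (-1 : R)) (sq m)) => // z _.
  by rewrite mulN1r.
(* [tau_vanishes] asks for Omega(Y1, Y2, Y3) = 1, whereas Om(T, Y2, Y1) = 1 means Om(Y1, Y2, T) =
   -1: the third field has to be -T. *)
pose T' z : E := - 1 *: T z.
have sT' : smooth_on D T'.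
  move=> m; apply: class_C_rV => // i.
  have C1T := class_CM oD (class_C_cst m D (-1 : R)) (class_C_coord i oD (sT m)).
  apply: class_C_ext C1T => // z _.
  by rewrite [RHS]mxE.
pose UB := [set x : B | D (chart x)].
have UBE : (chart : B -> E) @` UB = D by exact: chart_preimage_image.
have OmE x : Om (chart x) = Omega x by rewrite /Om chartK.
have diffable (W : normedModType R) (g : E -> W) z : smooth_on D g -> D z -> differentiable g z.
  by move=> sg; exact: (sg 1%N).1.
have chd (W : normedModType R) (g : E -> W) z v (sg : smooth_on D g) (Dz : D z) :=
  diff_chart_comp v oD DR Dz (diffable W g z sg Dz).
(* The left side is tau after substituting h = - q. The fields go to the body by composition with
   [chart], and [chd] brings their differentials back. *)
have tau0 z : D z -> 'd p z (Y1 z) - 'd q z (Y2 z) - 2 * p z * q z = 0.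
  move=> Dz; have Ux : UB (param z) by rewrite /UB /= paramK //; exact: DR.
  have pz : chart (param z : B) = z by apply: paramK; exact: DR.
  have := htau UB (Y1 \o chart) (Y2 \o chart) (T' \o chart) (p \o chart) (q \o chart)
    (h \o chart) _ _ _ _ _ _ _ _ _ _ (param z) Ux.
  rewrite /tau /body_diff /= pz => tz.
  have {}tz : 'd p z (Y1 z) + 'd h z (Y2 z) + p z * h z - p z * q z = 0.
    have aux (s t s' t' k l : R) : s = s' -> t = t' -> s + t + k - l = 0 -> s' + t' + k - l = 0.
      by move=> -> ->.
    apply: (aux _ _ _ _ _ _ (chd _ p z (Y1 z) sp Dz) (chd _ h z (Y2 z) sh Dz)).
    apply: tz.
    - by rewrite /body_open UBE.
    - exact: chart_comp_smooth.
    - exact: chart_comp_smooth.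
    - exact: chart_comp_smooth.
    - exact: chart_comp_smooth.
    - exact: chart_comp_smooth.
    - exact: chart_comp_smooth.
    - move=> x Dx; rewrite /= -OmE; have [_ L1E] := Y1P _ Dx; have [_ L2E] := Z2P' _ Dx.
      rewrite chartK in L1E L2E; rewrite L1E L2E memv_line memvZ ?memv_line //; split=> //.
      have [_ _ s3 _] := aOm (chart x); rewrite (scalar_formZ _ _ (s3 _ _)).
      rewrite (alternating3_swap12 (aOm _)) (alternating3_swap23 (aOm _)).
      by rewrite (alternating3_swap12 (aOm _)) OmTY //; ring.
    - move=> x Dx; rewrite lie_bracketE /bracket /= chartK.
      apply: (etrans (congr2 (fun s t => s - t) (chd _ Y2 (chart x) _ sY2 Dx)
        (chd _ Y1 (chart x) _ sY1 Dx))).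
      exact: brd.
    - move=> x Dx v1 v2 v3; rewrite (lie_derivativeE _ _ _ _ _ Omega_alternating).
      apply: etrans (_ : lie_der Om Y1 (chart x) v1 v2 v3 = _).
        have dY1 v := chd _ Y1 (chart x) v sY1 Dx.
        have YE : ((Y1 \o chart) \o (param : E -> B)) (chart x) = Y1 (chart x).
          by rewrite /= chartK.
        rewrite /lie_der; apply: (congr2 +%R); last first.
          exact: (congr1 (fun u => Om (chart x) v1 v2 u) (dY1 v3)).
        apply: (congr2 +%R); last exact: (congr1 (fun u => Om (chart x) v1 u v3) (dY1 v2)).
        apply: (congr2 +%R); last exact: (congr1 (fun u => Om (chart x) u v2 v3) (dY1 v1)).
        exact: (congr1 (fun u => 'd (fun y => Om y v1 v2 v3) (chart x) u) YE).
      by rewrite -OmE; exact: lieE.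
  have dh : 'd h z (Y2 z) = - 'd q z (Y2 z).
    exact: (congr1 (@^~ (Y2 z)) (diffN (diffable _ q z sq Dz))).
  have aux (s t t' k l : R) : t = - t' -> s + t + k * - l - k * l = 0 -> s - t' - 2 * k * l = 0.
    by move=> -> <-; ring.
  exact: aux dh tz.
have [U [Phi [G [[oU Ux0 UD oPU] [GK sPhi sG fr]]]]] :=
  flat_coordinates oD w_scalar ws aOm sOmD sT sY1 sY2 wT wY1 wY2 kerw OmTY dw Dx0 tau0.
have UR : U `<=` range (chart : B -> E) := subset_trans UD DR.
pose V := [set x : B | U (chart x)].
have VE : (chart : B -> E) @` V = U by exact: chart_preimage_image.
have PVE : (Phi \o chart) @` V = Phi @` U.
  by rewrite -VE image_comp.
have chartG y : (Phi @` U) y -> G y = (chart \o ((param : E -> B) \o G)) y.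
  by move=> [z Uz <-]; rewrite /= GK // paramK //; exact: UR.
exists V, (Phi \o chart), ((param : E -> B) \o G); split => //.
  split.
  - by rewrite /body_open VE.
  - by rewrite PVE.
  - by move=> x Ux; rewrite /= GK // chartK.
  - exact: chart_comp_smooth.
  - move=> m; rewrite PVE; apply: class_C_ext (sG m) => // y /set_mem; exact: chartG.
move=> e x Ux; have PU : (Phi @` U) (Phi (chart x)) by exists (chart x).
have eE i : e i x = 'd G (Phi (chart x)) (delta_mx 0 i).
  have dG : differentiable G (Phi (chart x)) by exact: (sG 1%N).1.
  have Gn : \forall y \near Phi (chart x), G y = (chart \o ((param : E -> B) \o G)) y.
    by apply: filterS (open_nbhs_nbhs (conj oPU PU)) => y /chartG.
  exact: (congr1 (@^~ (delta_mx 0 i)) (near_eq_diff Gn dG).2).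
have Dx := UD _ Ux.
have /= := fr (chart x) Ux; rewrite -!eE => -[we Ome [s s0 e1E] [t t0 e2E]].
have [_ L1E] := Y1P _ Dx; have [_ L2E] := Z2P' _ Dx; rewrite chartK in L1E L2E.
rewrite /w chartK in we; rewrite OmE in Ome.
split=> //.
- by apply: (alternating3_free (Omega_alternating x)); rewrite Ome oner_neq0.
- by rewrite L1E e2E vline_scale.
- by rewrite L2E e1E !vline_scale // invr_neq0 // th_neq0.
Qed.

End G2BStructure.

Theorem proposition6p11 (R : realType) (B : body R)
  (L1 L2 : B -> {vspace 'rV[R]_3})
  (omega : B -> 'rV[R]_3 -> R)
  (Omega : B -> 'rV[R]_3 -> 'rV[R]_3 -> 'rV[R]_3 -> R)
  (hL1 : line_distribution L1) (hL2 : line_distribution L2)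
  (hL12 : forall x : B, (L1 x :&: L2 x = 0)%VS)
  (homega : one_form omega)
  (homega0 : forall x : B, exists v : 'rV[R]_3, omega x v <> 0)
  (hker : forall (x : B) (v : 'rV[R]_3),
      v \in (L1 x + L2 x)%VS <-> omega x v = 0)
  (hOmega : volume_form Omega) :
  integrable_structure (G2B_structure L1 L2 omega Omega) <->
  [/\ involutive_distribution (fun x : B => (L1 x + L2 x)%VS),
      tau_vanishes L1 L2 Omega
    & forall (x : B) (v1 v2 : 'rV[R]_3), ext_deriv omega x v1 v2 = 0].
Proof.
split=> [hint|[_ htau dom]]; last exact: flat_integrable.
(* Closedness is established before involutivity, which is deduced from it. *)
have dom := integrable_closed homega hker hint.
split=> //; first exact: (closed_involutive homega hker dom).
exact: (integrable_tau hOmega hint).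
Qed.
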